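(* Let $F=\mathbb{Q}(\sqrt5)$ with ring of integers $\mathbb{Z}_F$, let $\beta\in\mathbb{Z}_F$ be a totally positive prime, and let $\Psi_{\beta,m}$ for $m\in\{1,2\}$ denote the Hilbert modular equations of level $\beta$ in Gundlach invariants. Let $\mathcal{F}\in\mathbb{Q}(J_1,J_2)$ be a coefficient of $\Psi_{\beta,1}$ or $\Psi_{\beta,2}$. Then the total degree of $\mathcal{F}$ is bounded above by $10\,d(\beta)/3$, where $d(\beta)=N_{F/\mathbb{Q}}(\beta)+1$.
   Context: Let $\mathbb{Z}_F^\vee$ be the dual of $\mathbb{Z}_F$ for the trace form and $\Gamma=\mathrm{SL}(\mathbb{Z}_F\oplus\mathbb{Z}_F^\vee)$, i.e. the group of matrices $\left(\begin{smallmatrix}a&b\\c&d\end{smallmatrix}\right)$ of determinant 1 with $a,d\in\mathbb{Z}_F$, $c\in\mathbb{Z}_F^\vee$, $b\in(\mathbb{Z}_F^\vee)^{-1}$. It acts on $\mathbb{H}_1^2$ (two copies of the complex upper half-plane) via the two real embeddings of $F$. Let $\sigma$ be the involution $(\tau_1,\tau_2)\mapsto(\tau_2,\tau_1)$. Hilbert modular forms of weight $w$ means parallel weight $(w,w)$ and level $\Gamma$; they are symmetric if invariant under $\sigma$, and defined over $\mathbb{Q}$ if their Fourier coefficients are rational. By Gundlach, the graded $\mathbb{Q}$-algebra of symmetric Hilbert modular forms of even weight defined over $\mathbb{Q}$ is free on three generators $F_2,F_6,F_{10}$ of weights $2,6,10$; fix such generators. The Gundlach invariants are $g_1=F_2^5/F_{10}$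 and $g_2=F_2^2F_6/F_{10}$; they are algebraically independent and generate over $\mathbb{Q}$ the field of symmetric modular functions on $\Gamma\backslash\mathbb{H}_1^2$ defined over $\mathbb{Q}$. Let $g_{i,\beta}(\tau)=g_i(\tau/\beta)$, where $\tau/\beta$ means dividing each coordinate by the corresponding real conjugate of $\beta$. Let $\Gamma_0$ be the group of transformations of $\mathbb{H}_1^2$ generated by $\Gamma$ and $\sigma$, acting on functions by $(\gamma\cdot f)(\tau)=f(\gamma^{-1}\tau)$, and let $\Gamma_1$ (resp. $\Gamma_2$) be the stabilizer in $\Gamma_0$ of $g_{1,\beta}$ (resp. of both $g_{1,\beta}$ and $g_{2,\beta}$). The Hilbert modular equations of level $\beta$ are $$\Psi_{\beta,1}=\prod_{\gamma\in\Gamma_0/\Gamma_1}(Y_1-\gamma\cdot g_{1,\beta}),\qquad \Psi_{\beta,2}=\sum_{\gamma\in\Gamma_0/\Gamma_1}\Bigl(\prod_{\gamma_1\in\Gamma_0/\Gamma_1,\ \gamma_1\neq\gamma}(Y_1-\gamma_1\cdot g_{1,\beta})\Bigr)\prod_{\gamma_2\in\Gamma_1/\Gamma_2}(Y_2-\gamma\gamma_2\cdot g_{2,\beta}).$$ Their coefficients (as polynomials in $Y_1,Y_2$) lie in $\mathbb{Q}(g_1,g_2)$ and are identified with elements of $\mathbb{Q}(J_1,J_2)$. The total degree of a rational fraction $P/Q$ in lowest terms is $\max\{\deg P,\deg Q\}$, where $\deg$ is the total degree. *)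

(* Defs.v *)
From HB Require Import structures.
From mathcomp Require Import all_boot all_order all_algebra all_field.
From mathcomp Require Import finmap fraction mpoly complex.
From mathcomp Require Import boolp classical_sets functions reals.
From mathcomp Require Import topology normedtype sequences derive exp trigo summability.
From mathcomp Require Import ring lra.

Set Implicit Arguments.
Unset Strict Implicit.
Unset Printing Implicit Defensive.

Import Order.TTheory GRing.Theory Num.Theory.
Import numFieldNormedType.Exports.

Local Open Scope complex_scope.
Local Open Scope classical_set_scope.
Local Open Scope ring_scope.

Record bijection (T : Type) := Bijection {
  bij_fun :> T -> T;
  bij_inv : T -> T;
  bij_funK : cancel bij_fun bij_inv;
  bij_invK : cancel bij_inv bij_fun }.

HB.instance Definition _ (T : Type) := gen_eqMixin (bijection T).
HB.instance Definition _ (T : Type) := gen_choiceMixin (bijection T).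

Section BijectionGroup.
Variable T : Type.
Implicit Types f g h : bijection T.

Lemma bijection_eq f g : f =1 g -> f = g.
Proof.
case: f g => [f f' fK f'K] [g g' gK g'K] /= /funext fg; rewrite -{}fg in gK g'K *.
have gf' : g' = f' by apply/funext => x; rewrite -[x in RHS]g'K fK.
rewrite {}gf' in gK g'K *.
by rewrite (Prop_irrelevance gK fK) (Prop_irrelevance g'K f'K).
Qed.

Definition bij_one : bijection T :=
  @Bijection T id id (fun=> erefl) (fun=> erefl).

Definition bij_mul f g : bijection T :=
  Bijection (can_comp (bij_funK f) (bij_funK g))
            (can_comp (bij_invK g) (bij_invK f)).

Definition bij_opp f : bijection T := Bijection (bij_invK f) (bij_funK f).

Fact bij_mulA : associative bij_mul. Proof. by move=> f g h; apply: bijection_eq. Qed.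
Fact bij_mul1 : left_id bij_one bij_mul. Proof. by move=> f; apply: bijection_eq. Qed.
Fact bij_1mul : right_id bij_one bij_mul. Proof. by move=> f; apply: bijection_eq. Qed.
Fact bij_mulV : left_inverse bij_one bij_opp bij_mul.
Proof. by move=> f; apply: bijection_eq => x /=; rewrite bij_funK. Qed.
Fact bij_Vmul : right_inverse bij_one bij_opp bij_mul.
Proof. by move=> f; apply: bijection_eq => x /=; rewrite bij_invK. Qed.

HB.instance Definition _ := isGroup.Build (bijection T)
  bij_mulA bij_mul1 bij_1mul bij_mulV bij_Vmul.
End BijectionGroup.

Section Groups.
Local Open Scope group_scope.
Variable G : groupType.
Implicit Types (A H : set G) (s : seq G).

Definition subgroup H := H 1 /\ forall x y, H x -> H y -> H (x * y^-1).

Definition generated A : set G := smallest subgroup A.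

(* s lists exactly one representative of each left coset xH contained in A. *)
Definition left_transversal A H s :=
  [/\ uniq s, forall x, x \in s -> A x &
      forall x, A x -> exists! y, y \in s /\ H (y^-1 * x)].

End Groups.

Section UpperHalfPlanes.
Variable R : realType.
Local Notation C := (R[i]).

Definition upper2 (z : C * C) : bool := (0 < complex.Im z.1) && (0 < complex.Im z.2).

Definition H2 := {z : C * C | upper2 z}.

Fact upper2_i : upper2 ('i, 'i).
Proof. by rewrite /upper2 /= ltr01. Qed.

(* Coincides with the identity on upper2, and is constant elsewhere; it is only
   applied to elements of upper2, see val_mobius2, val_swap and val_scaleV. *)
Definition toH2 (z : C * C) : H2 := insubd (Sub ('i, 'i) upper2_i) z.

Definition swap (t : H2) : H2 := toH2 ((val t).2, (val t).1).

Lemma val_swap t : val (swap t) = ((val t).2, (val t).1).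
Proof. by rewrite insubdK // unfold_in /upper2 andbC; apply: (valP t). Qed.

(* The topology and differential structure of C * C over C itself. *)
Local Notation Cn := (C^o)%type.

Definition extend0 (f : H2 -> C) (z : Cn * Cn) : Cn := oapp f 0 (insub (z : C * C)).

Definition holomorphic (f : H2 -> C) :=
  forall t : H2, differentiable (extend0 f) (val t : Cn * Cn).

(* P holds on a dense open subset of H2. A meromorphic function is represented by
   any function H2 -> C agreeing with it on a dense open subset (quotients take
   junk values at the poles), so equality of meromorphic functions is generic
   equality. *)
Definition generically (P : H2 -> Prop) :=
  exists U : set (Cn * Cn),
    [/\ open U, [set z | upper2 z] `<=` closure U & forall t : H2, U (val t) -> P t].

Definition exp2ipi (z : C) : C :=
  let x := 2 * pi * complex.Re z in
  (expR (- (2 * pi * complex.Im z)))%:C * (cos x +i* sin x).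

Definition act (g : bijection H2) (f : H2 -> C) : H2 -> C := fun t => f ((g^-1)%g t).

Definition stabilizer (A : set (bijection H2)) (f : H2 -> C) : set (bijection H2) :=
  [set g | A g /\ generically (fun t => act g f t = f t)].

End UpperHalfPlanes.

Definition eval_Q (R : realType) n (p : {mpoly rat[n]}) (v : 'I_n -> R[i]) : R[i] :=
  (map_mpoly ratr p).@[v].

(* i1 and i2 are meant to be the two real embeddings of the real quadratic field F. *)
Section Field.
Variables (R : realType) (F : fieldExtType rat) (i1 i2 : {rmorphism F -> R}).
Local Notation C := (R[i]).
Local Notation H2 := (H2 R).

Definition ZF : set F := [set x | integralOver (intr : int -> F) x].

Definition trace (x : F) : R := i1 x + i2 x.
Definition norm (x : F) : R := i1 x * i2 x.

Definition trace_dual (L : set F) : set F :=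
  [set x | forall y, L y -> trace (x * y) \is a Num.int].

Definition ideal_inv (L : set F) : set F := [set x | forall y, L y -> ZF (x * y)].

Definition ZFv : set F := trace_dual ZF.

Definition tot_positive (x : F) := 0 < i1 x /\ 0 < i2 x.

Definition prime_elt (b : F) :=
  [/\ ZF b, b != 0, ~ ZF b^-1 &
      forall x y, ZF x -> ZF y -> ZF (x * y / b) -> ZF (x / b) \/ ZF (y / b)].

Definition Gamma : set 'M[F]_2 :=
  [set M | [/\ \det M = 1, ZF (M 0 0), ideal_inv ZFv (M 0 1), ZFv (M 1 0) & ZF (M 1 1)]].

Definition mobius (i : {rmorphism F -> R}) (M : 'M[F]_2) (z : C) : C :=
  ((i (M 0 0))%:C * z + (i (M 0 1))%:C) / ((i (M 1 0))%:C * z + (i (M 1 1))%:C).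

Definition mobius2 (M : 'M[F]_2) (t : H2) : H2 :=
  toH2 (mobius i1 M (val t).1, mobius i2 M (val t).2).

Definition scaleV (b : F) (t : H2) : H2 :=
  toH2 ((val t).1 / (i1 b)%:C, (val t).2 / (i2 b)%:C).

Lemma det2 (K : comNzRingType) (M : 'M[K]_2) : \det M = M 0 0 * M 1 1 - M 0 1 * M 1 0.
Proof.
rewrite (expand_det_row _ 0) big_ord_recl big_ord1 /cofactor !det_mx11 !mxE /=.
rewrite expr0 expr1 !mul1r mulN1r mulrN; congr (_ * M _ _ - M _ _ * M _ _);
  exact: val_inj.
Qed.

Lemma mobius_den (i : {rmorphism F -> R}) (M : 'M[F]_2) (z : C) :
  \det M = 1 -> 0 < complex.Im z -> (i (M 1 0))%:C * z + (i (M 1 1))%:C != 0.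
Proof.
rewrite det2 => /(congr1 i); rewrite rmorphB !rmorphM rmorph1.
case: z => x y /= hM y0; apply/eqP => -[].
rewrite !mul0r !(addr0, subr0, add0r) => h1 /eqP; rewrite mulf_eq0 (gt_eqF y0) orbF.
by move=> /eqP c0; move: hM h1; rewrite c0; nra.
Qed.

Lemma Im_mobius (i : {rmorphism F -> R}) (M : 'M[F]_2) (z : C) :
  \det M = 1 -> 0 < complex.Im z -> 0 < complex.Im (mobius i M z).
Proof.
move=> hM hz; have := mobius_den i hM hz; move: hM hz; rewrite /mobius.
rewrite det2 => /(congr1 i); rewrite rmorphB !rmorphM rmorph1.
move: (i (M 0 0)) (i (M 0 1)) (i (M 1 0)) (i (M 1 1)) => a b c d.
case: z => x y /= hM y0; rewrite eq_complex /= => h.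
set D := _ ^+ 2 + _ ^+ 2.
have D0 : 0 < D.
  rewrite /D lt0r paddr_eq0 ?sqr_ge0 // !sqrf_eq0 h /=.
  by rewrite addr_ge0 ?sqr_ge0.
suff -> : forall u v, (a * x - 0 * y + b) * - (u / D) + (a * y + 0 * x + 0) * (v / D)
    = ((a * y) * v - (a * x + b) * u) / D.
  apply: divr_gt0 => //.
  have -> : a * y * (c * x - 0 * y + d) - (a * x + b) * (c * y + 0 * x + 0)
    = y * (a * d - b * c) by ring.
  by rewrite hM mulr1.
by move=> u v; ring.
Qed.

Lemma val_mobius2 (M : 'M[F]_2) (t : H2) : \det M = 1 ->
  val (mobius2 M t) = (mobius i1 M (val t).1, mobius i2 M (val t).2).
Proof.
move=> hM; rewrite insubdK //; have /andP[t1 t2] := valP t.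
by apply/andP; split; apply: Im_mobius.
Qed.

Lemma val_scaleV (b : F) (t : H2) : tot_positive b ->
  val (scaleV b t) = ((val t).1 / (i1 b)%:C, (val t).2 / (i2 b)%:C).
Proof.
have Im_div (z : C) (r : R) : 0 < r -> 0 < complex.Im z -> 0 < complex.Im (z / r%:C).
  case: z => x y r0 /= y0.
  rewrite expr0n addr0 mul0r oppr0 mulr0 add0r mulr_gt0 //.
  by rewrite divr_gt0 // exprn_gt0.
case=> b1 b2; rewrite insubdK //; have /andP[t1 t2] := valP t.
by apply/andP; split; apply: Im_div.
Qed.

Lemma mobius_mul (i : {rmorphism F -> R}) (M N : 'M[F]_2) (z : C) :
  \det N = 1 -> \det (M *m N) = 1 -> 0 < complex.Im z ->
  mobius i M (mobius i N z) = mobius i (M *m N) z.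
Proof.
move=> hN hMN hz; have := mobius_den i hMN hz; have := mobius_den i hN hz.
rewrite /mobius !mxE !big_ord_recl !big_ord0 !addr0 /=.
have -> : lift ord0 ord0 = 1 :> 'I_2 by exact: val_inj.
rewrite !rmorphD !rmorphM /=.
move: (i (M 0 0))%:C (i (M 0 1))%:C (i (M 1 0))%:C (i (M 1 1))%:C.
move: (i (N 0 0))%:C (i (N 0 1))%:C (i (N 1 0))%:C (i (N 1 1))%:C.
move=> a b c d a' b' c' d' h1 h2.
have h3 : c' * ((a * z + b) / (c * z + d)) + d' != 0.
  apply/eqP => e; move/eqP: h2; apply.
  by transitivity ((c' * ((a * z + b) / (c * z + d)) + d') * (c * z + d));
    [field | rewrite e mul0r].
have -> : (c' * a + d' * c) * z + (c' * b + d' * d)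
  = (c' * ((a * z + b) / (c * z + d)) + d') * (c * z + d) by field.
have -> : (a' * a + b' * c) * z + (a' * b + b' * d)
  = (a' * ((a * z + b) / (c * z + d)) + b') * (c * z + d) by field.
by rewrite -mulf_div divff // mulr1.
Qed.

Lemma mobius2_bij (M : 'M[F]_2) : \det M = 1 ->
  exists g : bijection H2, (g : H2 -> H2) =1 mobius2 M.
Proof.
have mobius1 (i : {rmorphism F -> R}) z : mobius i 1%:M z = z.
  rewrite /mobius !mxE /= rmorph1 rmorph0 rmorph1 rmorph0.
  by rewrite !(mul1r, mul0r) addr0 add0r divr1.
have K (A B : 'M[F]_2) : \det A = 1 -> \det B = 1 -> A *m B = 1%:M ->
    cancel (mobius2 B) (mobius2 A).
  move=> hA hB AB t; have /andP[t1 t2] := valP t; apply: val_inj.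
  rewrite !val_mobius2 //= !mobius_mul ?AB ?det1 // !mobius1.
  by case: (val t).
move=> hM; have uM : M \in unitmx by rewrite unitmxE hM unitr1.
have hV : \det (invmx M) = 1 by rewrite det_inv hM invr1.
by exists (Bijection (K _ _ hV hM (mulVmx uM)) (K _ _ hM hV (mulmxV uM))).
Qed.

Definition Gamma0 : set (bijection H2) :=
  generated [set g : bijection H2 |
    (exists2 M, Gamma M & (g : H2 -> H2) =1 mobius2 M) \/ (g : H2 -> H2) =1 @swap R].

(* Holomorphy at the cusps is automatic in two variables (Koecher). *)
Definition hilbert_form (w : nat) (f : H2 -> C) :=
  holomorphic f /\
  forall (M : 'M[F]_2) (t : H2), Gamma M ->
    f (mobius2 M t) = ((i1 (M 1 0))%:C * (val t).1 + (i1 (M 1 1))%:C) ^+ w *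
                      ((i2 (M 1 0))%:C * (val t).2 + (i2 (M 1 1))%:C) ^+ w * f t.

Definition symmetric_form (f : H2 -> C) := forall t, f (swap t) = f t.

(* Forms are invariant under the translations by ideal_inv ZFv, so their Fourier
   exponents lie in its trace dual; the sum is unconditional. *)
Definition defined_over_Q (f : H2 -> C) :=
  exists a : F -> rat,
    (forall nu, a nu != 0 -> trace_dual (ideal_inv ZFv) nu) /\
    forall t : H2,
      partial_sum (fun nu => (ratr (a nu) *
        exp2ipi ((i1 nu)%:C * (val t).1 + (i2 nu)%:C * (val t).2) : C^o)) A
        @[A --> totally] --> (f t : C^o).

Definition sym_form_Q (w : nat) (f : H2 -> C) :=
  [/\ hilbert_form w f, symmetric_form f & defined_over_Q f].

(* The graded algebra of forms of even weight is free on F2, F6, F10: each form of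
   even weight w is a unique isobaric polynomial of weight w in them. *)
Definition gundlach_generators (F2 F6 F10 : H2 -> C) :=
  let gens t (i : 'I_3) := nth 0 [:: F2 t; F6 t; F10 t] i in
  let weight (m : 'X_{1..3}) := (\sum_(i < 3) m i * nth 0 [:: 2; 6; 10] i)%N in
  [/\ sym_form_Q 2 F2, sym_form_Q 6 F6, sym_form_Q 10 F10 &
      forall w f, ~~ odd w -> sym_form_Q w f ->
        exists! p : {mpoly rat[3]},
          (forall m, m \in msupp p -> weight m = w) /\
          forall t, f t = eval_Q p (gens t)].

Definition g1 (F2 F10 : H2 -> C) : H2 -> C := fun t => F2 t ^+ 5 / F10 t.
Definition g2 (F2 F6 F10 : H2 -> C) : H2 -> C := fun t => F2 t ^+ 2 * F6 t / F10 t.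

End Field.

Section ModularEquations.
Variable R : realType.
Local Notation C := (R[i]).
Local Notation H2 := (H2 R).

(* s1 and s2 stand for transversals of Gamma0/Gamma1 and Gamma1/Gamma2; the
   polynomials are formed pointwise in t, and up to generic equality they do not
   depend on the transversals. *)
Definition Psi1 (h1 : H2 -> C) (s1 : seq (bijection H2)) (t : H2) : {mpoly C[2]} :=
  \prod_(g <- s1) ('X_0 - (act g h1 t)%:MP).

Definition Psi2 (h1 h2 : H2 -> C) (s1 s2 : seq (bijection H2)) (t : H2) :
    {mpoly C[2]} :=
  \sum_(g <- s1)
    (\prod_(g' <- s1 | g' != g) ('X_0 - (act g' h1 t)%:MP)) *
    (\prod_(g' <- s2) ('X_1 - (act (g * g')%g h2 t)%:MP)).

(* The meromorphic function c is f(h1, h2). *)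
Definition fraction_value (h1 h2 : H2 -> C) (f : {fraction {mpoly rat[2]}})
    (c : H2 -> C) :=
  exists P Q : {mpoly rat[2]},
    [/\ Q != 0, f = tofrac P / tofrac Q &
        generically (fun t =>
          let v (i : 'I_2) := nth 0 [:: h1 t; h2 t] i in
          eval_Q Q v != 0 /\ c t = eval_Q P v / eval_Q Q v)].

Definition is_coefficient (h1 h2 : H2 -> C) (Psi : H2 -> {mpoly C[2]})
    (f : {fraction {mpoly rat[2]}}) :=
  exists m : 'X_{1..2}, fraction_value h1 h2 f (fun t => (Psi t)@_m).

End ModularEquations.

Section TotalDegree.
Variables (n : nat) (K : fieldType).
Implicit Types (P Q D : {mpoly K[n]}) (f : {fraction {mpoly K[n]}}).

Definition coprime_mpoly P Q :=
  forall D A B, P = D * A -> Q = D * B -> D \is a GRing.unit.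

Definition lowest_terms f (PQ : {mpoly K[n]} * {mpoly K[n]}) :=
  [/\ PQ.2 != 0, coprime_mpoly PQ.1 PQ.2 & f = tofrac PQ.1 / tofrac PQ.2].

Definition mpoly_degree P : nat := (msize P).-1.

Definition total_degree f : nat :=
  let PQ := xget (0, 1) (lowest_terms f) in
  maxn (mpoly_degree PQ.1) (mpoly_degree PQ.2).

End TotalDegree.

(* Main.v *)
(* Each element of Gamma0 changes [g_i (t / beta)] into [g_i (T t)], where T is the
   action of one of N(beta) + 1 upper triangular matrices of determinant beta, possibly
   preceded by the exchange of the coordinates; distinct cosets give distinct T. The
   product D of the [F10 (T t)] over all T clears the denominators of both modular
   equations, and it is a symmetric form of weight w = 20 (N(beta) + 1). It is defined
   over Q because raising the roots of unity in the coefficients of its factors to a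
   power permutes these factors. So a coefficient of a modular equation is n / D with n
   holomorphic, and as it is a rational fraction in g_1 and g_2, n is also symmetric,
   modular of weight w and defined over Q. By Gundlach, n and D are isobaric polynomials
   of weight w in F2, F6, F10. The substitution F2 = J1, F6 = J1^2 J2, F10 = J1^4, for
   which g_1 = J1 and g_2 = J2, makes them polynomials in J1 and J2 which, up to the same
   power of J1, have degree at most w / 6. *)
Require Import Defs.
From HB Require Import structures.
From mathcomp Require Import all_boot all_order all_algebra all_field.
From mathcomp Require Import finmap fraction mpoly complex.
From mathcomp Require Import boolp classical_sets functions reals.
From mathcomp Require Import topology normedtype landau sequences derive exp trigo summability.
From mathcomp Require Import ring lra zify.

Set Implicit Arguments.
Unset Strict Implicit.
Unset Printing Implicit Defensive.

Import Order.TTheory GRing.Theory Num.Theory.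
Import numFieldNormedType.Exports.

Local Open Scope complex_scope.
Local Open Scope classical_set_scope.
Local Open Scope ring_scope.

(** * Bivariate polynomials *)

(** One product D is enough for [Psi2] too. Elements of Gamma1 fix the first invariant, so within
    one summand the maps T of the factors in Y2 differ from each other and from those of the factors
    in Y1, and each denominator occurs once. The degree of the lowest terms is at most that of any
    other representation because Q[J1, J2] has unique factorization, reached through Gauss's lemma.

    The analysis runs on absolutely convergent Fourier series. Koecher's principle makes their
    exponents totally nonnegative, so a product is a finite convolution on coefficients. Uniqueness
    of the coefficients comes from averaging over translations, and finite differences along real
    translations show that a nonzero series has no open set of zeros.

    For the rationality of D, let p be a rational prime divisible by beta and zeta a primitive p-th
    root of unity. The coefficients of the product over the matrices with corner 1 are values
    P(zeta) of rational polynomials. Replacing zeta by zeta^k gives the same product, so P(zeta^k)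
    is constant for 0 < k < p, and the sum of these values is rational. *)

Section GaussLemma.
Variable K : fieldType.
Implicit Types (c d e : {poly K}) (A B G P Q : {poly {poly K}}).

Lemma ex_irreducible_factor c : c != 0 -> (1 < size c)%N ->
  exists2 d, irreducible_poly d & d %| c.
Proof.
have [n] := ubnP (size c); elim: n c => // n IH c ltn c0 c1.
have [irr|red] := pselect (irreducible_poly c); first by exists c.
have [d [d1 dc dNc]] : exists d, [/\ size d != 1%N, d %| c & ~~ (d %= c)].
  apply: contrapT => none; apply: red; split=> // d d1 dc.
  by apply/negPn/negP => dNc; apply: none; exists d.
have d0 : d != 0 by apply: contraTneq dc => ->; rewrite dvd0p.
have szd : (size d < size c)%N.
  rewrite ltn_neqAle dvdp_leq // andbT; apply: contra dNc => /eqP e.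
  by rewrite -dvdp_size_eqp // e.
have [||e irr ed] := IH d _ d0.
- by rewrite (leq_trans szd).
- by move: d1; rewrite -size_poly_eq0 in d0; case: (size d) d0 => [|[]].
by exists e => //; apply: dvdp_trans dc.
Qed.

Lemma size_mul_irreducible d c : irreducible_poly d -> c != 0 ->
  (size c < size (c * d)%R)%N.
Proof.
move=> irr c0; have d0 := irredp_neq0 irr; rewrite size_mul //; have [d1 _] := irr.
by move: d1; case: (size d) => [|[|m]] // _; rewrite !addnS ltnS leq_addr.
Qed.

(** Gauss's lemma: [d] divides the leading coefficient of [A] or of [B], and removing that leading
    term keeps the divisibility of the product while lowering the total size. *)
Lemma irreducible_polyC_prime d A B G : irreducible_poly d ->
  A * B = d%:P * G -> (exists A', A = d%:P * A') \/ (exists B', B = d%:P * B').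
Proof.
move=> irr; have primed c e : d %| c * e -> d %| c \/ d %| e.
  move=> dce; have [|dNc] := boolP (d %| c); [by left | right].
  by rewrite -(Gauss_dvdpr e (_ : coprimep d c)) ?(irreducible_poly_coprime _ irr).
have [n] := ubnP (size A + size B); elim: n A B G => // n IH A B G.
wlog dA : A B / d %| lead_coef A => [hw|].
  move=> ltn e; have /primed[dA|dB] : d %| lead_coef A * lead_coef B.
  - by rewrite -lead_coefM e lead_coefM lead_coefC dvdp_mulr.
  - exact: hw.
  - by rewrite addnC mulrC in ltn e; have := hw B A dB ltn e; case; [right | left].
have [->|A0] := eqVneq A 0; first by left; exists 0; rewrite mulr0.
move=> ltn e; have /dvdpP[q eq] := dA.
set M : {poly {poly K}} := lead_coef A *: 'X^((size A).-1) in e *.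
have eM : M = d%:P * (q *: 'X^((size A).-1)).
  by rewrite /M eq mulrC -scalerA mul_polyC.
have ltA : (size (A - M)%R < size A)%N.
  have := A0; rewrite -size_poly_gt0 => /prednK <-; rewrite ltnS; apply/leq_sizeP => j.
  rewrite leq_eqVlt => /predU1P[<-|ltj].
    by rewrite coefB coefZ coefXn eqxx mulr1 subrr.
  rewrite coefB coefZ coefXn gtn_eqF // mulr0 subr0 nth_default //.
  by rewrite -(prednK (n := size A)) ?size_poly_gt0.
have [||[A' eA']|] := IH (A - M) B (G - (q *: 'X^((size A).-1)) * B); last by right.
- by rewrite -ltnS (leq_trans _ ltn) // ltnS ltn_add2r.
- by rewrite mulrBl e mulrBr eM mulrA.
left; exists (A' + q *: 'X^((size A).-1)).
by rewrite mulrDr -eA' -eM subrK.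
Qed.

(* Dividing both sides of [c A = B G] by the irreducible factors of c. *)
Lemma primitive_dvd c A B G : c != 0 ->
  (forall d A', irreducible_poly d -> G != d%:P * A') ->
  c%:P * A = B * G -> exists B', A = B' * G.
Proof.
move=> + prG; have [n] := ubnP (size c); elim: n c B => // n IH c B ltn c0 e.
have [c1|c1] := leqP (size c) 1.
  move: e; rewrite (size1_polyC c1) => e.
  have u0 : c`_0 != 0 by apply: contraNneq c0 => u0; rewrite (size1_polyC c1) u0.
  exists ((c`_0)^-1%:P%:P * B).
  by rewrite -mulrA -e mulrA -!polyCM mulVf // !polyC1 mul1r.
have [d irr /dvdpP[q eq]] := ex_irreducible_factor c0 c1.
have d0 := irredp_neq0 irr.
have q0 : q != 0 by apply: contraNneq c0 => q0; rewrite eq q0 mul0r.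
have eBG : B * G = d%:P * (q%:P * A) by rewrite -e eq mulrA -polyCM (mulrC d).
have [[B' eB]|[G' eG]] := irreducible_polyC_prime irr eBG; last first.
  by have := prG _ G' irr; rewrite eG eqxx.
apply: (IH q B') => //.
  by rewrite -ltnS (leq_trans _ ltn) // ltnS eq size_mul_irreducible.
apply: (@mulfI _ d%:P); first by rewrite polyC_eq0.
by rewrite [RHS]mulrA -eB eBG.
Qed.

(** Irreducible constants are split off one at a time; each of them shrinks the leading
    coefficient. *)
Lemma ex_primitive_part G : G != 0 -> exists g G0, [/\ g != 0, G = g%:P * G0 &
  forall d A, irreducible_poly d -> G0 != d%:P * A].
Proof.
have [n] := ubnP (size (lead_coef G)); elim: n G => // n IH G ltn G0.
have [pr|] := pselect (forall d A, irreducible_poly d -> G != d%:P * A).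
  by exists 1, G; rewrite oner_eq0 mul1r.
move=> /existsNP[d] /existsNP[A] /not_implyP[irr /negP/negPn/eqP eG].
have A0 : A != 0 by apply: contraNneq G0 => A0; rewrite eG A0 mulr0.
have d0 := irredp_neq0 irr.
have [|//|g [G1 [g0 e1 pr]]] := IH A.
  rewrite -ltnS (leq_trans _ ltn) // ltnS eG lead_coefM lead_coefC mulrC.
  by rewrite size_mul_irreducible // lead_coef_eq0.
exists (d * g), G1; split=> //; first by rewrite mulf_neq0.
by rewrite eG e1 polyCM mulrA.
Qed.

(** Over [{poly K}], [gcdp] and divisibility only make sense up to constants of K[x], that is over
    K(x). Coprimality in terms of units is first turned into coprimality over K(x); Gauss's lemma
    then removes the constant [c] left by pseudo-division. *)
Lemma coprime_bivariate_fraction P Q P' Q' : Q != 0 ->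
  (forall D A B, P = D * A -> Q = D * B -> D \is a GRing.unit) ->
  P * Q' = P' * Q -> exists2 D, P' = D * P & Q' = D * Q.
Proof.
move=> Q0 cop e.
have [P0|P0] := eqVneq P 0.
  have uQ : Q \is a GRing.unit by apply: (cop Q 0 1); rewrite ?mulr0 ?mulr1.
  exists (Q' / Q); last by rewrite divrK.
  by move/eqP: e; rewrite P0 mul0r mulr0 eq_sym mulf_eq0 (negPf Q0) orbF => /eqP.
(* The primitive part of a gcd over K(x) divides [P] and [Q] without any constant, so it is a
   unit. *)
have sG : coprimep P Q.
  set G := gcdp P Q; have G0 : G != 0 by rewrite gcdp_eq0 (negPf Q0) andbF.
  have [g [G1 [g0 eG pr]]] := ex_primitive_part G0.
  have div A : G %| A -> exists B, A = B * G1.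
    move=> /Pdiv.Idomain.dvdpP[[c B] /= c0 eA].
    apply: (@primitive_dvd c A (B * g%:P) G1 c0 pr).
    by rewrite mul_polyC eA eG mulrA.
  have [A eA] := div _ (dvdp_gcdl P Q); have [B eB] := div _ (dvdp_gcdr P Q).
  have : G1 \is a GRing.unit by apply: (cop G1 A B); rewrite mulrC.
  rewrite poly_unitE => /andP[s1 _].
  by rewrite /coprimep -/G eG mul_polyC size_scale.
have : P %| P' by rewrite -(Gauss_dvdpl _ sG) -e dvdp_mulr.
case/Pdiv.Idomain.dvdpP => [[c A] /= c0]; rewrite -mul_polyC => eP'.
have eQ' : c%:P * Q' = A * Q.
  by apply: (mulfI P0); rewrite mulrCA e mulrA eP' mulrAC mulrC mulrA mulrC (mulrC Q).
(* An irreducible factor [d] of [c] divides [A * P] and [A * Q] but not both [P] and [Q], so it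
   divides [A] and can be cancelled. *)
have [n] := ubnP (size c); elim: n c A c0 eP' eQ' => // n IH c A c0 eP' eQ' ltn.
have [c1|c1] := leqP (size c) 1.
  move: eP' eQ'; rewrite (size1_polyC c1).
  have u0 : c`_0 != 0 by apply: contraNneq c0 => u0; rewrite (size1_polyC c1) u0.
  have K1 : (c`_0)^-1%:P%:P * (c`_0)%:P%:P = 1 :> {poly {poly K}}.
    by rewrite -!polyCM mulVf.
  move=> eP' eQ'; exists ((c`_0)^-1%:P%:P * A).
    by rewrite -mulrA -eP' mulrA K1 mul1r.
  by rewrite -mulrA -eQ' mulrA K1 mul1r.
have [d irr /dvdpP[q eq]] := ex_irreducible_factor c0 c1.
have d0 := irredp_neq0 irr.
have q0 : q != 0 by apply: contraNneq c0 => q0; rewrite eq q0 mul0r.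
have shift B : c%:P * B = d%:P * (q%:P * B) by rewrite mulrA -polyCM (mulrC d) -eq.
have eAP : A * P = d%:P * (q%:P * P') by rewrite -shift.
have eAQ : A * Q = d%:P * (q%:P * Q') by rewrite -shift.
have [A' eA] : exists A', A = d%:P * A'.
  have [//|[P1 eP1]] := irreducible_polyC_prime irr eAP.
  have [//|[Q1 eQ1]] := irreducible_polyC_prime irr eAQ.
  have := cop d%:P P1 Q1 eP1 eQ1; rewrite poly_unitE coefC eqxx => /andP[_].
  by rewrite poly_unitE => /andP[/eqP d1]; case: irr; rewrite d1.
have dP0 : d%:P != 0 :> {poly {poly K}} by rewrite polyC_eq0.
apply: (IH q A') => //.
- by apply: (mulfI dP0); rewrite -eAP eA mulrA.
- by apply: (mulfI dP0); rewrite -eAQ eA mulrA.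
by rewrite -ltnS (leq_trans _ ltn) // ltnS eq size_mul_irreducible.
Qed.
End GaussLemma.

Section TwoVariables.
Variable K : fieldType.

Definition iterated : {mpoly K[2]} -> {poly {poly K}} :=
  mmap (polyC \o polyC) (fun i => if i == 0 then 'X%:P else 'X).

Definition uniterated : {poly {poly K}} -> {mpoly K[2]} :=
  horner_eval 'X_1 \o map_poly (horner_eval 'X_0 \o map_poly (@mpolyC 2 K)).

HB.instance Definition _ := GRing.RMorphism.on iterated.
HB.instance Definition _ := GRing.RMorphism.on uniterated.

Lemma iteratedK : cancel iterated uniterated.
Proof.
have XK i : uniterated (if i == 0 :> 'I_2 then 'X%:P else 'X) = 'X_i.
  have [->|i0] := eqVneq i 0.
    by rewrite /uniterated /= map_polyC /= map_polyX /horner_eval hornerX hornerC.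
  rewrite /uniterated /= map_polyX /horner_eval hornerX.
  by congr 'X__; apply: val_inj; case: i i0 => [[|[|]]].
have CK c : uniterated c%:P%:P = c%:MP.
  by rewrite /uniterated /= map_polyC /= map_polyC /horner_eval !hornerC.
move=> p; rewrite /iterated /mmap rmorph_sum [RHS]mpolyE; apply: eq_bigr => m _.
rewrite rmorphM /= CK -mul_mpolyC mpolyXE_id rmorph_prod; congr (_ * _).
by apply: eq_bigr => i _; rewrite rmorphXn /= XK.
Qed.

Lemma uniteratedK : cancel uniterated iterated.
Proof.
have X1 : iterated 'X_1 = 'X by rewrite /iterated mmapX mmap1U.
have X0 : iterated 'X_0 = 'X%:P by rewrite /iterated mmapX mmap1U.
have CK q : iterated (map_poly (@mpolyC 2 K) q).['X_0] = q%:P.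
  elim/poly_ind: q => [|q c IH]; first by rewrite map_poly0 horner0 rmorph0.
  rewrite rmorphD rmorphM /= map_polyX map_polyC !hornerE rmorphD rmorphM /= IH X0.
  by rewrite /iterated mmapC /= polyCD polyCM.
elim/poly_ind => [|p q IH]; first by rewrite !rmorph0.
rewrite rmorphD rmorphM /= rmorphD rmorphM /= IH.
congr (_ * _ + _); first by rewrite /uniterated /= map_polyX /horner_eval hornerX X1.
by rewrite /uniterated /= map_polyC /= /horner_eval hornerC CK.
Qed.

Lemma coprime_mpoly_fraction (P Q P' Q' : {mpoly K[2]}) : Q != 0 ->
  coprime_mpoly P Q -> P * Q' = P' * Q -> exists2 D, P' = D * P & Q' = D * Q.
Proof.
move=> Q0 cop e.
have [|||D eP eQ] := @coprime_bivariate_fraction K (iterated P) (iterated Q)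
    (iterated P') (iterated Q'); last 1 first.
- by exists (uniterated D); apply: (can_inj iteratedK); rewrite [RHS]rmorphM /= uniteratedK.
- by rewrite -(rmorph0 iterated) (can_eq iteratedK).
- move=> D A B eP eQ; rewrite -(uniteratedK D); apply: rmorph_unit.
  by apply: (cop _ (uniterated A) (uniterated B)); rewrite -rmorphM -?eP -?eQ /= iteratedK.
by rewrite -!rmorphM e.
Qed.

(** Any representation is a multiple of the lowest terms that [total_degree] picks, so it bounds
    their degrees. The default [(0, 1)] has degree 0. *)
Lemma total_degree_le (f : {fraction {mpoly K[2]}}) (P Q : {mpoly K[2]}) d :
  Q != 0 -> f = tofrac P / tofrac Q -> (msize P <= d.+1)%N -> (msize Q <= d.+1)%N ->
  (total_degree f <= d)%N.
Proof.
move=> Q0 ef sP sQ; rewrite /total_degree.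
case: xgetP => [[P0 Q1] _ [/= Q10 cop e]|_]; last by rewrite /mpoly_degree msize0 msize1.
have tf0 (A : {mpoly K[2]}) : A != 0 -> tofrac A != 0 by rewrite tofrac_eq0.
have /eqP : tofrac P0 / tofrac Q1 = tofrac P / tofrac Q by rewrite -e.
rewrite eqr_div ?tf0 // -!tofracM tofrac_eq => /eqP eq.
have [D eP eQ] := coprime_mpoly_fraction Q10 cop eq.
have D0 : D != 0 by apply: contraNneq Q0 => D0; rewrite eQ D0 mul0r.
have le (A : {mpoly K[2]}) : (msize (D * A) <= d.+1)%N -> (mpoly_degree A <= d)%N.
  have [->|A0] := eqVneq A 0; first by rewrite /mpoly_degree msize0.
  rewrite msizeM // /mpoly_degree -(prednK (n := msize D)) ?lt0n ?msize_poly_eq0 //.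
  by case: (msize A) => //= n; rewrite addnS ltnS; apply: leq_trans (leq_addl _ _).
by rewrite geq_max !le // -?eP -?eQ.
Qed.
End TwoVariables.

(** * Isobaric polynomials in weights 2, 6, 10 *)

Definition isobaric (w : nat) (p : {mpoly rat[3]}) :=
  forall m : 'X_{1..3}, m \in msupp p ->
    (\sum_(i < 3) m i * nth 0 [:: 2; 6; 10] i)%N = w.

Section EvalQ.
Variables (R : realType) (n : nat) (v : 'I_n -> R[i]).
Implicit Types p q : {mpoly rat[n]}.

Lemma eval_QM p q : eval_Q (p * q) v = eval_Q p v * eval_Q q v.
Proof. by rewrite /eval_Q rmorphM /= mevalM. Qed.

Lemma eval_Q0 : eval_Q (0 : {mpoly rat[n]}) v = 0.
Proof. by rewrite /eval_Q rmorph0 meval0. Qed.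

Lemma eval_QD p q : eval_Q (p + q) v = eval_Q p v + eval_Q q v.
Proof. by rewrite /eval_Q rmorphD /= mevalD. Qed.

Lemma eval_Q_sum I r (f : I -> {mpoly rat[n]}) :
  eval_Q (\sum_(i <- r) f i) v = \sum_(i <- r) eval_Q (f i) v.
Proof.
elim: r => [|i r IH]; first by rewrite !big_nil eval_Q0.
by rewrite !big_cons eval_QD IH.
Qed.

Lemma eval_QZX (c : rat) m :
  eval_Q (c *: 'X_[m]) v = ratr c * \prod_(i < n) v i ^+ m i.
Proof.
rewrite /eval_Q -mul_mpolyC rmorphM /= mevalM.
by rewrite /map_mpoly mmapC mevalC mmapX rmorph_prod /= ; congr (_ * _);
  apply: eq_bigr => i _; rewrite rmorphXn /= mevalXU.
Qed.

Lemma eval_QE p : eval_Q p v = \sum_(m <- msupp p) ratr p@_m * \prod_(i < n) v i ^+ m i.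
Proof.
by rewrite [in LHS](mpolyE p) eval_Q_sum; apply: eq_bigr => m _; rewrite eval_QZX.
Qed.
End EvalQ.

(* [X2 ^ k * P (X0 ^ 5 / X2, X0 ^ 2 * X1 / X2)], isobaric of weight [10 * k]. *)
Definition homogenization (k : nat) (P : {mpoly rat[2]}) : {mpoly rat[3]} :=
  \sum_(m <- msupp P) P@_m *:
    'X_[[multinom nth 0%N [:: 5 * m 0%R + 2 * m 1%R; m 1%R; k - m 0%R - m 1%R]%N i | i < 3]].

Lemma sumn3 (f : 'I_3 -> nat) : (\sum_(i < 3) f i = f 0%R + f 1%R + f (inord 2))%N.
Proof.
rewrite !big_ord_recl big_ord0 addn0 addnA; congr (f _ + f _ + f _)%N; apply: val_inj => //.
by rewrite /= inordK.
Qed.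

Lemma prod3 (V : comNzRingType) (f : 'I_3 -> V) :
  \prod_(i < 3) f i = f 0 * f 1 * f (inord 2).
Proof.
rewrite !big_ord_recl big_ord0 mulr1 mulrA; congr (f _ * f _ * f _); apply: val_inj => //.
by rewrite /= inordK.
Qed.

Lemma prod2 (V : comNzRingType) (f : 'I_2 -> V) : \prod_(i < 2) f i = f 0 * f 1.
Proof. by rewrite !big_ord_recl big_ord0 mulr1; congr (f _ * f _); apply: val_inj. Qed.

Lemma mdeg2 (m : 'X_{1..2}) : mdeg m = (m 0%R + m 1%R)%N.
Proof.
by rewrite mdegE !big_ord_recl big_ord0 addn0; congr (m _ + m _)%N; apply: val_inj.
Qed.

Lemma msupp_mdeg (P : {mpoly rat[2]}) k m : (msize P <= k.+1)%N ->
  m \in msupp P -> (m 0%R + m 1%R <= k)%N.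
Proof. by move=> sP /msize_mdeg_lt ltm; rewrite -mdeg2 -ltnS (leq_trans ltm). Qed.

Lemma eval_homogenization (R : realType) (P : {mpoly rat[2]}) k (x y z : R[i]) :
  (msize P <= k.+1)%N -> z != 0 ->
  eval_Q (homogenization k P) (fun i => nth 0 [:: x; y; z] i) =
  z ^+ k * eval_Q P (fun i => nth 0 [:: x ^+ 5 / z; x ^+ 2 * y / z] i).
Proof.
move=> sP z0; rewrite /homogenization eval_Q_sum eval_QE mulr_sumr.
rewrite big_seq [RHS]big_seq; apply: eq_bigr => m /(msupp_mdeg sP) le.
rewrite eval_QZX prod3 prod2 !mnmE /= inordK //= [RHS]mulrCA; congr (_ * _).
rewrite !expr_div_n (exprMn _ (x ^+ 2)) -!exprM.
have -> : z ^+ k = z ^+ m 0 * z ^+ m 1 * z ^+ (k - m 0%R - m 1%R)%N.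
  by rewrite -!exprD; congr (_ ^+ _); rewrite -subnDA subnKC.
have h0 : z ^+ m 0 != 0 by rewrite expf_neq0.
have h1 : z ^+ m 1 != 0 by rewrite expf_neq0.
rewrite exprD; move: (x ^+ _) (x ^+ _) (y ^+ _) (z ^+ (_ - _)) h0 h1 => a b c d.
move: (z ^+ m 0) (z ^+ m 1) => e f h0 h1; field; rewrite ?h0 ?h1 //.
Qed.

Lemma isobaric_homogenization P k : (msize P <= k.+1)%N ->
  isobaric (10 * k) (homogenization k P).
Proof.
move=> sP m /msupp_sum_le /flatten_mapP[m' ].
rewrite filter_predT => m'P /msuppZ_le; rewrite msuppX inE => /eqP ->.
rewrite sumn3 !mnmE /= inordK //=.
have := msupp_mdeg sP m'P; move: (m' 0) (m' 1) => a b; lia.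
Qed.

(* [X0 = J0], [X1 = J0 ^ 2 * J1], [X2 = J0 ^ 4] solve [X0 ^ 5 / X2 = J0] and
   [X0 ^ 2 * X1 / X2 = J1]. *)
Definition dehomogenize : {mpoly rat[3]} -> {mpoly rat[2]} :=
  comp_mpoly [tuple 'X_0; 'X_0 ^+ 2 * 'X_1; 'X_0 ^+ 4].

HB.instance Definition _ := GRing.RMorphism.on dehomogenize.

Lemma dehomogenizeZX c (m : 'X_{1..3}) : dehomogenize (c *: 'X_[m]) =
  c *: ('X_0 ^+ (m 0%R + 2 * m 1%R + 4 * m (inord 2))%N * 'X_1 ^+ m 1).
Proof.
rewrite /dehomogenize comp_mpolyZ comp_mpolyX prod3 !(tnth_nth 0) /= inordK //=.
by rewrite exprMn -!exprM mulrA -!exprD mulrAC -exprD.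
Qed.

Lemma dehomogenizeK k P : (msize P <= k.+1)%N ->
  dehomogenize (homogenization k P) = 'X_0 ^+ (4 * k) * P.
Proof.
move=> sP; rewrite /homogenization rmorph_sum [X in _ = _ * X]mpolyE mulr_sumr.
rewrite big_seq [RHS]big_seq; apply: eq_bigr => m /(msupp_mdeg sP) le.
rewrite /= dehomogenizeZX !mnmE /= inordK //= -scalerAr; congr (_ *: _).
rewrite [X in _ = _ * X]mpolyXE_id prod2 mulrA -exprD; congr (_ ^+ _ * _).
by move: (m 0) (m 1) le => a b; lia.
Qed.

Lemma mpolyXn_neq0 n (i : 'I_n) j : 'X_i ^+ j != 0 :> {mpoly rat[n]}.
Proof. by rewrite expf_neq0 // -msupp_eq0 msuppX. Qed.

(** For exponents with 2a + 6b + 10c = w, the monomial gets a + 2b + 4c = w/2 - b - c as exponent of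
    ['X_0] and b as exponent of ['X_1]. Since b + c <= w/6, a common factor
    ['X_0 ^+ (w %/ 2 - w %/ 6)] comes out, and the degree left is w/6 - c, with w/6 rounded down. *)
Lemma isobaric_dehomogenize w p : isobaric w p ->
  exists2 q, dehomogenize p = 'X_0 ^+ (w %/ 2 - w %/ 6) * q &
             (msize q <= (w %/ 6).+1)%N.
Proof.
move=> iso; exists (\sum_(m <- msupp p) p@_m *:
    ('X_0 ^+ (w %/ 6 - m 1%R - m (inord 2))%N * 'X_1 ^+ m 1)).
  rewrite [in LHS](mpolyE p) rmorph_sum mulr_sumr.
  rewrite big_seq [RHS]big_seq; apply: eq_bigr => m /iso.
  rewrite sumn3 /= inordK //= => e.
  rewrite /= dehomogenizeZX -scalerAr mulrA -exprD; congr (_ *: (_ ^+ _ * _)).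
  by move: (m 0) (m 1) (m _) e => a b c; lia.
rewrite big_seq; apply: (big_ind (fun q => msize q <= (w %/ 6).+1)%N).
- by rewrite msize0.
- by move=> q r hq hr; rewrite (leq_trans (msizeD_le _ _)) // geq_max hq.
move=> m /iso; rewrite sumn3 /= inordK //= => e.
apply: leq_trans (msizeZ_le _ _) _.
rewrite !mpolyXn -mpolyXD msizeX mdegD !mdegMn !mdeg1 !mul1n.
by move: (m 0) (m 1) (m _) e => a b c; lia.
Qed.

(** Distinct monomials of the same weight cannot collide: b, a + 2b + 4c and 2a + 6b + 10c determine
    a, b and c. *)
Lemma isobaric_dehomogenize_neq0 w p : isobaric w p -> p != 0 -> dehomogenize p != 0.
Proof.
move=> iso; rewrite -msupp_eq0; case E : (msupp p) => [//|m0 s] _.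
have m0p : m0 \in msupp p by rewrite E mem_head.
pose e (m : 'X_{1..3}) : 'X_{1..2} :=
  (U_(0%R) *+ (m 0%R + 2 * m 1%R + 4 * m (inord 2))%N + U_(1%R) *+ m 1%R)%MM.
have eX (m : 'X_{1..3}) : 'X_0 ^+ (m 0%R + 2 * m 1%R + 4 * m (inord 2))%N * 'X_1 ^+ m 1
    = 'X_[e m] :> {mpoly rat[2]} by rewrite !mpolyXn -mpolyXD.
apply/eqP => /(congr1 (mcoeff (e m0))); rewrite mcoeff0.
rewrite [in LHS](mpolyE p) rmorph_sum /= raddf_sum /= (bigD1_seq m0) ?msupp_uniq //=.
rewrite dehomogenizeZX eX mcoeffZ mcoeffX eqxx mulr1 big_seq_cond big1 => [|m].
  by rewrite addr0 => /eqP; rewrite mcoeff_eq0 m0p.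
case/andP=> mp; apply: contraNeq; rewrite /= dehomogenizeZX eX mcoeffZ mcoeffX.
case: (e m =P e m0) => [em _|_]; last by rewrite mulr0 eqxx.
have := congr1 (fun x : 'X_{1..2} => x 0) em; have := congr1 (fun x : 'X_{1..2} => x 1) em.
rewrite !mnmDE !mulmnE !mnm1E /= => e1 e0.
have := iso _ mp; rewrite -(iso _ m0p) !sumn3 /= inordK //=.
move: e0 e1 => /= e0 e1 e2.
have [h0 h1 h2] : [/\ m 0 = m0 0, m 1 = m0 1 & m (inord 2) = m0 (inord 2)].
  move: (m 0) (m 1) (m _) (m0 0) (m0 1) (m0 (inord 2)) e0 e1 e2 => a b c a' b' c'.
  by move=> *; split; lia.
apply/eqP/mnmP => i; have : (i == 0) || (i == 1) || (i == inord 2).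
  by rewrite -!val_eqE /= inordK //; case: i => [[|[|[]]]].
by case/orP=> [/orP[]|] /eqP ->.
Qed.

(** The powers of ['X_0] produced by dehomogenizing, one governed by [w] and one by [k], cancel on
    both sides, so the bound depends on the weight only. *)
Theorem total_degree_isobaric_quotient w k (p q : {mpoly rat[3]}) (P Q : {mpoly rat[2]}) :
  isobaric w p -> isobaric w q -> q != 0 ->
  (msize P <= k.+1)%N -> (msize Q <= k.+1)%N -> Q != 0 ->
  p * homogenization k Q = q * homogenization k P ->
  (total_degree (tofrac P / tofrac Q) <= w %/ 6)%N.
Proof.
move=> ip iq q0 sP sQ Q0 e.
have [p' ep sp'] := isobaric_dehomogenize ip.
have [q' eq sq'] := isobaric_dehomogenize iq.
have q'0 : q' != 0.
  apply: contraNneq (isobaric_dehomogenize_neq0 iq q0) => q'0.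
  by rewrite eq q'0 mulr0.
apply: (total_degree_le q'0 _ sp' sq').
apply/eqP; rewrite eqr_div ?tofrac_eq0 // -!tofracM tofrac_eq; apply/eqP.
have := congr1 dehomogenize e; rewrite !rmorphM /= !dehomogenizeK // ep eq.
move=> h; apply: (mulfI (mpolyXn_neq0 0 (w %/ 2 - w %/ 6)%N)).
apply: (mulfI (mpolyXn_neq0 0 (4 * k)%N)).
move: ('X_0 ^+ (w %/ 2 - w %/ 6)) ('X_0 ^+ (4 * k)) h => a b h.
by transitivity (a * q' * (b * P)); [ring | rewrite -h; ring].
Qed.

(** * Unconditional sums *)

Section ComplexAbs.
Variable R : realType.
Implicit Types z w : R[i].

Definition cabs z : R := Num.sqrt (complex.Re z ^+ 2 + complex.Im z ^+ 2).

Lemma normE z : `|z| = (cabs z)%:C. Proof. exact: normc_def. Qed.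

Lemma le_realc (x y : R) : (x%:C <= y%:C :> R[i]) = (x <= y).
Proof. by rewrite lecE /= eqxx. Qed.

Lemma lt_realc (x y : R) : (x%:C < y%:C :> R[i]) = (x < y).
Proof. by rewrite ltcE /= eqxx. Qed.

Lemma realc_inj : injective (fun x : R => x%:C : R[i]).
Proof. by move=> x y []. Qed.

Lemma realcM (x y : R) : (x * y)%:C = x%:C * y%:C :> R[i].
Proof. exact: rmorphM. Qed.

Lemma realcD (x y : R) : (x + y)%:C = x%:C + y%:C :> R[i].
Proof. exact: rmorphD. Qed.

Lemma cabs_ge0 z : 0 <= cabs z. Proof. exact: sqrtr_ge0. Qed.

Lemma cabsM z w : cabs (z * w) = cabs z * cabs w.
Proof. by apply: realc_inj; rewrite realcM -!normE normrM. Qed.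

Lemma cabsD z w : cabs (z + w) <= cabs z + cabs w.
Proof. by rewrite -le_realc realcD -!normE ler_normD. Qed.

Lemma cabsN z : cabs (- z) = cabs z.
Proof. by apply: realc_inj; rewrite -!normE normrN. Qed.

Lemma cabsB z w : cabs (z - w) <= cabs z + cabs w.
Proof. by rewrite (le_trans (cabsD _ _)) // cabsN. Qed.

Lemma cabs_distC z w : cabs (z - w) = cabs (w - z).
Proof. by rewrite -cabsN opprB. Qed.

Lemma cabs0 : cabs 0 = 0.
Proof. by apply: realc_inj; rewrite -!normE normr0. Qed.

Lemma cabs1 : cabs 1 = 1.
Proof. by apply: realc_inj; rewrite -!normE normr1. Qed.

Lemma cabs_eq0 z : (cabs z == 0) = (z == 0).
Proof. by rewrite -(inj_eq realc_inj) -normE normr_eq0. Qed.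

Lemma cabs_gt0 z : (0 < cabs z) = (z != 0).
Proof. by rewrite lt0r cabs_eq0 cabs_ge0 andbT. Qed.

Lemma cabsX z n : cabs (z ^+ n) = cabs z ^+ n.
Proof. by elim: n => [|n IH]; rewrite ?expr0 ?cabs1 // !exprS cabsM IH. Qed.

Lemma cabs_real (x : R) : cabs x%:C = `|x|.
Proof. by rewrite /cabs /= expr0n addr0 sqrtr_sqr. Qed.

Lemma cabsV z : cabs z^-1 = (cabs z)^-1.
Proof.
have [->|z0] := eqVneq z 0; first by rewrite invr0 cabs0 invr0.
apply: (mulfI (_ : cabs z != 0)); first by rewrite cabs_eq0.
by rewrite -cabsM !divff ?cabs1 // cabs_eq0.
Qed.

Lemma Re_le_cabs z : `|complex.Re z| <= cabs z.
Proof. by rewrite -sqrtr_sqr ler_wsqrtr // lerDl sqr_ge0. Qed.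

Lemma Im_le_cabs z : `|complex.Im z| <= cabs z.
Proof. by rewrite -sqrtr_sqr ler_wsqrtr // lerDr sqr_ge0. Qed.

Lemma cabs_le_ReIm z : cabs z <= `|complex.Re z| + `|complex.Im z|.
Proof.
rewrite [X in cabs X]complexE.
have ci : cabs 'i = 1 :> R by rewrite /cabs /= expr0n expr1n add0r sqrtr1.
by rewrite (le_trans (cabsD _ _)) // cabsM ci mul1r !cabs_real.
Qed.

Lemma cabs_sum I (r : seq I) (f : I -> R[i]) :
  cabs (\sum_(i <- r) f i) <= \sum_(i <- r) cabs (f i).
Proof.
elim: r => [|i r IH]; first by rewrite !big_nil cabs0.
by rewrite !big_cons (le_trans (cabsD _ _)) // lerD2l.
Qed.

End ComplexAbs.

Lemma big_fset_split (I : choiceType) (V : nmodType) (A0 A : {fset I}) (f : I -> V) :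
  (A0 `<=` A)%fset -> \sum_(i <- A) f i = \sum_(i <- A0) f i + \sum_(i <- (A `\` A0)%fset) f i.
Proof.
move=> sub; rewrite (big_fsetID _ (mem A0)); congr (_ + _).
  congr bigop; congr enum_fset; apply/fsetP => i; rewrite !inE /= andbC.
  by case: (boolP (i \in A0)) => // /(fsubsetP sub).
by congr bigop; congr enum_fset; apply/fsetP => i; rewrite !inE /= andbC.
Qed.

Section Sums.
Variables (R : realType) (I : choiceType).
Implicit Types (u v : I -> R[i]) (A : {fset I}).

(** The limit along [totally] in epsilon form; [e] ranges over [R] because positive elements of
    [R[i]] are real. *)
Definition sums u (l : R[i]) := forall e : R, 0 < e ->
  exists A0, forall A, (A0 `<=` A)%fset -> cabs (\sum_(i <- A) u i - l) <= e.

Definition abs_summable u := exists B : R, forall A, \sum_(i <- A) cabs (u i) <= B.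

Lemma sumsP u l : sums u l <->
  partial_sum (u : I -> (R[i])^o) A @[A --> totally] --> (l : (R[i])^o).
Proof.
have FF := @filter_filter _ _ (@totally_filter I).
split=> h.
  apply/cvgrPdist_le => eps e0.
  have [x x0 ex] : exists2 x : R, 0 < x & eps = x%:C.
    have : eps \is Num.real by rewrite gtr0_real.
    move/RRe_real => ex; exists (complex.Re eps) => //.
    by rewrite -lt_realc ex.
  have [A0 hA] := h _ x0; exists A0 => // A /= A0A.
  by rewrite /partial_sum -(big_seq_fsetE _ A xpredT u) distrC normE ex le_realc hA.
move=> e e0; move/cvgrPdist_le: h => /(_ e%:C).
rewrite (lt_realc 0) => /(_ e0)[A0 _ hA]; exists A0 => A A0A.
have := hA A A0A; rewrite /= /partial_sum.
by rewrite -(big_seq_fsetE _ A xpredT u) distrC normE le_realc.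
Qed.

Lemma abs_summable_tail u : abs_summable u -> forall e : R, 0 < e ->
  exists A0, forall A, [disjoint A0 & A]%fset -> \sum_(i <- A) cabs (u i) <= e.
Proof.
move=> [B hB] e e0; pose E := [set x | exists A, x = \sum_(i <- A) cabs (u i)].
have supE : has_sup E.
  split; first by exists (\sum_(i <- (fset0 : {fset I})) cabs (u i)), fset0.
  by exists B => _ [A ->].
have [_ [A0 ->] ltA0] := sup_adherent e0 supE.
exists A0 => A dis; have := ub_le_sup (proj2 supE) (ex_intro _ (A0 `|` A)%fset erefl).
rewrite (big_fset_split _ (fsubsetUl A0 A)).
have -> : ((A0 `|` A) `\` A0 = A)%fset.
  by rewrite fsetDUl fsetDv fset0U; apply/fsetDidPl; rewrite fdisjoint_sym.
by move=> le; rewrite -(lerD2l (\sum_(i <- A0) cabs (u i))) (le_trans le) // -lerBlDr ltW.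
Qed.

Lemma real_sum_abs_le (f : I -> R) (M : R) A :
  (forall A', (A' `<=` A)%fset -> `|\sum_(i <- A') f i| <= M) ->
  \sum_(i <- A) `|f i| <= M + M.
Proof.
move=> h; rewrite (big_fsetID _ (fun i => 0 <= f i)) /= lerD //.
  apply: le_trans (h _ (fset_sub _ _)); apply: le_trans (ler_norm _).
  rewrite big_seq [X in _ <= X]big_seq; apply: ler_sum => i.
  by rewrite !inE /= => /andP[_ fi]; rewrite ger0_norm.
apply: le_trans (h _ (fset_sub _ _)); rewrite -normrN; apply: le_trans (ler_norm _).
rewrite -sumrN big_seq [X in _ <= X]big_seq; apply: ler_sum => i.
by rewrite !inE /= -ltNge => /andP[_ fi]; rewrite ltr0_norm.
Qed.

(** Two finite sums containing [A0] are both within 1 of [l], so every finite sum away from [A0] has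
    modulus at most 2. Selecting the terms of one sign turns this into a bound on absolute
    values. *)
Lemma sums_abs u l : sums u l -> abs_summable u.
Proof.
move=> /(_ 1 ltr01)[A0 hA].
have small A : [disjoint A0 & A]%fset -> cabs (\sum_(i <- A) u i) <= 2.
  move=> dis; have e : ((A0 `|` A) `\` A0 = A)%fset.
    by rewrite fsetDUl fsetDv fset0U; apply/fsetDidPl; rewrite fdisjoint_sym.
  have := big_fset_split u (fsubsetUl A0 A); rewrite e => E.
  have -> : \sum_(i <- A) u i =
      (\sum_(i <- (A0 `|` A)%fset) u i - l) - (\sum_(i <- A0) u i - l) by rewrite E; ring.
  by rewrite (le_trans (cabsB _ _)) // -[2]/(1 + 1) lerD // hA // fsubsetUl.
have small' A A' : [disjoint A0 & A]%fset -> (A' `<=` A)%fset ->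
    cabs (\sum_(i <- A') u i) <= 2.
  by move=> dis sub; apply: small; apply: fdisjointWr dis.
(* A bound 2 for each sign of the real parts and each sign of the imaginary parts. *)
exists (\sum_(i <- A0) cabs (u i) + (2 + 2 + (2 + 2))) => A.
apply: (@le_trans _ _ (\sum_(i <- (A0 `|` A)%fset) cabs (u i))).
  rewrite (big_fset_split _ (fsubsetUr A0 A)) lerDl sumr_ge0 // => i _; exact: cabs_ge0.
rewrite (big_fset_split _ (fsubsetUl A0 A)) lerD2l.
set D := (_ `\` _)%fset; have dis : [disjoint A0 & D]%fset by apply/fdisjointP => i iA; rewrite inE iA.
apply: (@le_trans _ _ (\sum_(i <- D) (`|complex.Re (u i)| + `|complex.Im (u i)|))).
  by rewrite ler_sum // => i _; apply: cabs_le_ReIm.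
rewrite big_split lerD //; apply: real_sum_abs_le => A' sub.
  apply: le_trans (small' _ _ dis sub); apply: le_trans (Re_le_cabs _).
  by rewrite (raddf_sum (@complex.Re R)).
apply: le_trans (small' _ _ dis sub); apply: le_trans (Im_le_cabs _).
by rewrite (raddf_sum (@complex.Im R)).
Qed.

Lemma sums_uniq u l l' : sums u l -> sums u l' -> l = l'.
Proof.
move=> h h'; apply/eqP; rewrite -subr_eq0 -cabs_eq0 eq_le cabs_ge0 andbT.
apply/ler_addgt0Pl => e e0.
have [A hA] := h _ (divr_gt0 e0 (ltr0Sn R 1)); have [A' hA'] := h' _ (divr_gt0 e0 (ltr0Sn R 1)).
have := hA _ (fsubsetUl A A'); have := hA' _ (fsubsetUr A A').
set s := \sum_(_ <- _) _ => h1 h2; have -> : l - l' = (s - l') - (s - l) by ring.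
by rewrite addr0 (le_trans (cabsB _ _)) // [e]splitr lerD.
Qed.

Lemma sumsD u v l l' : sums u l -> sums v l' -> sums (fun i => u i + v i) (l + l').
Proof.
move=> h h' e e0.
have [A hA] := h _ (divr_gt0 e0 (ltr0Sn R 1)); have [A' hA'] := h' _ (divr_gt0 e0 (ltr0Sn R 1)).
exists (A `|` A')%fset => B; rewrite fsubUset => /andP[/hA h1 /hA' h2].
rewrite big_split /= opprD addrACA (le_trans (cabsD _ _)) //.
by rewrite [e]splitr lerD.
Qed.

Lemma sumsZ c u l : sums u l -> sums (fun i => c * u i) (c * l).
Proof.
move=> h e e0; have c0 : 0 < cabs c + 1 by rewrite ltr_wpDl ?cabs_ge0.
have [A hA] := h _ (divr_gt0 e0 c0); exists A => B /hA le.
rewrite -mulr_sumr -mulrBr cabsM.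
apply: le_trans (_ : (cabs c + 1) * (e / (cabs c + 1)) <= e).
  by rewrite ler_pM ?cabs_ge0 // lerDl.
by rewrite mulrC divfK // gt_eqF.
Qed.

Lemma sums_finite A u : (forall i, i \notin A -> u i = 0) -> sums u (\sum_(i <- A) u i).
Proof.
move=> h e e0; exists A => B sub; rewrite (big_fset_split _ sub) addrC addKr.
rewrite big_seq big1 ?cabs0 ?ltW // => i; rewrite inE => /andP[iA _]; exact: h.
Qed.

Lemma sums_bound u l B : sums u l -> (forall A, \sum_(i <- A) cabs (u i) <= B) ->
  cabs l <= B.
Proof.
move=> h hB; apply/ler_addgt0Pl => e e0; have [A hA] := h _ e0.
have -> : l = \sum_(i <- A) u i - (\sum_(i <- A) u i - l) by ring.
by rewrite (le_trans (cabsB _ _)) // addrC lerD // ?hA // (le_trans (cabs_sum _ _)).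
Qed.

Lemma abs_summable_le u v : (forall i, cabs (u i) <= cabs (v i)) ->
  abs_summable v -> abs_summable u.
Proof. by move=> le [B hB]; exists B => A; rewrite (le_trans _ (hB A)) // ler_sum. Qed.

Lemma eq_sums u v l : u =1 v -> sums u l -> sums v l.
Proof. by move=> /funext ->. Qed.

Lemma sums_sum J (r : seq J) (u : J -> I -> R[i]) (l : J -> R[i]) :
  (forall j, sums (u j) (l j)) ->
  sums (fun i => \sum_(j <- r) u j i) (\sum_(j <- r) l j).
Proof.
move=> h; elim: r => [|j r IH].
  rewrite big_nil => e e0; exists fset0 => A _.
  by rewrite big1 ?subrr ?cabs0 ?ltW // => i _; rewrite big_nil.
rewrite big_cons; apply: eq_sums (sumsD (h j) IH) => i; by rewrite big_cons.
Qed.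

Lemma sums_reindex (k k' : I -> I) u l : cancel k k' -> cancel k' k ->
  sums u l -> sums (u \o k) l.
Proof.
move=> kK kK' h e e0; have [A hA] := h e e0.
exists [fset k' i | i in A]%fset => B sub.
have -> : \sum_(i <- B) (u \o k) i = \sum_(i <- [fset k i | i in B]%fset) u i.
  by rewrite big_imfset //= => i j _ _; apply: can_inj kK _ _.
apply: hA; apply/fsubsetP => i iA; apply/imfsetP; exists (k' i); last by rewrite kK'.
by apply: (fsubsetP sub); apply/imfsetP; exists i.
Qed.
End Sums.

Section Convolution.
Variables (R : realType) (V : zmodType).
Implicit Types (u v : V -> R[i]) (A : {fset V}).

(** Cauchy product, where [S x] contains the support of the convolution at [x]. Over a set [E]
    containing all sums of [A] and [B], it becomes a sum over y of [u y] times the sum of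
    [v (x - y)] for x in [E]. The inner sum is close to [l'] when y is in [A]; for the other y it is
    bounded by [W] while the [u y] have a small absolute sum. *)
Lemma sums_convolution u v (S : V -> {fset V}) l l' :
  (forall x y, y \notin S x -> u y * v (x - y) = 0) -> sums u l -> sums v l' ->
  sums (fun x => \sum_(y <- S x) u y * v (x - y)) (l * l').
Proof.
move=> hS su sv e e0.
have [U hU] := sums_abs su; have [W hW] := sums_abs sv.
have U0 : 0 <= U by apply: le_trans (hU fset0); rewrite big_seq_fset0.
have W0 : 0 <= W by apply: le_trans (hW fset0); rewrite big_seq_fset0.
have M0 : 0 < U + W + cabs l' + 1 by have := cabs_ge0 l'; lra.
set M := _ + 1 in M0; set d := e / M; have d0 : 0 < d by exact: divr_gt0.
have [A1 tail] := abs_summable_tail (sums_abs su) d0.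
have [A2 hA2] := su d d0; have [B hB] := sv d d0.
pose A := (A1 `|` A2)%fset.
exists [fset (x + y)%R | x in A, y in B]%fset => E sub.
pose T := (A `|` \bigcup_(x <- E) S x)%fset.
have -> : \sum_(x <- E) \sum_(y <- S x) u y * v (x - y)
    = \sum_(y <- T) u y * \sum_(x <- E) v (x - y).
  under [RHS]eq_bigr do rewrite mulr_sumr.
  rewrite exchange_big /= big_seq [RHS]big_seq; apply: eq_bigr => x xE.
  apply: big_fset_incl => [|y _ /hS //].
  by apply: fsubset_trans (fsubsetUr _ _); apply: bigfcup_sup.
pose vE y := \sum_(x <- E) v (x - y).
have vEE y : vE y = \sum_(x <- [fset (x - y)%R | x in E]%fset) v x.
  by rewrite big_imfset //= => x x' _ _; apply: addIr.
have vEW y : cabs (vE y) <= W by rewrite vEE (le_trans (cabs_sum _ _)).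
have vEl y : y \in A -> cabs (vE y - l') <= d.
  move=> yA; rewrite vEE hB //; apply/fsubsetP => x xB; apply/imfsetP.
  exists (x + y); last by rewrite addrK.
  by apply: (fsubsetP sub); apply/imfset2P; exists y => //; exists x => //; rewrite addrC.
rewrite (big_fset_split _ (fsubsetUl A _)).
set T' := (T `\` A)%fset.
have -> : \sum_(y <- A) u y * vE y + \sum_(y <- T') u y * vE y - l * l'
   = \sum_(y <- A) u y * (vE y - l') + (\sum_(y <- A) u y - l) * l'
     + \sum_(y <- T') u y * vE y.
  under [X in _ = X + _ + _]eq_bigr do rewrite mulrBr.
  by rewrite big_split /= sumrN -mulr_suml; ring.
have -> : e = U * d + d * cabs l' + d * W + d by rewrite /d /M; field; rewrite gt_eqF.
rewrite (le_trans _ (ler_wpDr (ltW d0) (lexx _))) //.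
rewrite (le_trans (cabsD _ _)) // lerD // ?(le_trans (cabsD _ _)) // ?lerD //.
- rewrite (le_trans (cabs_sum _ _)) //.
  apply: le_trans (_ : \sum_(y <- A) cabs (u y) * d <= _).
    rewrite big_seq [X in _ <= X]big_seq; apply: ler_sum => y yA.
    by rewrite cabsM ler_wpM2l ?cabs_ge0 ?vEl.
  by rewrite -mulr_suml ler_wpM2r // ltW.
- by rewrite cabsM ler_wpM2r ?cabs_ge0 // hA2 // fsubsetUr.
rewrite (le_trans (cabs_sum _ _)) //.
apply: le_trans (_ : \sum_(y <- T') cabs (u y) * W <= _).
  by apply: ler_sum => y _; rewrite cabsM ler_wpM2l ?cabs_ge0.
rewrite -mulr_suml ler_wpM2r //; apply: tail; apply/fdisjointP => y yA1.
by rewrite !inE yA1.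
Qed.
End Convolution.

(** The monic integer polynomial is moved to [algC], where a rational algebraic integer is an
    integer. *)
Lemma ratr_integral (R : realType) (a : rat) :
  integralOver (intr : int -> R) (ratr a) -> a \is a Num.int.
Proof.
case=> p mp; rewrite /root => /eqP pa.
have : root (map_poly (intr : int -> algC) p) (ratr a).
  apply/rootP.
  have e : (map_poly (intr : int -> rat) p).[a] = 0.
    apply: (fmorph_inj (ratr : {rmorphism rat -> R})).
    rewrite rmorph0 -horner_map -[RHS]pa -map_poly_comp; congr (_.[_]).
    by apply: eq_map_poly => z; rewrite /= ratr_int.
  transitivity (ratr (map_poly (intr : int -> rat) p).[a] : algC); last by rewrite e rmorph0.
  rewrite -horner_map -map_poly_comp; congr (_.[_]).
  by apply: eq_map_poly => z; rewrite /= ratr_int.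
move=> /root_monic_Aint; rewrite monic_map // => /(_ isT) h.
have /h aA : map_poly (intr : int -> algC) p \is a polyOver Num.int.
  by apply/polyOverP => i; rewrite coef_map /= intr_int.
by have := Cint_rat_Aint (Crat_rat a) aA; rewrite Cint_rat.
Qed.

(** * The field Q(sqrt 5) *)

Class golden (R : realType) (F : fieldExtType rat) (s : F)
    (i1 i2 : {rmorphism F -> R}) : Prop := Golden {
  golden_sqr : s ^+ 2 = 5;
  golden_full : <<1; s>>%VS = fullv;
  golden_neq : ~ i1 =1 i2 }.

Section GoldenField.
Context (R : realType) (F : fieldExtType rat) (s : F).
Context (i1 i2 : {rmorphism F -> R}) {G : golden s i1 i2}.
Local Notation s5 := (golden_sqr (s := s)).
Implicit Types x y z : F.

Local Notation "a %:F" := (GRing.in_alg F a).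

Lemma coords x : exists a b : rat, x = a%:F + b%:F * s.
Proof.
have /Fadjoin1_polyP[p ->] : x \in <<1; s>>%VS by rewrite golden_full memvf.
elim/poly_ind: p => [|p c [a [b IH]]].
  by exists 0, 0; rewrite map_poly0 horner0 rmorph0 mul0r addr0.
exists (5 * b + c), a.
have -> : (5 * b + c)%:F = 5 * b%:F + c%:F by rewrite rmorphD rmorphM rmorph_nat.
have -> : map_poly (GRing.in_alg F) (p * 'X + c%:P) =
    map_poly (GRing.in_alg F) p * 'X + (c%:F)%:P.
  by rewrite rmorphD rmorphM /= map_polyX map_polyC.
rewrite hornerMXaddC IH -s5.
by move: (GRing.in_alg F) => q; ring.
Qed.

Lemma i_rat (i : {rmorphism F -> R}) (a : rat) : i a%:F = ratr a.
Proof. by rewrite /= alg_num_field fmorph_rat. Qed.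

Lemma i1s_sqr : i1 s ^+ 2 = 5. Proof. by rewrite -rmorphXn s5 rmorph_nat. Qed.

Lemma i2s : i2 s = - i1 s.
Proof.
have : (i2 s - i1 s) * (i2 s + i1 s) = 0.
  rewrite -subr_sqr -!rmorphXn /= s5 !rmorph_nat subrr //.
move/eqP; rewrite mulf_eq0 => /orP[|]; rewrite ?subr_eq0 ?addr_eq0 => /eqP // e.
case: (golden_neq (s := s)) => x; have [a [b ->]] := coords x.
by rewrite !rmorphD !rmorphM /= !i_rat e.
Qed.

Lemma i1_coords a b : i1 (a%:F + b%:F * s) = ratr a + ratr b * i1 s.
Proof. by rewrite rmorphD rmorphM /= !i_rat. Qed.

Lemma i2_coords a b : i2 (a%:F + b%:F * s) = ratr a - ratr b * i1 s.
Proof. by rewrite rmorphD rmorphM /= !i_rat i2s mulrN. Qed.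

Lemma conj_exists x : exists y, i1 y = i2 x /\ i2 y = i1 x.
Proof.
have [a [b ->]] := coords x; exists (a%:F + (- b)%:F * s).
by rewrite !i1_coords !i2_coords rmorphN /= mulNr opprK.
Qed.

(** Galois conjugation, characterized by its exchange of the two embeddings; [conj_exists] rules out
    the default 0. *)
Definition conjF x : F := xget 0 [set y | i1 y = i2 x /\ i2 y = i1 x].

Lemma conjFP x : i1 (conjF x) = i2 x /\ i2 (conjF x) = i1 x.
Proof. by rewrite /conjF; have [y hy] := conj_exists x; case: xgetP => // /(_ y). Qed.

Lemma i1_conj x : i1 (conjF x) = i2 x. Proof. by case: (conjFP x). Qed.
Lemma i2_conj x : i2 (conjF x) = i1 x. Proof. by case: (conjFP x). Qed.

Lemma conjFK : involutive conjF.
Proof. by move=> x; apply: (fmorph_inj i1); rewrite i1_conj i2_conj. Qed.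

Lemma conjFD x y : conjF (x + y) = conjF x + conjF y.
Proof. by apply: (fmorph_inj i1); rewrite rmorphD !i1_conj rmorphD. Qed.

Lemma conjFM x y : conjF (x * y) = conjF x * conjF y.
Proof. by apply: (fmorph_inj i1); rewrite rmorphM !i1_conj rmorphM. Qed.

Lemma conjFV x : conjF x^-1 = (conjF x)^-1.
Proof. by apply: (fmorph_inj i1); rewrite fmorphV !i1_conj fmorphV. Qed.

Lemma conjF1 : conjF 1 = 1.
Proof. by apply: (fmorph_inj i1); rewrite i1_conj !rmorph1. Qed.

Lemma conjFN x : conjF (- x) = - conjF x.
Proof. by apply: (fmorph_inj i1); rewrite rmorphN !i1_conj rmorphN. Qed.

Lemma conjF_s : conjF s = - s.
Proof. by apply: (fmorph_inj i1); rewrite i1_conj rmorphN i2s. Qed.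

Definition golden_ratio : F := (1 + s) / 2.
Local Notation phi := golden_ratio.

Lemma natF_neq0 n : (n.+1)%:R != 0 :> F.
Proof. by rewrite -(fmorph_eq0 i1) rmorph_nat pnatr_eq0. Qed.

Lemma phi_sqr : phi ^+ 2 = phi + 1.
Proof.
have -> : phi ^+ 2 = phi + 1 + (s ^+ 2 - 5) / 4.
  by rewrite /golden_ratio; field; rewrite ?natF_neq0.
by rewrite s5 subrr mul0r addr0.
Qed.

Lemma sE : s = 2 * phi - 1.
Proof. by rewrite /golden_ratio; field; rewrite natF_neq0. Qed.

Lemma ZF_int (n : int) : ZF (n%:~R : F).
Proof. exact: integral_id. Qed.

Lemma ZF_phi : ZF phi.
Proof.
exists ('X^2 - 'X - 1).
  rewrite monicE -addrA -opprD lead_coefDl ?lead_coefXn //.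
  by rewrite size_polyN size_polyXn (leq_ltn_trans (size_polyD _ _)) // size_polyX size_poly1.
rewrite /root !rmorphB rmorphXn /= map_polyX rmorph1 !hornerE.
by rewrite phi_sqr; apply/eqP; ring.
Qed.

Lemma ZFD x y : ZF x -> ZF y -> ZF (x + y). Proof. exact: integral_add. Qed.
Lemma ZFM x y : ZF x -> ZF y -> ZF (x * y). Proof. exact: integral_mul. Qed.
Lemma ZFN x : ZF x -> ZF (- x). Proof. exact: integral_opp. Qed.
Lemma ZFB x y : ZF x -> ZF y -> ZF (x - y). Proof. exact: integral_sub. Qed.
Lemma ZF0 : ZF (0 : F). Proof. exact: integral0. Qed.
Lemma ZF1 : ZF (1 : F). Proof. exact: integral1. Qed.
Lemma ZF_nat n : ZF (n%:R : F). Proof. exact: integral_nat. Qed.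

(** For x = a + b sqrt5, the trace A = 2a and the norm k are rational integers. Then 5 (2b)^2 = A^2
    - 4k makes 10b an integer whose square is divisible by 5, so B = 2b is an integer, and A^2 - 5
    B^2 = 4k gives A and B the same parity. *)
Lemma ZFP x : ZF x <-> exists m n : int, x = m%:~R + n%:~R * phi.
Proof.
split; last by case=> m [n ->]; apply/ZFD/ZFM; [exact: ZF_int|exact: ZF_int|exact: ZF_phi].
have [a [b ex]] := coords x => hx.
have h1 : integralOver (intr : int -> R) (i1 x).
  have := integral_rmorph i1 hx; rewrite (_ : i1 \o intr = intr) //.
  by apply/funext => z /=; rewrite rmorph_int.
have h2 : integralOver (intr : int -> R) (i2 x).
  have := integral_rmorph i2 hx; rewrite (_ : i2 \o intr = intr) //.
  by apply/funext => z /=; rewrite rmorph_int.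
have /intrP[A eA] : a *+ 2 \is a Num.int.
  apply: (@ratr_integral R); have := integral_add h1 h2; rewrite ex i1_coords i2_coords.
  by rewrite addrACA subrr addr0 rmorphMn.
have /intrP[k ek] : a ^+ 2 - 5 * b ^+ 2 \is a Num.int.
  apply: (@ratr_integral R); have := integral_mul h1 h2; rewrite ex i1_coords i2_coords.
  suff -> : (ratr a + ratr b * i1 s) * (ratr a - ratr b * i1 s) = ratr (a ^+ 2 - 5 * b ^+ 2).
    by [].
  by rewrite rmorphB !rmorphM rmorph_nat /= -i1s_sqr; ring.
have sq5 : (5 * (b *+ 2)) ^+ 2 = (5 * (A ^+ 2 - 4 * k))%:~R.
  rewrite !(rmorphM, rmorphB, rmorphXn) /=. rewrite -eA -ek; ring.
have /intrP[D eD] : 5 * (b *+ 2) \is a Num.int.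
  apply: (@ratr_integral R); rewrite -/(ratr _).
  exists ('X^2 - (5 * (A ^+ 2 - 4 * k))%:P); first exact: monicXnsubC.
  rewrite /root rmorphB rmorphXn /= map_polyX map_polyC !hornerE.
  by rewrite -rmorphXn sq5 /= ratr_int subrr.
have eAD : D ^+ 2 = 5 * (A ^+ 2 - 4 * k).
  by apply/eqP; rewrite -(eqr_int rat) -sq5 eD rmorphM.
have [B eB] : exists B, D = 5 * B.
  have : (D %% 5 = 0 \/ D %% 5 = 1 \/ D %% 5 = 2 \/ D %% 5 = 3 \/ D %% 5 = 4)%Z by lia.
  set Q := (D %/ 5)%Z => hD; exists Q.
  have eD5 : D = 5 * Q + (D %% 5)%Z by rewrite /Q; lia.
  move: eAD; rewrite eD5; move: (D %% 5)%Z hD => r hr e.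
  have : 5 * (5 * Q ^+ 2 + 2 * Q * r - A ^+ 2 + 4 * k) + r ^+ 2 = 0.
    have : (5 * Q + r) ^+ 2 - 5 * (A ^+ 2 - 4 * k) = 0 by rewrite e subrr.
    by move=> <-; ring.
  by case: hr => [->|[->|[->|[->|->]]]]; rewrite ?addr0 //; lia.
have eb : b *+ 2 = B%:~R.
  by apply: (mulfI (_ : 5 != 0 :> rat)) => //; rewrite eD eB rmorphM.
have [C eC] : exists C, A - B = 2 * C.
  have e : A ^+ 2 - 5 * B ^+ 2 = 4 * k.
    by apply: (mulfI (_ : 5 != 0 :> int)) => //; move: eAD; rewrite eB; lia.
  have [q [r [eq hr]]] : exists q r : int, A - B = 2 * q + r /\ (r = 0 \/ r = 1).
    exists ((A - B) %/ 2)%Z, ((A - B) %% 2)%Z; split; lia.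
  exists q; case: hr => hr; first lia.
  exfalso; have eA' : A = 2 * q + 1 + B by lia.
  have : 4 * (q ^+ 2 + q + q * B - B ^+ 2 - k) + 2 * B + 1 = 0.
    have : A ^+ 2 - 5 * B ^+ 2 - 4 * k = 0 by rewrite e subrr.
    by rewrite eA' => <-; ring.
  lia.
exists C, B; rewrite ex /golden_ratio.
have -> : a = (A%:~R) / 2 by rewrite -eA; field.
have -> : b = (B%:~R) / 2 by rewrite -eb; field.
have -> : A = 2 * C + B by lia.
rewrite !fmorph_div !rmorph_int !rmorph_nat intrD intrM.
by field; rewrite natF_neq0.
Qed.
End GoldenField.
Arguments ZF0 {F}.
Arguments ZF1 {F}.
Arguments ZF_int {F}.
Arguments ZF_nat {F}.
Arguments ZF_phi {R F s i1 i2 G}.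
Arguments phi_sqr {R F s i1 i2 G}.
Arguments i1s_sqr {R F s i1 i2 G}.
Arguments i2s {R F s i1 i2 G}.

(** * Codifferent, units and lattice points *)

Section Duals.
Context (R : realType) (F : fieldExtType rat) (s : F).
Context (i1 i2 : {rmorphism F -> R}) {G : golden s i1 i2}.
Implicit Types x y z : F.
Local Notation phi := (golden_ratio s).
Local Notation tr := (trace i1 i2).
Local Notation nm := (norm i1 i2).

Lemma ZF_s : ZF s.
Proof. by rewrite (sE s i1); apply/ZFB/ZF1/ZFM/ZF_phi/ZF_nat. Qed.

Lemma s_neq0 : s != 0.
Proof. by rewrite -(fmorph_eq0 i1) -sqrf_eq0 i1s_sqr pnatr_eq0. Qed.

Lemma phi1 : i1 phi = (1 + i1 s) / 2.
Proof. by rewrite /golden_ratio fmorph_div rmorphD !rmorph1 rmorph_nat. Qed.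

Lemma phi2 : i2 phi = (1 - i1 s) / 2.
Proof. by rewrite /golden_ratio fmorph_div rmorphD !rmorph1 rmorph_nat i2s. Qed.

Lemma i1_ZF (m n : int) :
  i1 (m%:~R + n%:~R * phi) = m%:~R + n%:~R * ((1 + i1 s) / 2).
Proof. by rewrite -phi1; move: phi => p; rewrite rmorphD rmorphM !rmorph_int. Qed.

Lemma i2_ZF (m n : int) :
  i2 (m%:~R + n%:~R * phi) = m%:~R + n%:~R * ((1 - i1 s) / 2).
Proof. by rewrite -phi2; move: phi => p; rewrite rmorphD rmorphM !rmorph_int. Qed.

Lemma ZF_conj x : ZF x -> ZF (conjF i1 i2 x).
Proof.
case=> p mp hp; exists p => //; rewrite /root -(fmorph_eq0 i1) -horner_map i1_conj.
move: hp; rewrite /root -(fmorph_eq0 i2) -horner_map -!map_poly_comp.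
by rewrite (eq_map_poly (g := i1 \o intr)) // => n /=; rewrite !rmorph_int.
Qed.

Lemma traceD x y : tr (x + y) = tr x + tr y.
Proof. by rewrite /trace !rmorphD addrACA. Qed.

Lemma traceZ (n : int) x : tr (n%:~R * x) = n%:~R * tr x.
Proof. by rewrite /trace !rmorphM !rmorph_int mulrDr. Qed.

Lemma traceZs x : ZF x -> tr (x / s) \is a Num.int.
Proof.
move=> /ZFP[m [n ->]]; rewrite mulrDl traceD -mulrA !traceZ.
have -> : tr s^-1 = 0 by rewrite /trace !fmorphV i2s invrN subrr.
rewrite mulr0 add0r; have -> : tr (phi / s) = 1; last by rewrite mulr1 intr_int.
have s0 : i1 s != 0 by rewrite fmorph_eq0 s_neq0.
rewrite /trace (fmorph_div i1) (fmorph_div i2) phi1 phi2 i2s.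
by field; rewrite s0.
Qed.

Lemma ratr_int_inj (q : rat) : (ratr q : R) \is a Num.int -> exists n : int, q = n%:~R.
Proof.
move=> /intrP[n e]; exists n; apply: (fmorph_inj (ratr : {rmorphism rat -> R})).
by rewrite /= e ratr_int.
Qed.

(** The codifferent is generated by 1/sqrt5; pairing with the basis 1, phi recovers the integral
    coordinates of [s * x]. *)
Lemma ZFvP x : ZFv i1 i2 x <-> ZF (s * x).
Proof.
split=> [h|h y hy]; last first.
  have -> : x * y = (s * x) * y / s by field; rewrite s_neq0.
  by apply: traceZs; apply: ZFM.
have ZFp : ZF phi by exact: ZF_phi.
have := h 1 ZF1; have := h _ ZFp; have [a [b ex]] := coords x.
have -> : tr (x * phi) = ratr (a + 5 * b).
  rewrite /trace (rmorphM i1) (rmorphM i2) ex i1_coords i2_coords phi1 phi2 rmorphD.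
  by rewrite rmorphM rmorph_nat -i1s_sqr; field.
have -> : tr (x * 1) = ratr (2 * a).
  rewrite mulr1 /trace ex i1_coords i2_coords rmorphM rmorph_nat; ring.
move=> /ratr_int_inj[k ek] /ratr_int_inj[n en].
apply/ZFP; exists (k - n), n.
have -> : s * x = 5 * GRing.in_alg F b + GRing.in_alg F a * s.
  by rewrite ex -(golden_sqr (s := s)); ring.
have e5 : 5 * GRing.in_alg F b = k%:~R - GRing.in_alg F a.
  by rewrite -(rmorph_int (GRing.in_alg F)) -ek rmorphD rmorphM rmorph_nat; ring.
have ea : n%:~R = 2 * GRing.in_alg F a.
  by rewrite -(rmorph_int (GRing.in_alg F)) -en rmorphM rmorph_nat.
by rewrite e5 intrB ea [s in LHS](sE s i1); ring.
Qed.

Lemma ideal_invP x : ideal_inv (ZFv i1 i2) x <-> ZF (x / s).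
Proof.
split=> [|h y /ZFvP hy]; first by apply; apply/ZFvP; rewrite divff ?s_neq0 //; apply: ZF1.
by have -> : x * y = (x / s) * (s * y); [field; rewrite s_neq0|apply: ZFM].
Qed.

(** Origin of the denominator 5 of Fourier exponents: translations run over sqrt5 ZF, whose trace
    dual is ZF / 5. *)
Lemma dual_ideal_invP x : trace_dual i1 i2 (ideal_inv (ZFv i1 i2)) x <-> ZF (5 * x).
Proof.
have e : 5 * x = s * (x * s) by rewrite -(golden_sqr (s := s)); ring.
rewrite e -ZFvP; split=> h y hy.
  by rewrite -mulrA; apply: h; apply/ideal_invP; rewrite mulrAC divff ?s_neq0 // mul1r.
have -> : x * y = x * s * (y / s) by field; rewrite s_neq0.
by apply: h; apply/ideal_invP.
Qed.

Lemma norm_coords (m n : int) :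
  nm (m%:~R + n%:~R * phi) = (m ^+ 2 + m * n - n ^+ 2)%:~R.
Proof.
rewrite /norm i1_ZF i2_ZF.
rewrite !(intrD, intrB, intrM, rmorphXn) /=.
transitivity (m%:~R ^+ 2 + m%:~R * n%:~R - (i1 s ^+ 2 - 1) / 4 * n%:~R ^+ 2 : R).
  by field.
by rewrite i1s_sqr; field.
Qed.

Lemma ZF_inv_phi : ZF phi^-1.
Proof.
have p : phi * (phi - 1) = 1 by rewrite mulrBr mulr1 -expr2 phi_sqr; ring.
have p0 : phi != 0 by apply/eqP => p0; move/eqP: p; rewrite p0 mul0r eq_sym oner_eq0.
have -> : phi^-1 = phi - 1 by apply: (mulfI p0); rewrite divff // p.
exact: ZFB ZF_phi ZF1.
Qed.

(* The totally positive unit [phi ^ 2], of norm 1. *)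
Lemma ex_unit : exists u : F, [/\ ZF u, ZF u^-1, 0 < i1 u,
  i1 u * i2 u = 1 & i1 u != 1].
Proof.
have sq (x : R) : x != 0 -> 0 < x ^+ 2 by move=> x0; rewrite lt0r sqr_ge0 sqrf_eq0 x0.
have p0 : phi != 0.
  have p2 : phi ^+ 2 = phi + 1 by exact: phi_sqr.
  by apply/eqP => p0; move/eqP: p2; rewrite p0 expr0n add0r eq_sym oner_eq0.
have r0 : i1 s != 0 by rewrite fmorph_eq0 s_neq0.
have n1 : i1 phi * i2 phi = -1.
  have := norm_coords 0 1; rewrite /norm add0r mul1r => ->.
  by rewrite expr0n mul0r !add0r expr1n rmorphN.
exists (phi ^+ 2); split.
- by rewrite expr2; apply: ZFM; apply: ZF_phi.
- by rewrite -exprVn expr2; apply: ZFM; apply: ZF_inv_phi.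
- by rewrite rmorphXn sq // fmorph_eq0.
- by rewrite !rmorphXn -exprMn n1 sqrrN expr1n.
rewrite phi_sqr rmorphD rmorph1 -subr_eq0 addrK fmorph_eq0 //.
Qed.
End Duals.

Arguments s_neq0 {R F s i1 i2 G}.
Arguments ZF_s {R F s i1 i2 G}.

Lemma int_shift (N : nat) (w : int) : `|w| <= N%:Z ->
  exists2 a : nat, (a < (2 * N).+1)%N & w = a%:Z - N%:Z.
Proof. by move=> h; exists (absz (w + N%:Z)); lia. Qed.

Section Discreteness.
Context (R : realType) (F : fieldExtType rat) (s : F).
Context (i1 i2 : {rmorphism F -> R}) {G : golden s i1 i2}.

Local Notation phi := (golden_ratio s).

(** For m x = u + v phi, the difference of the two embeddings is v sqrt5, which bounds v; one
    embedding then bounds u. *)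
Lemma bounded_lattice_finite (m : nat) (T : R) : (0 < m)%N ->
  exists A : {fset F}, forall x : F, ZF (m%:R * x) ->
    `|i1 x| <= T -> `|i2 x| <= T -> x \in A.
Proof.
move=> m0.
have r1 : 1 <= `|i1 s|.
  rewrite -(expr_ge1 (n := 2)) // -normrX i1s_sqr ger0_norm ?ler0n //.
  by rewrite -[1]/(1%:R) ler_nat.
have r3 : `|i1 s| <= 3.
  rewrite -(ler_pXn2r (n := 2)) ?nnegrE // -normrX i1s_sqr ger0_norm ?ler0n //.
  by rewrite -natrX ler_nat.
(* With [|v| <= 2 m T] and [|(1 + sqrt5) / 2| <= 5/2], a crude bound for u is (1 + 2 * 5/2) m T = 6
   m T. *)
have [N leN] : exists N : nat, 6 * (m%:R * T) <= N%:R.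
  by exists (Num.bound `|6 * (m%:R * T)|); rewrite (le_trans (ler_norm _)) // ltW ?archi_boundP.
exists [fset (((a%:Z - N%:Z)%:~R + (b%:Z - N%:Z)%:~R * phi) / m%:R)%R
   | a in [fset k in iota 0 (2 * N).+1], b in [fset k in iota 0 (2 * N).+1]]%fset.
move=> x /ZFP[u [v e]] h1 h2.
have mF : m%:R != 0 :> F by rewrite -(prednK m0) (natF_neq0 i1).
have ex : x = (u%:~R + v%:~R * phi) / m%:R by rewrite -e mulrC mulKf.
have T0 : 0 <= T by apply: le_trans h1.
have M1 : `|i1 (m%:R * x)| <= m%:R * T by rewrite rmorphM rmorph_nat normrM normr_nat ler_wpM2l.
have M2 : `|i2 (m%:R * x)| <= m%:R * T by rewrite rmorphM rmorph_nat normrM normr_nat ler_wpM2l.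
have v_le : `|v%:~R| <= 2 * (m%:R * T) :> R.
  have -> : 2 * (m%:R * T) = m%:R * T + m%:R * T by ring.
  apply: le_trans (_ : `|i1 s * v%:~R| <= _); first by rewrite normrM ler_peMl.
  have -> : i1 s * v%:~R = i1 (m%:R * x) - i2 (m%:R * x).
    by rewrite e i1_ZF i2_ZF; field.
  by rewrite (le_trans (ler_normB _ _)) // lerD.
have u_le : `|u%:~R| <= 6 * (m%:R * T) :> R.
  have -> : u%:~R = i1 (m%:R * x) - v%:~R * ((1 + i1 s) / 2).
    by rewrite e i1_ZF; ring.
  have -> : 6 * (m%:R * T) = m%:R * T + 2 * (m%:R * T) * (5 / 2) by field.
  rewrite (le_trans (ler_normB _ _)) // lerD // normrM ler_pM //.
  by rewrite ler_norml; move: r3; rewrite ler_norml => /andP[]; lra.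
have inN (w : int) : `|w%:~R| <= 6 * (m%:R * T) :> R -> exists2 a : nat,
     a \in [fset k in iota 0 (2 * N).+1]%fset & w = a%:Z - N%:Z.
  move=> hw; have : `|w%:~R| <= N%:Z%:~R :> R by rewrite (le_trans hw).
  rewrite -intr_norm ler_int => /int_shift[a aN ea]; exists a => //.
  by rewrite !inE mem_iota; case: {ea} a aN.
have [a aN ea] := inN u u_le.
have [|b bN eb] := inN v.
  rewrite (le_trans v_le) // ler_wpM2r ?mulr_ge0 // ler_nat //.
by apply/imfset2P; exists a => //; exists b => //; rewrite ex ea eb.
Qed.
End Discreteness.

(** * Residues modulo a prime element *)

Lemma ex_class_representatives (T : eqType) (E : T -> T -> Prop) (l : seq T) :
  (forall x, E x x) -> (forall x y, E x y -> E y x) ->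
  (forall x y z, E x y -> E y z -> E x z) ->
  exists l' : seq T, [/\ uniq l', {subset l' <= l}, (size l' <= size l)%N,
    forall x, x \in l -> exists2 y, y \in l' & E x y &
    forall x y, x \in l' -> y \in l' -> E x y -> x = y].
Proof.
move=> Er Es Et; elim: l => [|x l [l' [ul' sub sz cov inj]]]; first by exists [::].
have [[y yl' Exy]|none] := pselect (exists2 y, y \in l' & E x y).
  exists l'; split=> //.
  - by move=> z /sub; rewrite inE orbC => ->.
  - by rewrite (leq_trans sz).
  - by move=> z; rewrite inE => /predU1P[->|/cov //]; exists y.
exists (x :: l'); split=> //=.
- by rewrite ul' andbT; apply: contra_notN none => xl'; exists x.
- by move=> z; rewrite !inE => /predU1P[->|/sub ->]; rewrite ?eqxx ?orbT.
- move=> z; rewrite inE => /predU1P[->|/cov[y yl' Ezy]]; first by exists x; rewrite ?mem_head.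
  by exists y => //; rewrite inE yl' orbT.
move=> y z; rewrite !inE => /predU1P[->|yl'] /predU1P[->|zl'] //.
- by move=> Exz; case: none; exists z.
- by move=> Eyx; case: none; exists y => //; apply: Es.
- exact: inj.
Qed.

Section Residues.
Context (R : realType) (F : fieldExtType rat) (s : F).
Context (i1 i2 : {rmorphism F -> R}) {G : golden s i1 i2}.
Implicit Types x y z b : F.
Local Notation phi := (golden_ratio s).
Local Notation nm := (norm i1 i2).

Lemma congruent_sym b x y : ZF ((x - y) / b) -> ZF ((y - x) / b).
Proof. by move=> /ZFN; rewrite -mulNr opprB. Qed.

Lemma congruent_trans b x y z : ZF ((x - y) / b) -> ZF ((y - z) / b) -> ZF ((x - z) / b).
Proof. by move=> h /(ZFD h); rewrite -mulrDl addrA subrK. Qed.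

Lemma ZF_coords (m n : int) : ZF (m%:~R + n%:~R * phi).
Proof. by apply/ZFP; exists m, n. Qed.

Lemma norm_factor (u v : int) :
  (u%:~R + v%:~R * phi) * ((u + v)%:~R + (- v)%:~R * phi) =
  (u ^+ 2 + u * v - v ^+ 2)%:~R.
Proof.
rewrite intrN !(intrD, intrB) !rmorphXn !intrM.
transitivity (u%:~R ^+ 2 + u%:~R * v%:~R - v%:~R ^+ 2 * (phi ^+ 2 - phi)); first by ring.
by rewrite phi_sqr; ring.
Qed.

(* With [g = gcd u v], the lattice [b * ZF] contains [norm b / g] and an element
   with [phi]-coordinate [g]. *)
Lemma ex_covering b : ZF b -> 0 < nm b -> exists B : seq F,
  [/\ (size B)%:R <= nm b, {in B, forall x, ZF x} &
      forall x, ZF x -> exists2 y, y \in B & ZF ((x - y) / b)].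
Proof.
move=> /ZFP[u [v eb]]; rewrite {1 2}eb norm_coords; set N := _ - _ => N0.
have {}N0 : 0 < N by rewrite -(ltr_int R).
have b0 : b != 0.
  apply/eqP => b0; have := norm_factor u v; rewrite -eb b0 mul0r => /(congr1 i1).
  by move/eqP; rewrite rmorph0 rmorph_int eq_sym intr_eq0 -/N gt_eqF.
have [p [q epq]] := Bezoutz u v; set g := gcdz u v in epq.
have gF k : (g %| k)%Z -> exists k', k = k' * g by move=> /dvdzP.
have [u' eu] := gF _ (dvdz_gcdl u v); have [v' ev] := gF _ (dvdz_gcdr u v).
have g0 : 0 < g.
  rewrite lt0r; apply/andP; split; last by rewrite /g /gcdz.
  by apply: contraTneq N0 => g0; rewrite /N eu ev g0 !mulr0 expr0n.
have gF0 : g%:~R != 0 :> F by rewrite -(fmorph_eq0 i1) rmorph_int intr_eq0 gt_eqF.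
set n : int := g * (u' ^+ 2 + u' * v' - v' ^+ 2).
have eN : N = n * g by rewrite /n /N eu ev; ring.
have nb : ZF (n%:~R / b).
  have -> : n%:~R / b = (u' + v')%:~R + (- v')%:~R * phi.
    apply: (mulIf b0); rewrite divfK // eb mulrC; apply: (mulfI gF0).
    have e1 : (u + v)%:~R = (u' + v')%:~R * g%:~R :> F by rewrite -intrM mulrDl -eu -ev.
    have e2 : (- v)%:~R = (- v')%:~R * g%:~R :> F by rewrite -intrM mulNr -ev.
    by rewrite -intrM (mulrC g) -eN /N -norm_factor e1 e2; ring.
  exact: ZF_coords.
have n0 : 0 < n by rewrite -(pmulr_lgt0 _ g0) -eN.
(* The multiplier (q - p) + p phi turns u + v phi into an element whose phi-coordinate is the Bezout
   combination p u + q v = g; [w0] is its other coordinate. *)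
pose w0 := u * (q - p) + v * p.
have wb : ZF ((w0%:~R + g%:~R * phi) / b).
  have -> : w0%:~R + g%:~R * phi = b * ((q - p)%:~R + p%:~R * phi).
    rewrite eb -epq /w0 !(intrD, intrB, intrM).
    transitivity (u%:~R * (q%:~R - p%:~R) + v%:~R * p%:~R * (phi ^+ 2 - phi) +
       (p%:~R * u%:~R + q%:~R * v%:~R) * phi); last by ring.
    by rewrite phi_sqr; ring.
  by rewrite mulrC mulKf //; apply: ZF_coords.
exists [seq i%:R + j%:R * phi | i <- iota 0 `|n|%N, j <- iota 0 `|g|%N]; split.
- by rewrite size_allpairs !size_iota natrM !natr_absz !gtr0_norm // -intrM -eN.
- move=> x /allpairsP[[i j] [_ _ ->]] /=; exact: ZF_coords i%:Z j%:Z.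
move=> x /ZFP[m [k ->]]; pose t := (k %/ g)%Z; pose m' := m - t * w0.
exists ((m' %% n)%Z%:~R + (k %% g)%Z%:~R * phi).
  have e (a b' : int) : 0 < b' -> exists2 i, i \in iota 0 `|b'|%N & (a %% b')%Z = i%:Z.
    by move=> b'0; exists `|(a %% b')%Z|%N; rewrite ?mem_iota; lia.
  have [i hi ->] := e m' n n0; have [j hj ->] := e k g g0.
  by apply/allpairsP; exists (i, j).
have -> : m%:~R + k%:~R * phi - ((m' %% n)%Z%:~R + (k %% g)%Z%:~R * phi) =
    (m' %/ n)%Z%:~R * n%:~R + t%:~R * (w0%:~R + g%:~R * phi).
  have -> : m = (m' %/ n)%Z * n + (m' %% n)%Z + t * w0 by rewrite -divz_eq /m' subrK.
  rewrite {1}(divz_eq k g) -/t; rewrite !(intrD, intrM); ring.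
by rewrite mulrDl -!mulrA; apply: ZFD; apply: ZFM (ZF_int _) _.
Qed.

Lemma ex_residues b : ZF b -> 0 < nm b -> exists B : seq F,
  [/\ (size B)%:R <= nm b, {in B, forall x, ZF x}, uniq B,
      forall x, ZF x -> exists2 y, y \in B & ZF ((x - y) / b) &
      forall x y, x \in B -> y \in B -> ZF ((x - y) / b) -> x = y].
Proof.
move=> hb b0; have [B0 [szB0 ZB0 cov]] := ex_covering hb b0.
have [||x y z|B [uB sub sz cov' inj]] :=
    @ex_class_representatives _ (fun x y => ZF ((x - y) / b)) B0.
- by move=> x; rewrite subrr mul0r; apply: ZF0.
- by move=> x y; apply: congruent_sym.
- exact: congruent_trans.
exists B; split=> //.
- by rewrite (le_trans _ szB0) // ler_nat.
- by move=> x /sub /ZB0.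
move=> x /cov[y /cov'[z zB yz] xy]; exists z => //; exact: congruent_trans xy yz.
Qed.

(** [b] divides the integer [N] obtained by multiplying it by its conjugate, hence, being prime, one
    of the prime factors of that integer. *)
Lemma ex_rational_prime b : prime_elt b -> exists2 p : nat, prime p & ZF (p%:R / b).
Proof.
case=> hb b0 nub pr.
have [n n0 hn] : exists2 n : nat, (0 < n)%N & ZF (n%:R / b).
  have [u [v eb]] := (ZFP b).1 hb; pose N : int := u ^+ 2 + u * v - v ^+ 2.
  have hN : ZF (N%:~R / b).
    by rewrite -norm_factor -eb mulrC mulKf //; apply: ZF_coords.
  have N0 : N != 0.
    apply: contra_neq b0 => N0; apply/eqP; have : nm b == 0 by rewrite eb norm_coords -/N N0.
    by rewrite mulf_eq0 !fmorph_eq0 orbb.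
  exists `|N|%N; first by rewrite absz_gt0.
  have -> : `|N|%N%:R = (sgz N)%:~R * N%:~R :> F.
    by rewrite -intrM -abszEsg.
  by rewrite -mulrA; apply: ZFM (ZF_int _) hN.
have [m] := ubnP n; elim: m n n0 hn => // m IH n n0 hn ltn.
have [n1|n1] := leqP n 1.
  by case: nub; have := hn; rewrite (_ : n = 1%N) ?mul1r //; lia.
have [] := pr (pdiv n)%:R (n %/ pdiv n)%:R (ZF_nat _) (ZF_nat _).
- by rewrite -natrM mulnC divnK // pdiv_dvd.
- by exists (pdiv n) => //; apply: pdiv_prime.
move=> h; apply: IH h _; first by rewrite divn_gt0 ?pdiv_gt0 // dvdn_leq // pdiv_dvd.
by rewrite -ltnS (leq_trans _ ltn) // ltnS ltn_Pdiv // prime_gt1 // pdiv_prime.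
Qed.

(** If [b] divided [k] as well as [p], a Bezout relation would make it a unit. *)
Lemma prime_elt_cancel b p k x : prime_elt b -> prime p -> ZF (p%:R / b) ->
  ~~ (p %| k)%N -> ZF x -> ZF (k%:R * x / b) -> ZF (x / b).
Proof.
case=> hb b0 nub pr pp hp pk hx /(pr _ _ (ZF_nat k) hx)[hk|//]; case: nub.
have k0 : (0 < k)%N by rewrite lt0n; apply: contraNneq pk => ->; rewrite dvdn0.
case: (egcdnP p k0) => u v e _; move: e.
have /eqP -> : gcdn k p == 1%N by rewrite -[_ == _]/(coprime k p) coprime_sym prime_coprime.
move=> /(congr1 (fun n => n%:R : F)); rewrite natrD !natrM => e.
rewrite -[b^-1]mul1r; have -> : 1 = u%:R * k%:R - v%:R * p%:R :> F by rewrite e addrC addKr.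
by rewrite mulrBl -!mulrA; apply: ZFB; apply: ZFM (ZF_nat _) _.
Qed.

(** ZF modulo [b] is a finite domain: multiplication by [a] is injective on the representatives,
    hence surjective. *)
Lemma prime_elt_solve b a c B : prime_elt b ->
  {in B, forall x, ZF x} -> uniq B ->
  (forall x, ZF x -> exists2 y, y \in B & ZF ((x - y) / b)) ->
  (forall x y, x \in B -> y \in B -> ZF ((x - y) / b) -> x = y) ->
  ZF a -> ~ ZF (a / b) -> ZF c -> exists2 y, y \in B & ZF ((c - a * y) / b).
Proof.
case=> hb b0 nub pr ZB uB cov inj ha nab hc.
have [r hr] : {r : F -> F | forall x, ZF x -> r x \in B /\ ZF ((x - r x) / b)}.
  exists (fun x => xget 0 [set y | y \in B /\ ZF ((x - y) / b)]) => x hx.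
  by case: xgetP => // no; have [y yB hy] := cov x hx; case: (no y).
pose f y := r (a * y).
have fB y : y \in B -> f y \in B by move=> /ZB hy; case: (hr (a * y)) => //; apply: ZFM.
have finj : {in B &, injective f}.
  move=> x y xB yB e; apply: inj => //.
  have [_ h1] := hr _ (ZFM ha (ZB _ xB)); have [_ h2] := hr _ (ZFM ha (ZB _ yB)).
  have := congruent_trans h1; rewrite -/(f x) e => /(_ _ (congruent_sym h2)).
  by rewrite -mulrBr => /(pr _ _ ha (ZFB (ZB _ xB) (ZB _ yB)))[].
have sub : {subset map f B <= B} by move=> _ /mapP[y yB ->]; apply: fB.
have [||_ eqB] := uniq_min_size _ sub _.
- by rewrite map_inj_in_uniq.
- by rewrite size_map.
have [z zB cz] := cov c hc.
have : z \in map f B by rewrite eqB.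
case/mapP => y yB ez; exists y => //.
have [_ h] := hr _ (ZFM ha (ZB _ yB)).
by apply: congruent_trans cz _; rewrite ez; apply: congruent_sym.
Qed.
End Residues.

(** * Hecke representatives *)

Section TwoByTwo.
Variable K : comNzRingType.

Definition mx2 (a b c d : K) : 'M[K]_2 :=
  \matrix_(i < 2, j < 2) if i == 0 then if j == 0 then a else b
                         else if j == 0 then c else d.

Lemma mx2E a b c d : (mx2 a b c d 0 0 = a) * (mx2 a b c d 0 1 = b) *
  (mx2 a b c d 1 0 = c) * (mx2 a b c d 1 1 = d).
Proof. by rewrite !mxE. Qed.

Lemma ord2 (i : 'I_2) : i = 0 \/ i = 1.
Proof. by case: i => [[|[|]]] // h; [left|right]; apply: val_inj. Qed.

Lemma mx2_eta (A : 'M[K]_2) : A = mx2 (A 0 0) (A 0 1) (A 1 0) (A 1 1).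
Proof. by apply/matrixP => i j; case: (ord2 i) => ->; case: (ord2 j) => ->; rewrite mx2E. Qed.

Lemma mulmx2 (A B : 'M[K]_2) i j : (A *m B) i j = A i 0 * B 0 j + A i 1 * B 1 j.
Proof.
by rewrite mxE !big_ord_recl big_ord0 addr0; congr (A _ _ * B _ _ + A _ _ * B _ _);
  apply: val_inj.
Qed.

Lemma mx2_mul a b c d a' b' c' d' : mx2 a b c d *m mx2 a' b' c' d' =
  mx2 (a * a' + b * c') (a * b' + b * d') (c * a' + d * c') (c * b' + d * d').
Proof. by rewrite [LHS]mx2_eta !mulmx2 !mx2E. Qed.

Lemma det_mx2 a b c d : \det (mx2 a b c d) = a * d - b * c.
Proof. by rewrite det2 !mx2E. Qed.
End TwoByTwo.

Section Action.
Context (R : realType) (F : fieldExtType rat).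
Context (i1 i2 : {rmorphism F -> R}).
Implicit Types (A B M : 'M[F]_2) (t : H2 R) (i : {rmorphism F -> R}) (z : R[i]).
Local Notation mob := (mobius2 i1 i2).
Local Notation posdet A := (tot_positive i1 i2 (\det A)).

Definition cocycle i A z : R[i] := (i (A 1 0))%:C * z + (i (A 1 1))%:C.

Lemma cocycle_neq0 i A z : 0 < i (\det A) -> 0 < complex.Im z -> cocycle i A z != 0.
Proof.
rewrite det2 rmorphB !rmorphM /cocycle.
case: z => x y /= hM y0; apply/eqP => -[].
rewrite !mul0r !(addr0, subr0, add0r) => h1 /eqP; rewrite mulf_eq0 (gt_eqF y0) orbF.
by move=> /eqP c0; move: hM h1; rewrite c0; nra.
Qed.

Lemma Im_mobius_gt0 i A z : 0 < i (\det A) -> 0 < complex.Im z ->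
  0 < complex.Im (mobius i A z).
Proof.
move=> hM hz; have := cocycle_neq0 hM hz; move: hM hz; rewrite /mobius /cocycle.
rewrite det2 rmorphB !rmorphM.
move: (i (A 0 0)) (i (A 0 1)) (i (A 1 0)) (i (A 1 1)) => a b c d.
case: z => x y /= hM y0; rewrite eq_complex /= => h.
set D := _ ^+ 2 + _ ^+ 2.
have D0 : 0 < D.
  rewrite /D lt0r paddr_eq0 ?sqr_ge0 // !sqrf_eq0 h /=.
  by rewrite addr_ge0 ?sqr_ge0.
suff -> : forall u v, (a * x - 0 * y + b) * - (u / D) + (a * y + 0 * x + 0) * (v / D)
    = ((a * y) * v - (a * x + b) * u) / D.
  apply: divr_gt0 => //.
  have -> : a * y * (c * x - 0 * y + d) - (a * x + b) * (c * y + 0 * x + 0)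
    = y * (a * d - b * c) by ring.
  exact: mulr_gt0.
by move=> u v; ring.
Qed.

Lemma H2P t : 0 < complex.Im (val t).1 /\ 0 < complex.Im (val t).2.
Proof. by have /andP := valP t. Qed.

Lemma val_mob A t : posdet A ->
  val (mob A t) = (mobius i1 A (val t).1, mobius i2 A (val t).2).
Proof.
move=> [d1 d2]; have [t1 t2] := H2P t; rewrite insubdK //.
by apply/andP; split; apply: Im_mobius_gt0.
Qed.

Lemma mobius_comp i A B z : 0 < i (\det A) -> 0 < i (\det B) -> 0 < complex.Im z ->
  mobius i (A *m B) z = mobius i A (mobius i B z) /\
  cocycle i (A *m B) z = cocycle i A (mobius i B z) * cocycle i B z.
Proof.
move=> hA hB hz; have h2 := cocycle_neq0 hB hz.
have h3 := cocycle_neq0 hA (Im_mobius_gt0 hB hz); move: h2 h3.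
rewrite /mobius /cocycle !mulmx2 !rmorphD !rmorphM /=.
move: (i (B 0 0))%:C (i (B 0 1))%:C (i (B 1 0))%:C (i (B 1 1))%:C.
move: (i (A 0 0))%:C (i (A 0 1))%:C (i (A 1 0))%:C (i (A 1 1))%:C.
move=> a' b' c' d' a b c d h1 h2.
have e : (c' * a + d' * c) * z + (c' * b + d' * d)
  = (c' * ((a * z + b) / (c * z + d)) + d') * (c * z + d) by field.
rewrite e; split=> //.
have -> : (a' * a + b' * c) * z + (a' * b + b' * d)
  = (a' * ((a * z + b) / (c * z + d)) + b') * (c * z + d) by field.
by rewrite -mulf_div divff // mulr1.
Qed.

Definition autf A t : R[i] := cocycle i1 A (val t).1 * cocycle i2 A (val t).2.

Lemma autf_neq0 A t : posdet A -> autf A t != 0.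
Proof. by case=> d1 d2; have [t1 t2] := H2P t; rewrite mulf_neq0 // cocycle_neq0. Qed.

Lemma mobM A B t : posdet A -> posdet B -> mob (A *m B) t = mob A (mob B t).
Proof.
move=> hA hB; have [t1 t2] := H2P t.
have hAB : posdet (A *m B).
  by rewrite det_mulmx; case: hA hB => [??] [??]; split; rewrite rmorphM mulr_gt0.
apply: val_inj; rewrite !val_mob //=.
case: hA hB => [a1 a2] [b1 b2].
by have [-> _] := mobius_comp a1 b1 t1; have [-> _] := mobius_comp a2 b2 t2.
Qed.

Lemma autfM A B t : posdet A -> posdet B -> autf (A *m B) t = autf A (mob B t) * autf B t.
Proof.
move=> hA hB; have [t1 t2] := H2P t; rewrite /autf !val_mob //=.
case: hA hB => [a1 a2] [b1 b2].
by have [_ ->] := mobius_comp a1 b1 t1; have [_ ->] := mobius_comp a2 b2 t2; ring.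
Qed.

Lemma posdet1 M : \det M = 1 -> posdet M.
Proof. by move=> ->; split; rewrite rmorph1 ltr01. Qed.

Lemma mob1 t : mob 1%:M t = t.
Proof.
apply: val_inj; rewrite val_mob ?det1; last by split; rewrite rmorph1 ltr01.
by case: (val t) => a b; rewrite /mobius !mxE /= !rmorph1 !rmorph0 !mul1r !mul0r !addr0 !add0r !divr1.
Qed.

Lemma scaleV_mob b t : tot_positive i1 i2 b -> scaleV i1 i2 b t = mob (mx2 1 0 0 b) t.
Proof.
move=> hb; apply: val_inj; rewrite val_scaleV // val_mob.
  by rewrite /mobius !mx2E !rmorph1 !rmorph0 !mul1r !mul0r !addr0 !add0r.
by rewrite det_mx2 mul1r mul0r subr0.
Qed.

Lemma swapK : involutive (@swap R).
Proof. by move=> t; apply: val_inj; rewrite !val_swap /=; case: (val t). Qed.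
End Action.

Section Representatives.
Context (R : realType) (F : fieldExtType rat) (s : F).
Context (i1 i2 : {rmorphism F -> R}) {G : golden s i1 i2}.
Implicit Types (A B M : 'M[F]_2) (t : H2 R) (b : F).
Local Notation mob := (mobius2 i1 i2).
Local Notation conj := (conjF i1 i2).
Local Notation Gam := (Gamma i1 i2).

(** Conjugation by diag(s, 1) identifies these with the matrices of determinant [b] over ZF;
    [hecke 1] is Gamma. *)
Definition hecke b : set 'M[F]_2 :=
  [set A | [/\ \det A = b, ZF (A 0 0), ZF (A 0 1 / s), ZF (s * A 1 0) & ZF (A 1 1)]].

Lemma Gamma_hecke M : Gam M <-> hecke 1 M.
Proof. by split=> -[h1 h2 /ideal_invP h3 /ZFvP h4 h5]; split. Qed.

Lemma heckeM b c A B : hecke b A -> hecke c B -> hecke (b * c) (A *m B).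
Proof.
have s0 : s != 0 by exact: s_neq0.
move=> [<- a1 a2 a3 a4] [<- b1 b2 b3 b4].
split; rewrite ?det_mulmx ?mulmx2 //.
- apply: ZFD; first exact: ZFM.
  have -> : A 0 1 * B 1 0 = (A 0 1 / s) * (s * B 1 0) by field.
  exact: ZFM.
- have -> : (A 0 0 * B 0 1 + A 0 1 * B 1 1) / s = A 0 0 * (B 0 1 / s) + (A 0 1 / s) * B 1 1.
    by field.
  by apply: ZFD; apply: ZFM.
- have -> : s * (A 1 0 * B 0 0 + A 1 1 * B 1 0) = s * A 1 0 * B 0 0 + A 1 1 * (s * B 1 0).
    by ring.
  by apply: ZFD; apply: ZFM.
apply: ZFD; last exact: ZFM.
have -> : A 1 0 * B 0 1 = (s * A 1 0) * (B 0 1 / s) by field.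
exact: ZFM.
Qed.

Definition adj2 M : 'M[F]_2 := mx2 (M 1 1) (- M 0 1) (- M 1 0) (M 0 0).

Lemma mul_adj2 M : M *m adj2 M = (\det M)%:M /\ adj2 M *m M = (\det M)%:M.
Proof.
rewrite det2 /adj2; split; rewrite [RHS]mx2_eta [LHS]mx2_eta !mulmx2 !mx2E !mxE /=;
  rewrite ?(mulr1n, mulr0n); congr mx2; ring.
Qed.

Lemma Gamma_adj M : Gam M -> Gam (adj2 M).
Proof.
move=> /Gamma_hecke[h1 h2 h3 h4 h5]; apply/Gamma_hecke; split; rewrite ?mx2E //.
- by rewrite det_mx2 -h1 det2; ring.
- by rewrite mulNr; apply: ZFN.
by rewrite mulrN; apply: ZFN.
Qed.

Lemma swap_mob A t : tot_positive i1 i2 (\det A) ->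
  swap (mob A t) = mob (map_mx conj A) (swap t).
Proof.
move=> hA; have hA' : tot_positive i1 i2 (\det (map_mx conj A)).
  have -> : \det (map_mx conj A) = conj (\det A).
    by rewrite !det2 !mxE conjFD conjFN !conjFM.
  by rewrite /tot_positive i1_conj i2_conj; case: hA.
apply: val_inj; rewrite val_swap !val_mob // val_swap /=.
by rewrite /mobius !mxE !i1_conj !i2_conj.
Qed.

Lemma Gamma_conj M : Gam M -> Gam (map_mx conj M).
Proof.
move=> /Gamma_hecke[h1 h2 h3 h4 h5]; apply/Gamma_hecke; split; rewrite ?mxE.
- by rewrite det2 !mxE -!conjFM -conjFN -conjFD -det2 h1 conjF1.
- exact: ZF_conj.
- have -> : conj (M 0 1) / s = - conj (M 0 1 / s).
    by rewrite conjFM conjFV conjF_s invrN mulrN opprK.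
  exact/ZFN/ZF_conj.
- have -> : s * conj (M 1 0) = - conj (s * M 1 0) by rewrite conjFM conjF_s mulNr opprK.
  exact/ZFN/ZF_conj.
exact: ZF_conj.
Qed.
End Representatives.

Definition residue_system (F : fieldExtType rat) (b : F) (B : seq F) :=
  [/\ {in B, forall x, ZF x}, uniq B,
      forall x, ZF x -> exists2 y, y \in B & ZF ((x - y) / b) &
      forall x y, x \in B -> y \in B -> ZF ((x - y) / b) -> x = y].

Section HeckeRepresentatives.
Context (R : realType) (F : fieldExtType rat) (s : F).
Context (i1 i2 : {rmorphism F -> R}) {G : golden s i1 i2}.
Variables (b : F) (B : seq F).
Hypotheses (b_prime : prime_elt b) (b_pos : tot_positive i1 i2 b).
Hypothesis (B_res : residue_system b B).
Implicit Types (A M : 'M[F]_2) (t : H2 R).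
Local Notation Gam := (Gamma i1 i2).

Definition hecke_reps : seq 'M[F]_2 :=
  mx2 b 0 0 1 :: [seq mx2 1 (s * y) 0 b | y <- B].

Let s0 : s != 0. Proof. exact: s_neq0. Qed.
Let b0 : b != 0. Proof. by case: b_prime. Qed.
Let Zb : ZF b. Proof. by case: b_prime. Qed.

Lemma hecke_repsP A : A \in hecke_reps ->
  A = mx2 b 0 0 1 \/ exists2 y, y \in B & A = mx2 1 (s * y) 0 b.
Proof. by rewrite inE => /predU1P[->|/mapP[y yB ->]]; [left|right; exists y]. Qed.

Lemma hecke_reps_hecke A : A \in hecke_reps -> hecke s b A.
Proof.
case/hecke_repsP => [->|[y yB ->]]; split; rewrite ?mx2E ?det_mx2 ?mul0r ?mulr0 //.
- by rewrite mulr1 subr0.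
- exact: ZF0.
- exact: ZF0.
- exact: ZF1.
- by rewrite mul1r subr0.
- exact: ZF1.
- by rewrite mulrC mulKf //; case: B_res => h *; apply: h.
- exact: ZF0.
Qed.

(** With entries a, s e, c/s, d one has ad - ec = b. If [b] divides a and c, it can be extracted
    from the first column. Otherwise y must satisfy e = a y and d = c y modulo [b]: the congruence
    with invertible coefficient determines y, and the other follows from ad - ec = b because [b] is
    prime. *)
Lemma hecke_reps_cover A : hecke s b A ->
  exists2 A', A' \in hecke_reps & exists2 M, Gam M & A = M *m A'.
Proof.
have [ZB uB cov inj] := B_res; have pr : forall x y, _ := let: And4 _ _ _ pr := b_prime in pr.
case; set a := A 0 0; set e := A 0 1 / s; set c := s * A 1 0; set d := A 1 1.
move=> hdet Za Ze Zc Zd.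
have hb : a * d - e * c = b by rewrite -hdet det2 /a /d /e /c; field.
have EA : A = mx2 a (s * e) (c / s) d.
  by rewrite [LHS]mx2_eta /a /d /e /c; congr mx2; field; rewrite ?s0 ?b0.
clearbody a e c d.
have [[h1 h2]|hn] := pselect (ZF (a / b) /\ ZF (c / b)).
  exists (mx2 b 0 0 1); first by rewrite mem_head.
  exists (mx2 (a / b) (s * e) (c / s / b) d); last first.
    by rewrite mx2_mul EA !mulr0 !mulr1 !addr0 !add0r !divfK.
  apply/Gamma_hecke; split; rewrite ?mx2E //.
  - rewrite det_mx2; transitivity ((a * d - e * c) / b); last by rewrite hb divff.
    by field; rewrite ?s0 ?b0.
  - by rewrite mulrC mulKf.
  - by have -> : s * (c / s / b) = c / b; [field; rewrite ?s0 ?b0|].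
suff [y yB [h1 h2]] : exists2 y, y \in B & ZF ((e - a * y) / b) /\ ZF ((d - c * y) / b).
  exists (mx2 1 (s * y) 0 b); first by rewrite inE; apply/orP; right; apply/mapP; exists y.
  exists (mx2 a (s * ((e - a * y) / b)) (c / s) ((d - c * y) / b)).
    apply/Gamma_hecke; split; rewrite ?mx2E //.
    - rewrite det_mx2; transitivity ((a * d - e * c) / b); last by rewrite hb divff.
      by field; rewrite ?s0 ?b0.
    - by rewrite mulrC mulKf.
    - by rewrite mulrCA divff // mulr1.
  by rewrite mx2_mul EA; congr mx2; field; rewrite ?s0 ?b0.
have [ha|ha] := pselect (ZF (a / b)); last first.
  have [y yB hy] := prime_elt_solve b_prime ZB uB cov inj Za ha Ze.
  exists y => //; split=> //; have Zy := ZB _ yB.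
  have [] // := pr a (d - c * y) Za (ZFB Zd (ZFM Zc Zy)).
  have -> : a * (d - c * y) / b = (a * d - e * c) / b + c * ((e - a * y) / b) by field; rewrite ?s0 ?b0.
  by rewrite hb divff //; apply: ZFD ZF1 (ZFM _ _).
have hc : ~ ZF (c / b) by move=> hc; apply: hn.
have [y yB hy] := prime_elt_solve b_prime ZB uB cov inj Zc hc Zd.
exists y => //; split=> //; have Zy := ZB _ yB.
have [] // := pr c (e - a * y) Zc (ZFB Ze (ZFM Za Zy)).
have -> : c * (e - a * y) / b = a * ((d - c * y) / b) - (a * d - e * c) / b by field; rewrite ?s0 ?b0.
by rewrite hb divff //; apply: ZFB (ZFM _ _) ZF1.
Qed.

Lemma hecke_reps_inj A A' M : A \in hecke_reps -> A' \in hecke_reps ->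
  Gam M -> A = M *m A' -> A = A'.
Proof.
have [ZB uB cov inj] := B_res; have nb : ~ ZF b^-1 by case: b_prime.
move=> /hecke_repsP hA /hecke_repsP hA' /Gamma_hecke[_ M0 M1 M2 M3] e.
have e00 := congr1 (fun X : 'M_2 => X 0 0) e; have e01 := congr1 (fun X : 'M_2 => X 0 1) e.
have e10 := congr1 (fun X : 'M_2 => X 1 0) e; have e11 := congr1 (fun X : 'M_2 => X 1 1) e.
move: e00 e01 e10 e11; rewrite !mulmx2.
case: hA => [->|[y yB ->]]; case: hA' => [->|[y' yB' ->]]; rewrite ?mx2E //.
- rewrite !mulr1 !mulr0 !addr0 => _ _ <-; rewrite mul0r add0r => e11; case: nb.
  by have -> : b^-1 = M 1 1; [apply: (mulIf b0); rewrite mulVf|].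
- rewrite !mulr0 !addr0 => e00; case: nb.
  by have -> : b^-1 = M 0 0; [apply: (mulIf b0); rewrite mulVf|].
rewrite !mulr1 !mulr0 !addr0 => <- e01 _ _; congr mx2; congr (_ * _); apply: inj => //.
have -> : (y - y') / b = M 0 1 / s; last by [].
apply: (mulIf b0); apply: (mulfI s0); rewrite divfK //.
transitivity (M 0 1 * b); last by field; rewrite ?s0 ?b0.
by apply: (addrI (1 * (s * y'))); rewrite -e01; ring.
Qed.

Lemma hecke_reps_uniq : uniq hecke_reps.
Proof.
have [ZB uB cov inj] := B_res; have nb : ~ ZF b^-1 by case: b_prime.
rewrite /= map_inj_uniq ?uB ?andbT.
  apply/mapP => -[y _] /(congr1 (fun X : 'M_2 => X 0 0)); rewrite !mx2E => e.
  by apply: nb; rewrite e invr1; apply: ZF1.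
by move=> x y /(congr1 (fun X : 'M_2 => X 0 1)); rewrite !mx2E => /(mulfI s0).
Qed.

(** Right multiplication by [M] permutes the cosets of Gamma in [hecke s b]; [f] is this permutation
    read on representatives. *)
Lemma hecke_reps_perm M : Gam M -> exists f : 'M[F]_2 -> 'M[F]_2,
  perm_eq (map f hecke_reps) hecke_reps /\
  forall A, A \in hecke_reps -> exists2 M', Gam M' & A *m M = M' *m f A.
Proof.
move=> hM; have hMh : hecke s 1 M by apply/Gamma_hecke.
have ex A : A \in hecke_reps -> exists A',
    A' \in hecke_reps /\ exists2 M', Gam M' & A *m M = M' *m A'.
  move=> /hecke_reps_hecke hA.
  have hAM : hecke s b (A *m M) by rewrite -[b]mulr1; apply: heckeM.
  by have [A' hA' [M' hM' e]] := hecke_reps_cover hAM; exists A'; split=> //; exists M'.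
pose f A := xget A [set A' | A' \in hecke_reps /\ exists2 M', Gam M' & A *m M = M' *m A'].
have fP A : A \in hecke_reps ->
    f A \in hecke_reps /\ exists2 M', Gam M' & A *m M = M' *m f A.
  by move=> /ex[A' hA']; rewrite /f; case: xgetP => [//|/(_ A')].
exists f; split; last by move=> A /fP[].
have detM : \det M = 1 by case: hM.
have finj : {in hecke_reps &, injective f}.
  move=> A A' hA hA' e; have [_ [N hN eN]] := fP A hA; have [_ [N' hN' eN']] := fP A' hA'.
  have detN' : \det N' = 1 by case: hN'.
  apply: (hecke_reps_inj (M := N *m adj2 N') hA hA').
    by apply/Gamma_hecke; rewrite -[1]mulr1; apply: heckeM; apply/Gamma_hecke => //;
       apply: Gamma_adj.
  have uM : M \in unitmx by rewrite unitmxE detM unitr1.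
  apply: (can_inj (mulmxK uM)); rewrite eN -mulmxA eN' e -!mulmxA; congr (_ *m _).
  by rewrite mulmxA (mul_adj2 N').2 detN' mul1mx.
have ufr : uniq (map f hecke_reps) by rewrite map_inj_in_uniq // hecke_reps_uniq.
have sub : {subset map f hecke_reps <= hecke_reps} by move=> _ /mapP[A hA ->]; case: (fP A hA).
have [|_ eqm] := uniq_min_size ufr sub; first by rewrite size_map.
by apply: uniq_perm => //; apply: hecke_reps_uniq.
Qed.
End HeckeRepresentatives.

Section FullGroup.
Context (R : realType) (F : fieldExtType rat) (s : F).
Context (i1 i2 : {rmorphism F -> R}) {G : golden s i1 i2}.
Implicit Types (A M : 'M[F]_2) (t : H2 R).
Local Notation mob := (mobius2 i1 i2).
Local Notation conj := (conjF i1 i2).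
Local Notation Gam := (Gamma i1 i2).

Lemma Gamma_posdet M : Gam M -> tot_positive i1 i2 (\det M).
Proof. by case=> h _ _ _ _; apply: posdet1. Qed.

Lemma GammaM M N : Gam M -> Gam N -> Gam (M *m N).
Proof.
move=> /Gamma_hecke hM /Gamma_hecke hN; apply/Gamma_hecke.
by rewrite -[1]mulr1; apply: heckeM.
Qed.

Definition swap_if (e : bool) t := if e then swap t else t.

Lemma swap_if_mob e M : Gam M -> exists2 M', Gam M' &
  forall t, swap_if e (mob M t) = mob M' (swap_if e t).
Proof.
case: e => hM; last by exists M.
exists (map_mx conj M); first exact: Gamma_conj.
by move=> t; rewrite /= swap_mob //; apply: Gamma_posdet.
Qed.

Lemma swap_ifK e : involutive (@swap_if e).
Proof. by case: e => t //=; rewrite swapK. Qed.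

Lemma swap_ifD e e' t : swap_if e (swap_if e' t) = swap_if (e (+) e') t.
Proof. by case: e; case: e' => //=; rewrite swapK. Qed.

(** The exchange of coordinates normalizes Gamma, since moving it past a matrix conjugates the
    entries; so these normal forms are closed under the group operations. *)
Lemma Gamma0P (g : bijection (H2 R)) : Gamma0 i1 i2 g ->
  exists2 M, Gam M & exists e, (g : H2 R -> H2 R) =1 mob M \o swap_if e.
Proof.
pose S : set (bijection (H2 R)) := [set g | exists2 M, Gam M & exists e,
  (g : H2 R -> H2 R) =1 mob M \o swap_if e].
suff : Gamma0 i1 i2 `<=` S by move=> h /h.
apply: smallest_sub; last first.
  move=> h [[M hM e]|e]; first by exists M => //; exists false.
  exists 1%:M; last by exists true => t; rewrite /= mob1 e.
  apply/Gamma_hecke; split; rewrite ?det1 // !mxE /= ?mul0r ?mulr0;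
    by [exact: ZF0|exact: ZF1].
split.
  exists 1%:M; last by exists false => t; rewrite /= mob1.
  apply/Gamma_hecke; split; rewrite ?det1 // !mxE /= ?mul0r ?mulr0;
    by [exact: ZF0|exact: ZF1].
move=> x y [M hM [e ex]] [N hN [e' ey]].
have hN' : Gam (adj2 N) by exact: Gamma_adj.
have detN : \det N = 1 by case: hN.
have [N1 hN1 eN1] := swap_if_mob (e (+) e') hN'.
exists (M *m N1); first exact: GammaM.
exists (e (+) e') => t /=.
have -> : bij_inv y t = swap_if e' (mob (adj2 N) t).
  rewrite -[RHS](bij_funK y) ey /= swap_ifK -mobM; try exact: Gamma_posdet.
  by rewrite (mul_adj2 N).1 detN mob1.
by rewrite ex /= swap_ifD eN1 mobM //; exact: Gamma_posdet.
Qed.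

(** Division by [b] is the action of diag(1, b), and diag(1, b) times an element of Gamma is again a
    Hecke matrix, which factors through a representative. *)
Lemma hecke_orbit b B (g : bijection (H2 R)) :
  prime_elt b -> tot_positive i1 i2 b -> residue_system b B -> Gamma0 i1 i2 g ->
  exists2 A, A \in hecke_reps s b B & exists2 M, Gam M & exists e, forall t,
    scaleV i1 i2 b (g t) = mob M (mob A (swap_if e t)).
Proof.
move=> bp b0 hB /Gamma0P[N hN [e eg]].
have hA : hecke s b (mx2 1 0 0 b *m N).
  rewrite -[b in hecke _ b]mulr1; apply: heckeM; last exact/Gamma_hecke.
  have [Zb *] := bp; split; rewrite ?mx2E ?det_mx2 ?mulr0 ?mul0r ?mul1r ?subr0 //;
    by [exact: ZF1|exact: ZF0].
have [A hAr [M hM eA]] := hecke_reps_cover bp hB hA.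
have posb X : \det X = b -> tot_positive i1 i2 (\det X) by move=> ->.
have detA : \det A = b.
  have : \det (mx2 1 0 0 b *m N) = \det (M *m A) by rewrite eA.
  by rewrite !det_mulmx det_mx2; case: hN => -> _ _ _ _; case: hM => -> _ _ _ _;
    rewrite !mulr1 !mul1r mulr0 subr0.
exists A => //; exists M => //; exists e => t.
rewrite eg /= scaleV_mob // -mobM; last exact: Gamma_posdet.
  by rewrite eA mobM //; [exact: Gamma_posdet|exact: posb].
by apply: posb; rewrite det_mx2 mul1r mulr0 subr0.
Qed.
End FullGroup.

(** * Fourier expansions *)

Section Exp2ipi.
Variable R : realType.
Implicit Types z w : R[i].

Lemma exp2ipiD z w : exp2ipi (z + w) = exp2ipi z * exp2ipi w.
Proof.
case: z => x y; case: w => x' y'; rewrite /exp2ipi /= !mulrDr opprD expRD cosD sinD.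
move: (expR _) (expR _) (cos _) (cos _) (sin _) (sin _) => a b c d e f.
by apply/eqP; rewrite eq_complex /=; apply/andP; split; apply/eqP; ring.
Qed.

Lemma exp2ipi0 : exp2ipi 0 = 1 :> R[i].
Proof.
rewrite /exp2ipi /= mulr0 oppr0 expR0 cos0 sin0.
by apply/eqP; rewrite eq_complex /= !(mulr1, mul1r, mulr0, mul0r, subr0, addr0) !eqxx.
Qed.

Lemma cabs_exp2ipi z : cabs (exp2ipi z) = expR (- (2 * pi * complex.Im z)).
Proof.
rewrite /exp2ipi cabsM cabs_real ger0_norm ?expR_ge0 //.
by rewrite /cabs /= cos2Dsin2 sqrtr1 mulr1.
Qed.

Lemma exp2ipi_real (x : R) : exp2ipi x%:C = cos (2 * pi * x) +i* sin (2 * pi * x).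
Proof.
rewrite /exp2ipi /= mulr0 oppr0 expR0.
by apply/eqP; rewrite eq_complex /= !(mulr1, mul1r, mulr0, mul0r, subr0, addr0) !eqxx.
Qed.

Lemma exp2ipi_half : exp2ipi (2^-1)%:C = -1 :> R[i].
Proof.
rewrite exp2ipi_real mulrAC divff ?pnatr_eq0 // mul1r cospi sinpi.
by apply/eqP; rewrite eq_complex /= oppr0 !eqxx.
Qed.

Lemma exp2ipi_nat (n : nat) : exp2ipi n%:R%:C = 1 :> R[i].
Proof.
elim: n => [|n IH]; first exact: exp2ipi0.
rewrite -addn1 natrD realcD exp2ipiD IH mul1r.
have -> : 1%:R = 2^-1 + 2^-1 :> R by field.
by rewrite realcD exp2ipiD exp2ipi_half mulrNN mulr1.
Qed.

Lemma exp2ipi_int (n : int) : exp2ipi n%:~R%:C = 1 :> R[i].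
Proof.
case: n => n; first exact: exp2ipi_nat.
have := exp2ipi0; rewrite NegzE -(subrr (n.+1%:R%:C)) exp2ipiD exp2ipi_nat mul1r => <-.
by congr exp2ipi; rewrite mulrNz rmorphN.
Qed.

(** Once the integer part is removed, injectivity of the cosine on [0, pi] settles y <= 1/2, and 1 -
    y reduces the rest to this case. *)
Lemma exp2ipi_eq1 (x : R) : exp2ipi x%:C = 1 -> x \is a Num.int.
Proof.
have pi0 := @pi_gt0 R.
have small (y : R) : 0 <= y -> y <= 2^-1 -> exp2ipi y%:C = 1 -> y = 0.
  move=> y0 y1; rewrite exp2ipi_real => -[ec _].
  have : 2 * pi * y = 0.
    apply: cos_inj; last by rewrite ec cos0.
      rewrite in_itv /=; apply/andP; split; first by rewrite !mulr_ge0 // ltW.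
      rewrite [X in _ <= X](_ : _ = 2 * pi * 2^-1); last by field.
      by rewrite ler_pM2l // mulr_gt0.
    by rewrite in_itv /= lexx ltW.
  by move/eqP; rewrite !mulf_eq0 pnatr_eq0 (gt_eqF pi0) /= => /eqP.
have /andP[lef ltf] := floor_itv x; set n := Num.floor x in lef ltf.
pose y := x - n%:~R; have ex : x = n%:~R + y by rewrite addrC subrK.
have y0 : 0 <= y by rewrite subr_ge0.
have y1 : y < 1 by move: ltf; rewrite intrD /y; lra.
rewrite ex realcD exp2ipiD exp2ipi_int mul1r => ey.
have [le|gt] := leP y 2^-1; first by rewrite (small y y0 le ey) addr0 intr_int.
have ey' : exp2ipi (1 - y)%:C = 1.
  have := exp2ipi_nat 1; rewrite -[1%:R](subrK y) realcD exp2ipiD ey mulr1.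
  by rewrite mulr1n.
have := small (1 - y) _ _ ey'; rewrite subr_ge0 (ltW y1) => /(_ isT).
have -> : 1 - y <= 2^-1 by lra.
by move=> /(_ isT); lra.
Qed.
End Exp2ipi.

Section Characters.
Context (R : realType) (F : fieldExtType rat).
Context (i1 i2 : {rmorphism F -> R}).
Implicit Types (x y nu : F) (t : H2 R).
Local Notation mob := (mobius2 i1 i2).

Definition chi x : R[i] := exp2ipi (trace i1 i2 x)%:C.

Definition qexp nu t : R[i] :=
  exp2ipi ((i1 nu)%:C * (val t).1 + (i2 nu)%:C * (val t).2).

Lemma chiD x y : chi (x + y) = chi x * chi y.
Proof. by rewrite /chi -exp2ipiD -realcD /trace !rmorphD /= addrACA. Qed.

Lemma chi0 : chi 0 = 1.
Proof. by rewrite /chi /trace !rmorph0 addr0 exp2ipi0. Qed.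

Lemma cabs_chi x : cabs (chi x) = 1.
Proof. by rewrite cabs_exp2ipi /= mulr0 oppr0 expR0. Qed.

Lemma chi_quarter : chi 4^-1 = -1.
Proof.
rewrite /chi /trace !fmorphV !rmorph_nat; have -> : 4^-1 + 4^-1 = 2^-1 :> R by field.
exact: exp2ipi_half.
Qed.

Lemma qexpD x y t : qexp (x + y) t = qexp x t * qexp y t.
Proof. by rewrite /qexp -exp2ipiD !rmorphD /=; congr exp2ipi; ring. Qed.

Lemma qexp0 t : qexp 0 t = 1.
Proof. by rewrite /qexp !rmorph0 !mul0r addr0 exp2ipi0. Qed.

Lemma cabs_qexp nu t : cabs (qexp nu t) =
  expR (- (2 * pi * (i1 nu * complex.Im (val t).1 + i2 nu * complex.Im (val t).2))).
Proof.
rewrite cabs_exp2ipi; congr (expR (- (_ * _))).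
by case: (val t) => -[a b] [c d] /=; rewrite !mul0r !addr0.
Qed.

Lemma qexp_neq0 nu t : qexp nu t != 0.
Proof. by rewrite -cabs_gt0 cabs_qexp expR_gt0. Qed.

Lemma qexp_swap nu t : qexp nu (swap t) =
  exp2ipi ((i2 nu)%:C * (val t).1 + (i1 nu)%:C * (val t).2).
Proof. by rewrite /qexp val_swap /= addrC. Qed.

Lemma qexp_mob nu a x d t : tot_positive i1 i2 (a * d) ->
  qexp nu (mob (mx2 a x 0 d) t) = qexp (nu * a / d) t * chi (nu * x / d).
Proof.
move=> ad; have d0 : d != 0.
  by apply/eqP => d0; case: ad; rewrite d0 mulr0 rmorph0 ltxx.
rewrite /qexp /chi -exp2ipiD val_mob ?det_mx2 ?mulr0 ?subr0 //; congr exp2ipi.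
rewrite /mobius !mx2E /trace !(fmorph_div, rmorphM, rmorphD, rmorph0) /= !mul0r !add0r.
have d1 : (i1 d)%:C != 0 by rewrite (inj_eq (@realc_inj R) _ 0) fmorph_eq0.
have d2 : (i2 d)%:C != 0 by rewrite (inj_eq (@realc_inj R) _ 0) fmorph_eq0.
by field; rewrite d1 d2.
Qed.

(** Uniqueness of Fourier coefficients. Averaging kills the coefficients in a finite set outside of
    which the absolute sum is at most half of [cabs (u nu0)], and keeps that of [nu0]; a zero sum
    would then give [cabs (u nu0) <= cabs (u nu0) / 2]. *)
Lemma sums_chi_eq0 (u : F -> R[i]) :
  (forall x, sums (fun nu => u nu * chi (nu * x)) 0) -> forall nu, u nu = 0.
Proof.
move=> hu nu0; apply/eqP; apply: contraT => u0.
pose P (v : F -> R[i]) := [/\ forall x, sums (fun nu => v nu * chi (nu * x)) 0,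
  forall nu, cabs (v nu) <= cabs (u nu) & v nu0 = u nu0].
(* Averaging with a translation under which the characters of [nu0] and [nu1] differ
   by the factor [-1] kills the coefficient of [nu1] and keeps that of [nu0]. *)
have kill (A : seq F) : exists2 v, P v & forall nu, nu \in A -> nu != nu0 -> v nu = 0.
  elim: A => [|nu1 A [v [v1 v2 v3] v4]].
    by exists u => //; split.
  have [->|ne] := eqVneq nu1 nu0.
    by exists v => // nu; rewrite inE => /predU1P[->|/v4 //]; rewrite eqxx.
  pose x0 := (4 * (nu1 - nu0))^-1.
  exists (fun nu => v nu * ((1 + chi ((nu - nu0) * x0)) / 2)); last first.
    move=> nu; rewrite inE => /predU1P[->|nuA] nu00; last by rewrite v4 ?mul0r.
    have -> : (nu1 - nu0) * x0 = 4^-1.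
      by rewrite /x0 invfM mulrCA divff ?subr_eq0 ?mulr1.
    by rewrite chi_quarter subrr mul0r mulr0.
  split=> [x|nu|].
  - have h := sumsD (sumsZ (2^-1) (v1 x)) (sumsZ (chi (- (nu0 * x0)) / 2) (v1 (x + x0))).
    rewrite !mulr0 addr0 in h; apply: eq_sums h => nu.
    by rewrite mulrDr chiD mulrBl chiD; field.
  - apply: le_trans (v2 nu); rewrite cabsM ler_piMr ?cabs_ge0 //.
    rewrite cabsM cabsV -[2]/(2%:R) -(rmorph_nat (real_complex R)) cabs_real normr_nat.
    rewrite ler_pdivrMr // mul1r (le_trans (cabsD _ _)) // cabs1 cabs_chi //.
  - by rewrite subrr mul0r chi0 -v3; field.
have hs : abs_summable u.
  apply: abs_summable_le (sums_abs (hu 0)) => nu.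
  by rewrite mulr0 chi0 mulr1.
have e0 : 0 < cabs (u nu0) / 2 by rewrite divr_gt0 // cabs_gt0.
have [A0 tail] := abs_summable_tail hs e0.
have [v [v1 v2 v3] v4] := kill (nu0 |` A0)%fset.
pose w nu := if nu == nu0 then - u nu0 else 0.
have hw : sums w (- u nu0).
  have -> : - u nu0 = \sum_(nu <- [fset nu0]%fset) w nu by rewrite big_seq_fset1 /w eqxx.
  by apply: sums_finite => nu; rewrite inE /w => /negPf ->.
have h := sumsD (v1 0) hw.
have vw nu : cabs (v nu * chi (nu * 0) + w nu) <= if nu \in (nu0 |` A0)%fset then 0 else cabs (u nu).
  rewrite mulr0 chi0 mulr1 /w; have [->|ne] := eqVneq nu nu0.
    by rewrite v3 subrr cabs0; case: ifP; rewrite ?cabs_ge0.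
  rewrite addr0; case: ifP => [nuA|_]; last exact: v2.
  by rewrite v4 ?cabs0.
have : cabs (- u nu0) <= cabs (u nu0) / 2.
  rewrite -[X in cabs X]add0r; apply: sums_bound h _ => A.
  apply: le_trans (tail (A `\` (nu0 |` A0))%fset _); last first.
    by apply/fdisjointP => nu nuA; rewrite !inE nuA orbT.
  rewrite [X in _ <= X](_ : _ = \sum_(i <- A | i \notin (nu0 |` A0)%fset) cabs (u i)); last first.
    suff -> : (A `\` (nu0 |` A0) = [fset i in A | i \notin (nu0 |` A0)])%fset by rewrite big_fset.
    by apply/fsetP => i; rewrite !inE andbC.
  rewrite [X in _ <= X]big_mkcond /=; apply: ler_sum => nu _.
  by apply: le_trans (vw nu) _; case: ifP.
rewrite cabsN; have := u0; rewrite -cabs_gt0; lra.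
Qed.
End Characters.

(** For [p < 0], Bernoulli's inequality makes [- eta ^+ k * p] grow at least linearly in k, while
    the term in [q] stays bounded by [|q|]. *)
Lemma bounded_exponential_orbit (R : realType) (p q eta C : R) : 1 < eta ->
  (forall k, expR (- (2 * pi * (eta ^+ k * p + eta ^- k * q))) <= C) -> 0 <= p.
Proof.
move=> eta1 hC; rewrite leNgt; apply/negP => p0.
have bern k : 1 + k%:R * (eta - 1) <= eta ^+ k.
  elim: k => [|k IH]; first by rewrite mul0r addr0 expr0.
  have : eta * (1 + k%:R * (eta - 1)) <= eta ^+ k.+1.
    by rewrite exprS ler_pM2l // (lt_trans _ eta1).
  have : 0 <= k%:R * (eta - 1) * (eta - 1) by rewrite !mulr_ge0 // subr_ge0 ltW.
  by rewrite -natr1; lra.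
have pi0 := @pi_gt0 R; have pi2 : 1 <= 2 * pi :> R by have := @pi_ge2 R; lra.
have low k : k%:R * ((eta - 1) * - p) <= `|C| + `|q|.
  have e0 : 0 < eta by lra.
  have inv1 : 0 <= eta ^- k <= 1.
    by rewrite invr_ge0 exprn_ge0 ?(ltW e0) //= invf_le1 ?exprn_gt0 // exprn_ege1 // ltW.
  have hq : eta ^- k * q <= `|q|.
    by case/andP: inv1 => h0 h1; rewrite (le_trans (ler_norm _)) // normrM ger0_norm // ler_piMl.
  have hp : (1 + k%:R * (eta - 1)) * - p <= eta ^+ k * - p.
    by rewrite ler_wpM2r // oppr_ge0 ltW.
  have := hC k; have := expR_ge1Dx (- (2 * pi * (eta ^+ k * p + eta ^- k * q))).
  have := ler_norm C; set y := eta ^+ k * p + _ => hC1 hC2 hC3.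
  have hy : y <= - (k%:R * ((eta - 1) * - p)) + `|q| by rewrite /y; move: hp; lra.
  have [|y0] := leP (k%:R * ((eta - 1) * - p)) `|q|.
    by move=> le; rewrite (le_trans le) // lerDr.
  have : - y <= 2 * pi * - y by rewrite ler_peMl //; lra.
  by lra.
have pos : 0 < (eta - 1) * - p by rewrite mulr_gt0 ?subr_gt0 ?oppr_gt0.
have := archi_boundP (_ : 0 <= (`|C| + `|q|) / ((eta - 1) * - p)).
rewrite divr_ge0 ?addr_ge0 ?(ltW pos) // => /(_ isT).
by rewrite ltr_pdivrMr // ltNge low.
Qed.

Section Expansions.
Context (R : realType) (F : fieldExtType rat) (s : F).
Context (i1 i2 : {rmorphism F -> R}) {G : golden s i1 i2}.
Implicit Types (x y nu : F) (t : H2 R) (m : nat) (h : H2 R -> R[i]).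
Local Notation mob := (mobius2 i1 i2).
Local Notation chi := (chi i1 i2).
Local Notation qexp := (qexp i1 i2).

(** The denominator [m] is free because a Hecke substitution can enlarge the lattice of exponents.
    Coefficients live in [K], which will be rational numbers, complex numbers, or polynomials to be
    evaluated at roots of unity. *)
Definition expansion (K : comNzRingType) m (ev : K -> R[i]) (a : F -> K) h :=
  (forall nu, a nu != 0 -> [/\ ZF (m%:R * nu), 0 <= i1 nu & 0 <= i2 nu]) /\
  forall t, sums (fun nu => ev (a nu) * qexp nu t) (h t).

Lemma qexp_translate nu x t : qexp nu (mob (mx2 1 x 0 1) t) = qexp nu t * chi (nu * x).
Proof.
rewrite qexp_mob; first by rewrite mulr1 !divr1.
by rewrite mulr1 /tot_positive !rmorph1 ltr01.
Qed.

Lemma sums_qexp_eq0 (c : F -> R[i]) t :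
  (forall x, sums (fun nu => c nu * qexp nu (mob (mx2 1 x 0 1) t)) 0) ->
  forall nu, c nu = 0.
Proof.
move=> hc nu; have : c nu * qexp nu t = 0.
  move: nu; apply: (@sums_chi_eq0 _ _ i1 i2) => x; apply: eq_sums (hc x) => nu.
  by rewrite qexp_translate mulrA.
by move/eqP; rewrite mulf_eq0 (negPf (qexp_neq0 _ _ _ _)) orbF => /eqP.
Qed.

Lemma sums_qexp_uniq (c c' : F -> R[i]) h :
  (forall t, sums (fun nu => c nu * qexp nu t) (h t)) ->
  (forall t, sums (fun nu => c' nu * qexp nu t) (h t)) -> c =1 c'.
Proof.
move=> hc hc' nu; apply/eqP; rewrite -subr_eq0; apply/eqP; move: nu.
pose t := toH2 ('i, 'i) : H2 R.
apply: (@sums_qexp_eq0 _ t) => x.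
have := sumsD (hc (mob (mx2 1 x 0 1) t)) (sumsZ (-1) (hc' (mob (mx2 1 x 0 1) t))).
by rewrite mulN1r subrr; apply: eq_sums => nu; rewrite mulN1r mulrBl.
Qed.

(** Koecher's principle. Invariance under diag(u, 1/u) gives [a] the same value along nu u^(2k),
    while convergence at (i, i) bounds exp(-2 pi tr(nu u^(2k))) times this value. A negative
    embedding of nu would make these terms unbounded. *)
Lemma koecher (a : F -> rat) h : (forall nu, a nu != 0 -> ZF (5 * nu)) ->
  (forall t, sums (fun nu => ratr (a nu) * qexp nu t) (h t)) ->
  (forall u t, ZF u -> ZF u^-1 -> i1 u * i2 u = 1 -> h (mob (mx2 u 0 0 u^-1) t) = h t) ->
  expansion 5 ratr a h.
Proof.
move=> ha hs hu; split=> //; have [u [Zu Zv u1 n1 ne1]] := @ex_unit _ _ _ _ _ G.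
have u0 : u != 0 by apply: contraTneq u1 => ->; rewrite rmorph0 ltxx.
have u2 : 0 < i2 u by rewrite -(pmulr_rgt0 _ u1) n1.
have inv v : ZF v -> ZF v^-1 -> 0 < i1 v -> i1 v * i2 v = 1 ->
    forall nu, a (nu / v ^+ 2) = a nu.
  move=> Zv1 Zv2 v1 nv nu; have v0 : v != 0 by apply: contraTneq v1 => ->; rewrite rmorph0 ltxx.
  have v2 : 0 < i2 v by rewrite -(pmulr_rgt0 _ v1) nv.
  have v20 : v ^+ 2 != 0 by rewrite expf_neq0.
  apply: (fmorph_inj (ratr : {rmorphism rat -> R[i]})) => /=; move: nu.
  apply: (@sums_qexp_uniq (fun nu => ratr (a (nu / v ^+ 2))) (fun nu => ratr (a nu)) h);
    last exact: hs.
  move=> t.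
  have := sums_reindex (k := fun x => x / v ^+ 2) (k' := fun x => x * v ^+ 2)
     (divfK v20) (mulfK v20) (hs (mob (mx2 v 0 0 v^-1) t)).
  rewrite hu //; apply: eq_sums => nu /=; rewrite qexp_mob; last first.
    by rewrite divff // /tot_positive !rmorph1 ltr01.
  rewrite mulr0 mul0r chi0 mulr1 invrK.
  by have -> : nu / v ^+ 2 * v * v = nu by field.
have orb v : ZF v -> ZF v^-1 -> 0 < i1 v -> i1 v * i2 v = 1 ->
    forall nu k, a (nu * (v ^+ 2) ^+ k) = a nu.
  move=> Zv1 Zv2 v1 nv nu; elim=> [|k IH]; first by rewrite expr0 mulr1.
  have v0 : v != 0 by apply: contraTneq v1 => ->; rewrite rmorph0 ltxx.
  by rewrite -(inv v) // exprS mulrCA mulrAC divff ?mul1r ?expf_neq0.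
pose t := Sub ('i, 'i) (upper2_i R) : H2 R.
have [C hC] : exists C, forall nu, a nu != 0 -> expR (- (2 * pi * (i1 nu + i2 nu))) <= C / cabs (ratr (a nu) : R[i]).
  have [B hB] := sums_abs (hs t); exists B => nu a0.
  have c0 : 0 < cabs (ratr (a nu) : R[i]) by rewrite cabs_gt0 fmorph_eq0.
  have := hB [fset nu]%fset; rewrite big_seq_fset1 cabsM cabs_qexp.
  by rewrite ler_pdivlMr // mulrC /= !mulr1.
have orbC v nu k : ZF v -> ZF v^-1 -> 0 < i1 v -> i1 v * i2 v = 1 -> a nu != 0 ->
   expR (- (2 * pi * (i1 v ^+ 2 ^+ k * i1 nu + i1 v ^+ 2 ^- k * i2 nu))) <=
   C / cabs (ratr (a nu) : R[i]).
  move=> Zv1 Zv2 v0 nv a0; have := hC (nu * (v ^+ 2) ^+ k); rewrite orb // => /(_ a0).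
  have -> : i1 v ^+ 2 ^- k = i2 v ^+ 2 ^+ k.
    have e : i2 v = (i1 v)^-1 by rewrite -[LHS](mulKf (lt0r_neq0 v0)) nv mulr1.
    by rewrite e !exprVn.
  have ev (i : {rmorphism F -> R}) : i (nu * (v ^+ 2) ^+ k) = i v ^+ 2 ^+ k * i nu.
    by rewrite rmorphM !rmorphXn mulrC.
  by rewrite !ev.
have cone v nu : ZF v -> ZF v^-1 -> 1 < i1 v -> i1 v * i2 v = 1 -> a nu != 0 ->
    0 <= i1 nu /\ 0 <= i2 nu.
  move=> Zv1 Zv2 v1 nv a0; have v0 : 0 < i1 v by rewrite (lt_trans ltr01).
  have e2 : i2 v = (i1 v)^-1 by rewrite -[LHS](mulKf (lt0r_neq0 v0)) nv mulr1.
  have v12 : 1 < i1 v ^+ 2 by rewrite exprn_egt1.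
  split; first by apply: bounded_exponential_orbit v12 _ => k; apply: orbC.
  apply: (bounded_exponential_orbit (q := i1 nu) (C := C / cabs (ratr (a nu) : R[i])) v12) => k.
  have := @orbC v^-1 nu k Zv2 _ _ _ a0; rewrite invrK => /(_ Zv1).
  rewrite !fmorphV invr_gt0 => /(_ v0); rewrite e2 invrK mulVf ?gt_eqF // => /(_ erefl).
  by rewrite !exprVn invrK addrC.
move=> nu a0; have [] : 0 <= i1 nu /\ 0 <= i2 nu; last by split=> //; apply: ha.
(* As [i1 u != 1], either the unit or its inverse is larger than 1 in the first embedding. *)
have [lt|le] := ltP 1 (i1 u); first exact: (cone u).
apply: (cone u^-1) => //; rewrite ?invrK //.
  by rewrite fmorphV invf_gt1 // lt_neqAle ne1.
by rewrite !fmorphV -invfM n1 invr1.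
Qed.
End Expansions.

Section ExpansionAlgebra.
Context (R : realType) (F : fieldExtType rat) (s : F).
Context (i1 i2 : {rmorphism F -> R}) {G : golden s i1 i2}.
Context (I : Type) (K : comNzRingType) (ev : I -> {rmorphism K -> R[i]}).
Implicit Types (x y nu : F) (t : H2 R) (m : nat) (h : I -> H2 R -> R[i]).
Local Notation mob := (mobius2 i1 i2).
Local Notation chi := (chi i1 i2).
Local Notation qexp := (qexp i1 i2).
Local Notation expansion := (expansion i1 i2).

(* A family of functions, the coefficients of the [i]-th one being the images under
   [ev i] of common coefficients in [K]. *)
Definition has_expansion h := exists m a, (0 < m)%N /\ forall i, expansion m (ev i) a (h i).

Lemma expansion_scale (L : comNzRingType) m n (e : L -> R[i]) a (f : H2 R -> R[i]) :
  expansion m e a f -> expansion (n * m) e a f.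
Proof.
move=> [ha hs]; split=> // nu /ha[h1 h2 h3]; split=> //.
by rewrite natrM -mulrA; apply: ZFM (ZF_nat _) h1.
Qed.

Lemma has_expansion_cst h c : (forall i t, h i t = ev i c) -> has_expansion h.
Proof.
move=> hc; exists 1%N, (fun nu => if nu == 0 then c else 0); split=> // i; split=> [nu|t].
  by have [->|_] := eqVneq nu 0; rewrite ?eqxx // mulr0 !rmorph0 lexx; split=> //; apply: ZF0.
have := sums_finite (A := [fset (0 : F)]%fset)
   (u := fun nu => ev i (if nu == 0 then c else 0) * qexp nu t).
rewrite big_seq_fset1 eqxx qexp0 mulr1 -(hc i t); apply=> nu.
by rewrite inE => /negPf ->; rewrite rmorph0 mul0r.
Qed.

Lemma has_expansionD h h' : has_expansion h -> has_expansion h' ->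
  has_expansion (fun i t => h i t + h' i t).
Proof.
move=> [m [a [m0 ha]]] [n [b [n0 hb]]].
exists (m * n)%N, (fun nu => a nu + b nu); rewrite muln_gt0 m0 n0; split=> // i.
have [ha1 ha2] := expansion_scale n (ha i); have [hb1 hb2] := expansion_scale m (hb i).
split=> [nu|t].
  by have [->|/ha1 + _] := eqVneq (a nu) 0; [rewrite add0r; apply: hb1|rewrite mulnC].
by apply: eq_sums (sumsD (ha2 t) (hb2 t)) => nu; rewrite rmorphD mulrDl.
Qed.

(** Only exponents between 0 and [mu] in both embeddings contribute to the coefficient of [mu] in a
    product; this is where nonnegative exponents make the convolution finite. *)
Lemma ex_box m : (0 < m)%N -> exists S : F -> {fset F}, forall mu nu,
  ZF (m%:R * nu) -> 0 <= i1 nu <= i1 mu -> 0 <= i2 nu <= i2 mu -> nu \in S mu.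
Proof.
move=> m0; have ex mu : exists A : {fset F}, forall nu,
    ZF (m%:R * nu) -> 0 <= i1 nu <= i1 mu -> 0 <= i2 nu <= i2 mu -> nu \in A.
  have [A hA] := bounded_lattice_finite (i1 mu + i2 mu) m0; exists A => nu hnu.
  by move=> /andP[? ?] /andP[? ?]; apply: hA => //; rewrite ger0_norm //; lra.
exists (fun mu => xget fset0 [set A : {fset F} | forall nu, ZF (m%:R * nu) ->
   0 <= i1 nu <= i1 mu -> 0 <= i2 nu <= i2 mu -> nu \in A]) => mu nu.
by have [A hA] := ex mu; case: xgetP => [B _ hB|/(_ A)//]; apply: hB.
Qed.

Lemma has_expansionM h h' : has_expansion h -> has_expansion h' ->
  has_expansion (fun i t => h i t * h' i t).
Proof.
move=> [m [a [m0 ha]]] [n [b [n0 hb]]].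
have mn0 : (0 < m * n)%N by rewrite muln_gt0 m0.
have [S hS] := ex_box mn0.
exists (m * n)%N, (fun mu => \sum_(nu <- S mu) a nu * b (mu - nu)); split=> // i.
have [ha1 ha2] := expansion_scale n (ha i); have [hb1 hb2] := expansion_scale m (hb i).
split=> [mu|t].
  move=> hmu; have [nu _ /=] : exists2 nu, nu \in S mu & a nu * b (mu - nu) != 0.
    apply: contrapT => no; move/eqP: hmu; apply; rewrite big_seq big1 // => nu nuS.
    by apply/eqP; apply: contraT => ne; case: no; exists nu.
  have [->|/ha1[x1 x2 x3]] := eqVneq (a nu) 0; first by rewrite mul0r eqxx.
  have [->|/hb1[y1 y2 y3] _] := eqVneq (b (mu - nu)) 0; first by rewrite mulr0 eqxx.
  have e : mu = nu + (mu - nu) by rewrite addrC subrK.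
  rewrite e mulrDr !rmorphD; split; last 2 first.
  - by apply: addr_ge0 => //; move: y2; rewrite rmorphD.
  - by apply: addr_ge0 => //; move: y3; rewrite rmorphD.
  by apply: ZFD => //; rewrite mulnC.
apply: (eq_sums _ (sums_convolution (S := S) _ (ha2 t) (hb2 t))) => [mu|mu nu nuS].
  rewrite rmorph_sum mulr_suml; apply: eq_bigr => nu _.
  rewrite [qexp mu t](_ : _ = qexp nu t * qexp (mu - nu) t); last first.
    by rewrite -qexpD addrC subrK.
  by rewrite rmorphM mulrACA.
have [->|/ha1[x1 x2 x3]] := eqVneq (a nu) 0; first by rewrite rmorph0 !mul0r.
have [->|/hb1[y1 y2 y3]] := eqVneq (b (mu - nu)) 0; first by rewrite rmorph0 mul0r mulr0.
case/negP: nuS; apply: hS; first by rewrite mulnC.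
  by rewrite x2 /= -subr_ge0 -rmorphB.
by rewrite x3 /= -subr_ge0 -rmorphB.
Qed.

Lemma eq_has_expansion h h' : (forall i, h i =1 h' i) -> has_expansion h -> has_expansion h'.
Proof.
by move=> e [m [a [m0 ha]]]; exists m, a; split=> // i; have [h1 h2] := ha i; split=> // t;
  rewrite -e.
Qed.

Lemma has_expansion_prod (J : eqType) (r : seq J) (h : J -> I -> H2 R -> R[i]) :
  (forall j, j \in r -> has_expansion (h j)) ->
  has_expansion (fun i t => \prod_(j <- r) h j i t).
Proof.
elim: r => [|j r IH] hr.
  by apply: (@has_expansion_cst _ 1) => i t; rewrite big_nil rmorph1.
apply: (eq_has_expansion (h := fun i t => h j i t * \prod_(j <- r) h j i t)).
  by move=> i t; rewrite big_cons.
apply: has_expansionM; first by apply: hr; rewrite mem_head.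
by apply: IH => k kr; apply: hr; rewrite inE kr orbT.
Qed.

Lemma ex_denominator x : exists2 n, (0 < n)%N & ZF (n%:R * x).
Proof.
have [a [b ->]] := coords x.
have den (q : rat) : exists2 n, (0 < n)%N & exists k : int, n%:R * q = k%:~R.
  exists `|denq q|%N; first by rewrite absz_gt0 denq_neq0.
  exists (numq q); rewrite natr_absz gtr0_norm ?denq_gt0 //.
  by rewrite -[X in _ * X]divq_num_den mulrC divfK // intr_eq0 denq_neq0.
have [n n0 [k ek]] := den a; have [m m0 [l el]] := den b.
exists (n * m)%N; first by rewrite muln_gt0 n0.
have -> : (n * m)%:R * (GRing.in_alg F a + GRing.in_alg F b * s) =
   m%:R * k%:~R + n%:R * l%:~R * s.
  have ea : k%:~R = n%:R * GRing.in_alg F a.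
    by rewrite -(rmorph_int (GRing.in_alg F)) -ek rmorphM rmorph_nat.
  have eb : l%:~R = m%:R * GRing.in_alg F b.
    by rewrite -(rmorph_int (GRing.in_alg F)) -el rmorphM rmorph_nat.
  by rewrite ea eb natrM; ring.
apply: ZFD; first by apply: ZFM (ZF_nat _) (ZF_int _).
apply: ZFM; last exact: ZF_s.
by apply: ZFM (ZF_nat _) (ZF_int _).
Qed.

(** The exponent [nu] moves to [nu * a / d] and its coefficient is multiplied by a value of [chi].
    One element [psi nu] must lift that value for all members of the family: for the powers of a
    root of unity, a monomial in K = Q[X]. *)
Lemma has_expansion_mob a d (x : I -> F) m c h (psi : F -> K) : (0 < m)%N ->
  (forall i, expansion m (ev i) c (h i)) -> tot_positive i1 i2 (a * d) ->
  (forall i nu, ZF (m%:R * nu) -> ev i (psi nu) = chi (nu * x i / d)) ->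
  has_expansion (fun i t => h i (mob (mx2 a (x i) 0 d) t)).
Proof.
move=> m0 hc ad hpsi; have [n n0 hn] := ex_denominator (a / d).
have a0 : a != 0 by apply/eqP => a0; case: ad; rewrite a0 mul0r rmorph0 ltxx.
have d0 : d != 0 by apply/eqP => d0; case: ad; rewrite d0 mulr0 rmorph0 ltxx.
have ipos (i : {rmorphism F -> R}) : 0 < i (a * d) -> 0 <= i (a / d).
  move=> iad; have -> : a / d = a * d * d^-1 ^+ 2 by field.
  by rewrite rmorphM rmorphXn mulr_ge0 ?sqr_ge0 // ltW.
exists (m * n)%N, (fun mu => c (mu * d / a) * psi (mu * d / a)); split.
  by rewrite muln_gt0 m0.
move=> i; have [h1 h2] := hc i; split=> [mu|t].
  have [->|/h1[x1 x2 x3] _] := eqVneq (c (mu * d / a)) 0; first by rewrite mul0r eqxx.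
  have e : mu = mu * d / a * (a / d) by field; rewrite ?a0 ?d0.
  rewrite e; split.
  - have -> : (m * n)%:R * (mu * d / a * (a / d)) = (m%:R * (mu * d / a)) * (n%:R * (a / d)).
      by rewrite natrM; ring.
    exact: ZFM.
  - by rewrite rmorphM; apply: mulr_ge0 => //; apply: ipos; case: ad.
  - by rewrite rmorphM; apply: mulr_ge0 => //; apply: ipos; case: ad.
have k1 : cancel (fun mu => mu * d / a) (fun mu => mu * a / d) by move=> mu; field; rewrite ?a0 ?d0.
have k2 : cancel (fun mu => mu * a / d) (fun mu => mu * d / a) by move=> mu; field; rewrite ?a0 ?d0.
apply: eq_sums (sums_reindex k1 k2 (h2 (mob (mx2 a (x i) 0 d) t))) => mu /=.
rewrite qexp_mob // rmorphM -[RHS]mulrA.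
have [->|/h1[x1 _ _]] := eqVneq (c (mu * d / a)) 0; first by rewrite rmorph0 !mul0r.
rewrite hpsi // [qexp _ t * _]mulrC.
by have -> : mu * d / a * a / d = mu by field; rewrite ?a0 ?d0.
Qed.

Lemma has_expansion_swap h : has_expansion h -> has_expansion (fun i t => h i (swap t)).
Proof.
move=> [m [a [m0 ha]]]; exists m, (a \o conjF i1 i2); split=> // i.
have [h1 h2] := ha i; split=> [nu /h1[x1 x2 x3]|t].
  move: x2 x3; rewrite i1_conj i2_conj => x2 x3; split=> //.
  have -> : m%:R * nu = conjF i1 i2 (m%:R * conjF i1 i2 nu).
    rewrite conjFM conjFK; congr (_ * _); apply: (fmorph_inj i1).
    by rewrite i1_conj !rmorph_nat.
  exact: ZF_conj.
have cK : involutive (conjF i1 i2) by exact: conjFK.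
apply: eq_sums (sums_reindex cK cK (h2 (swap t))) => nu /=.
by rewrite qexp_swap i1_conj i2_conj.
Qed.
End ExpansionAlgebra.

(** * Identity theorem *)

Section IdentityTheorem.
Variable R : realType.

Lemma abs_sin_le (x : R) : `|sin x| <= `|x|.
Proof.
wlog x0 : x / 0 < x => [hw|].
  have [x0|x0|<-] := ltgtP 0 x; [exact: hw| |by rewrite sin0 normr0].
  by have := hw (- x); rewrite sinN !normrN oppr_gt0; apply.
have [c _] := MVT x0 (fun y _ => is_derive_sin y) (continuous_subspaceT (@continuous_sin R)).
rewrite sin0 !subr0 => ->; rewrite normrM ler_piMl // ler_norml.
by rewrite cos_geN1 cos_le1.
Qed.

Lemma abs_cos_sub1_le (x : R) : `|cos x - 1| <= `|x|.
Proof.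
wlog x0 : x / 0 < x => [hw|].
  have [x0|x0|<-] := ltgtP 0 x; [exact: hw| |by rewrite cos0 subrr normr0].
  by have := hw (- x); rewrite cosN normrN oppr_gt0; apply.
have [c _] := MVT x0 (fun y _ => is_derive_cos y) (continuous_subspaceT (@continuous_cos R)).
rewrite cos0 subr0 => ->; rewrite normrM ler_piMl // normrN ler_norml.
by rewrite sin_geN1 sin_le1.
Qed.

Lemma cabs_exp2ipi_sub1 (y : R) : cabs (exp2ipi y%:C - 1) <= 4 * pi * `|y|.
Proof.
rewrite exp2ipi_real (le_trans (cabs_le_ReIm _)) //=.
have -> : 4 * pi * `|y| = `|2 * pi * y| + `|2 * pi * y|.
  by rewrite !normrM (ger0_norm (pi_ge0 R)) normr_nat; ring.
by rewrite subr0 lerD // ?abs_cos_sub1_le ?abs_sin_le.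
Qed.

Lemma exp2ipi_natmul (y : R) n : exp2ipi (n%:R * y)%:C = exp2ipi y%:C ^+ n.
Proof.
elim: n => [|n IH]; first by rewrite mul0r exp2ipi0.
by rewrite -natr1 mulrDl mul1r realcD exp2ipiD IH exprSr.
Qed.

Lemma bin_expn_le (x : R) N k : 0 <= x -> (0 < N)%N ->
  'C(N, k)%:R * (x / N%:R) ^+ k <= x ^+ k / k`!%:R.
Proof.
move=> x0 N0; have kf : 0 < k`!%:R :> R by rewrite ltr0n fact_gt0.
have Nk : 0 < N%:R ^+ k :> R by rewrite exprn_gt0 // ltr0n.
have -> : 'C(N, k)%:R * (x / N%:R) ^+ k = (N ^_ k)%:R / N%:R ^+ k * (x ^+ k / k`!%:R).
  by rewrite -bin_ffact natrM expr_div_n; field; rewrite !gt_eqF.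
rewrite ler_piMl ?divr_ge0 ?exprn_ge0 ?ler0n // ler_pdivrMr //.
rewrite mul1r -natrX ler_nat ffact_prod -[X in (_ <= _ ^ X)%N]card_ord -prod_nat_const.
by apply: leq_prod => i _; rewrite leq_subr.
Qed.

Lemma expn_fact_le_expR (x : R) k : 0 <= x -> x ^+ k / k`!%:R <= expR x.
Proof.
case: k => [|k] x0; first by rewrite expr0 divr1 -expR0 ler_expR.
by apply: le_trans (expR_ge1Dxn k x0); rewrite lerDr.
Qed.

Lemma geometric_tail (q : R) m n : 0 <= q -> (m <= n)%N ->
  (1 - q) * \sum_(m <= k < n) q ^+ k <= q ^+ m.
Proof.
move=> q0 mn; suff -> : (1 - q) * \sum_(m <= k < n) q ^+ k = q ^+ m - q ^+ n.
  by rewrite gerBl exprn_ge0.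
elim: n mn => [|n IH]; first by rewrite leqn0 => /eqP ->; rewrite big_geq // mulr0 subrr.
rewrite leq_eqVlt => /predU1P[->|mn]; first by rewrite big_geq // mulr0 subrr.
by rewrite big_nat_recr //= mulrDr IH // exprS; ring.
Qed.

Lemma expn_small (q C c : R) : 0 <= q -> q < 1 -> (forall k, c <= C * q ^+ k) -> c <= 0.
Proof.
move=> q0 q1 h; have qn : `|q| < 1 by rewrite ger0_norm.
have cv : C * q ^+ k @[k --> \oo] --> C * 0 by apply: cvgMr; apply: cvg_expr.
rewrite -(mulr0 C) -(cvg_lim (@Rhausdorff R) cv).
by apply: limr_ge; [apply/cvg_ex; exists (C * 0)|apply: nearW].
Qed.

(** Newton's difference formula in place of a Taylor series. With x = N y and w = exp(2 pi i lam y),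
    expand w^N = (1 + (w - 1))^N. The terms of order k < k0 sum to k-th differences of [phi] near 0
    and vanish. The term of order k is at most (4 pi |lam| |x|)^k / k! <= q^k exp(4 pi |lam| delta)
    with q = |x| / delta, so [phi x] is at most B q^k0 / (1 - q) for all k0. *)
Lemma exponential_family_vanishes (I : choiceType) (b : I -> R[i]) (lam : I -> R)
    (delta r B : R) (phi : R -> R[i]) :
  0 < delta -> 0 < r ->
  (forall A : {fset I}, \sum_(i <- A) cabs (b i) * expR (4 * pi * `|lam i| * delta) <= B) ->
  (forall x, sums (fun i => b i * exp2ipi (lam i * x)%:C) (phi x)) ->
  (forall x, `|x| < r -> phi x = 0) -> forall x, `|x| < delta -> phi x = 0.
Proof.
move=> d0 r0 hB hs hr x xd; pose q := `|x| / delta.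
have q0 : 0 <= q by rewrite divr_ge0 // ltW.
have q1 : q < 1 by rewrite ltr_pdivrMr // mul1r.
apply/eqP; rewrite -cabs_eq0 eq_le cabs_ge0 andbT.
apply: (@expn_small q (B / (1 - q))) => // k0.
(* N is so large that k0 steps of length |x| / N stay inside the radius [r] where [phi] vanishes. *)
have [N [N0 k0N Nr]] : exists N, [/\ (0 < N)%N, (k0 <= N)%N & k0%:R * `|x| < r * N%:R].
  exists (maxn k0.+1 (Num.bound (k0%:R * `|x| / r))); split.
  - by rewrite leq_max.
  - by rewrite leq_max leqnSn.
  have h0 : 0 <= k0%:R * `|x| / r by rewrite divr_ge0 ?mulr_ge0 // ltW.
  have := archi_boundP h0; rewrite ltr_pdivrMr // => /lt_le_trans; apply.
  by rewrite mulrC ler_pM2l // ler_nat leq_max leqnn orbT.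
pose y := x / N%:R; pose w i := exp2ipi (lam i * y)%:C.
have NR : N%:R != 0 :> R by rewrite pnatr_eq0 -lt0n.
have wX i n : w i ^+ n = exp2ipi (lam i * (n%:R * y))%:C.
  by rewrite /w -exp2ipi_natmul; congr (exp2ipi _%:C); ring.
pose u k i := b i * (w i - 1) ^+ k *+ 'C(N, k).
have su k : sums (u k) ((\sum_(j < k.+1) (-1) ^+ j *+ 'C(k, j) * phi ((k - j)%:R * y)) *+ 'C(N, k)).
  have h := @sums_sum R I _ (index_enum 'I_k.+1) (fun (j : 'I_k.+1) i =>
      ((-1) ^+ j *+ 'C(k, j)) * (b i * exp2ipi (lam i * ((k - j)%:R * y))%:C)) _
     (fun j => sumsZ ((-1) ^+ j *+ 'C(k, j)) (hs ((k - j)%:R * y))).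
  have := sumsZ ('C(N, k)%:R) h; rewrite mulr_natl; apply: eq_sums => i.
  rewrite /u mulr_natl exprDn mulr_sumr; congr (_ *+ _); apply: eq_bigr => j _.
  by rewrite -wX mulrnAl mulrnAr; congr (_ *+ _); ring.
have su0 k : (k < k0)%N -> sums (u k) 0.
  move=> kk0; have := su k; rewrite big1 ?mul0rn // => j _.
  rewrite hr ?mulr0 // normrM normr_nat /y normrM normfV normr_nat mulrA.
  rewrite ltr_pdivrMr ?ltr0n // (le_lt_trans _ Nr) // ler_wpM2r // ler_nat.
  by rewrite (leq_trans (leq_subr _ _)) // ltnW.
have sv : sums (fun i => \sum_(k0 <= k < N.+1) u k i) (phi x).
  have h : sums (fun i => \sum_(0 <= k < k0) u k i) 0.
    have hk (k : nat) : sums (if (k < k0)%N then u k else fun=> 0) 0.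
      case: ifP => [/su0 //|_] e e0; exists fset0 => A _.
      by rewrite big1 // subrr cabs0 ltW.
    have := sums_sum (index_iota 0 k0) hk; rewrite big1 //; apply: eq_sums => i.
    by rewrite big_nat_cond [RHS]big_nat_cond; apply: eq_bigr => k /andP[/andP[_ ->]].
  have := sumsD (hs x) (sumsZ (-1) h); rewrite mulr0 addr0; apply: eq_sums => i.
  have -> : lam i * x = N%:R * (lam i * y) by rewrite /y; field.
  have ew : w i = 1 + (w i - 1) by ring.
  rewrite exp2ipi_natmul -/(w i) [X in X ^+ N]ew exprDn mulr_sumr.
  rewrite -(big_mkord xpredT (fun k => b i * (1 ^+ (N - k) * (w i - 1) ^+ k *+ 'C(N, k)))).
  rewrite (big_cat_nat (leq0n k0) (leqW k0N)) /= mulN1r addrC.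
  have e k : b i * (1 ^+ (N - k) * (w i - 1) ^+ k *+ 'C(N, k)) = u k i.
    by rewrite expr1n mul1r mulrnAr.
  by rewrite !(eq_bigr (fun k => u k i) (fun k _ => e k)) addrK.
apply: sums_bound sv _ => A.
apply: le_trans (_ : \sum_(i <- A) cabs (b i) * expR (4 * pi * `|lam i| * delta) *
    (q ^+ k0 / (1 - q)) <= _); last first.
  by rewrite -mulr_suml mulrAC -mulrA ler_wpM2r // divr_ge0 ?exprn_ge0 // subr_ge0 ltW.
apply: ler_sum => i _; rewrite (le_trans (cabs_sum _ _)) //.
apply: le_trans (_ : \sum_(k0 <= k < N.+1)
    cabs (b i) * expR (4 * pi * `|lam i| * delta) * q ^+ k <= _); last first.
  rewrite -mulr_sumr ler_wpM2l ?mulr_ge0 ?cabs_ge0 ?expR_ge0 //.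
  by rewrite ler_pdivlMr ?subr_gt0 // mulrC geometric_tail // leqW.
apply: ler_sum => k _; rewrite /u -mulrnAr cabsM -mulrA ler_wpM2l ?cabs_ge0 //.
rewrite -mulr_natl cabsM -(rmorph_nat (real_complex R)) cabs_real normr_nat cabsX.
have hw : cabs (w i - 1) <= 4 * pi * `|lam i| * `|x| / N%:R.
  rewrite (le_trans (cabs_exp2ipi_sub1 _)) // /y !normrM normfV normr_nat.
  by rewrite !mulrA.
have p0 : 0 <= 4 * pi * `|lam i| by rewrite !mulr_ge0 // pi_ge0.
apply: (@le_trans _ _ ('C(N, k)%:R * (4 * pi * `|lam i| * `|x| / N%:R) ^+ k)).
  by rewrite ler_wpM2l // lerXn2r ?nnegrE ?cabs_ge0 // !mulr_ge0 ?invr_ge0 // pi_ge0.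
apply: le_trans (bin_expn_le k _ N0) _; first by rewrite mulr_ge0.
have -> : 4 * pi * `|lam i| * `|x| = q * (4 * pi * `|lam i| * delta).
  by rewrite /q; field; rewrite gt_eqF.
rewrite exprMn -[X in X <= _]mulrA [X in X <= _]mulrC ler_wpM2r ?exprn_ge0 // expn_fact_le_expR //.
by rewrite mulr_ge0 // ltW.
Qed.
End IdentityTheorem.

Section ExpansionIdentity.
Context (R : realType) (F : fieldExtType rat) (s : F).
Context (i1 i2 : {rmorphism F -> R}) {G : golden s i1 i2}.
Implicit Types (x y nu : F) (t : H2 R) (m : nat).
Local Notation mob := (mobius2 i1 i2).
Local Notation qexp := (qexp i1 i2).

(** Along a real translation through [t0], [h] is an exponential family in one real variable, so its
    vanishing propagates from near [t0] to the translate by [x]. With all translates available,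
    uniqueness of Fourier coefficients gives [c = 0]. *)
Lemma expansion_identity m (c : F -> R[i]) (h : H2 R -> R[i]) t0 (r : R) :
  expansion i1 i2 m id c h -> 0 < r ->
  (forall t, cabs ((val t).1 - (val t0).1) < r -> cabs ((val t).2 - (val t0).2) < r ->
     h t = 0) -> forall t, h t = 0.
Proof.
move=> [hc hs] r0 hr.
have [y1 y2] := H2P t0.
suff c0 nu : c nu = 0.
  move=> t; apply: (sums_uniq (hs t)) => e e0; exists fset0 => A _.
  by rewrite big1 ?subrr ?cabs0 ?ltW // => nu _; rewrite c0 mul0r.
move: nu; apply: (@sums_qexp_eq0 _ _ i1 i2 _ t0) => x.
pose st (a : R) : H2 R := toH2 ((val t0).1 + (a * i1 x)%:C, (val t0).2 + (a * i2 x)%:C).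
have Im_add (z : R[i]) (a : R) : complex.Im (z + a%:C) = complex.Im z.
  by case: z => ? ? /=; rewrite addr0.
have val_st a : val (st a) = ((val t0).1 + (a * i1 x)%:C, (val t0).2 + (a * i2 x)%:C).
  by rewrite insubdK // unfold_in /upper2 /= !Im_add y1.
have st1 : st 1 = mob (mx2 1 x 0 1) t0.
  apply: val_inj; rewrite val_st val_mob.
    by rewrite /mobius !mx2E !rmorph1 !rmorph0 !mul1r !mul0r !add0r !divr1.
  by rewrite det_mx2 mulr1 mulr0 subr0 /tot_positive !rmorph1 ltr01.
have qexp_st nu a : qexp nu (st a) = qexp nu t0 * exp2ipi (trace i1 i2 (nu * x) * a)%:C.
  rewrite /qexp val_st /= -exp2ipiD /trace !rmorphM /=; congr exp2ipi.
  rewrite !(realcM, realcD); ring.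
pose X : R := `|i1 x| + `|i2 x| + 1.
have X0 : 0 < X by rewrite /X; have := normr_ge0 (i1 x); have := normr_ge0 (i2 x); lra.
(* Lowering both imaginary parts by [k] stays in [H2], and convergence there controls the terms at
   [t0] multiplied by exp(2 pi k tr(nu)). *)
pose k : R := Num.min (complex.Im (val t0).1) (complex.Im (val t0).2) / 2.
have k0 : 0 < k by rewrite divr_gt0 // lt_min y1.
have k1 : k < complex.Im (val t0).1.
  by rewrite ltr_pdivrMr // (@le_lt_trans _ _ (complex.Im (val t0).1)) ?ge_min ?lexx //; lra.
have k2 : k < complex.Im (val t0).2.
  by rewrite ltr_pdivrMr // (@le_lt_trans _ _ (complex.Im (val t0).2)) ?ge_min ?lexx ?orbT //; lra.
pose tk : H2 R := toH2 ((val t0).1 - (0 +i* k), (val t0).2 - (0 +i* k)).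
have val_tk : val tk = ((val t0).1 - (0 +i* k), (val t0).2 - (0 +i* k)).
  rewrite insubdK // unfold_in /upper2 /=.
  by case: ((val t0).1) ((val t0).2) k1 k2 => [? ?] [? ?] /=; rewrite !subr_gt0 => -> ->.
have qexp_tk nu : cabs (qexp nu tk) = cabs (qexp nu t0) * expR (2 * pi * k * (i1 nu + i2 nu)).
  rewrite !cabs_qexp val_tk -expRD; congr expR.
  by case: (val t0) => -[a b] [d e] /=; ring.
pose b nu := c nu * qexp nu t0; pose lam nu := trace i1 i2 (nu * x).
(* Chosen so that 4 pi |lam nu| delta <= 2 pi k tr(nu), as |lam nu| <= X tr(nu) for nonnegative
   embeddings. *)
pose delta := k / (2 * X); have d0 : 0 < delta by rewrite divr_gt0 // mulr_gt0.
have [B hB] := sums_abs (hs tk).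
have bB (A : {fset F}) : \sum_(nu <- A) cabs (b nu) * expR (4 * pi * `|lam nu| * delta) <= B.
  apply: le_trans (hB A); apply: ler_sum => nu _; rewrite /b cabsM [X in _ <= X]cabsM.
  have [->|/hc[_ n1 n2]] := eqVneq (c nu) 0; first by rewrite cabs0 !mul0r.
  rewrite qexp_tk [X in _ <= X]mulrA ler_wpM2l ?mulr_ge0 ?cabs_ge0 // ler_expR.
  have lamX : `|lam nu| <= X * (i1 nu + i2 nu).
    rewrite /lam /trace !rmorphM (le_trans (ler_normD _ _)) // !normrM (ger0_norm n1) (ger0_norm n2).
    have X1 : `|i1 x| <= X by rewrite /X; have := normr_ge0 (i2 x); lra.
    have X2 : `|i2 x| <= X by rewrite /X; have := normr_ge0 (i1 x); lra.
    by rewrite mulrDr [i1 nu * _]mulrC [i2 nu * _]mulrC lerD // ler_wpM2r.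
  have -> : 2 * pi * k * (i1 nu + i2 nu) = 4 * pi * (X * (i1 nu + i2 nu)) * delta.
    by rewrite /delta; field; rewrite gt_eqF.
  by rewrite ler_wpM2r ?(ltW d0) // ler_wpM2l // mulr_ge0 // pi_ge0.
pose phi a := h (st a).
have sphi a : sums (fun nu => b nu * exp2ipi (lam nu * a)%:C) (phi a).
  by apply: eq_sums (hs (st a)) => nu; rewrite qexp_st mulrA.
(* Recentring at [a] multiplies the coefficients by numbers of modulus 1, so the same [delta] and
   [B] work everywhere, and steps of length 1/N < delta reach 1. *)
have step a r' : 0 < r' -> (forall y : R, `|y - a| < r' -> phi y = 0) ->
    forall y : R, `|y - a| < delta -> phi y = 0.
  move=> r'0 h0 y ya; rewrite -[y](subrK a).
  apply: (@exponential_family_vanishes _ _ (fun nu => b nu * exp2ipi (lam nu * a)%:C) lam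
    delta r' B (fun y : R => phi (y + a)) d0 r'0) => //.
  - move=> A; apply: le_trans (bB A); apply: ler_sum => nu _.
    by rewrite cabsM cabs_exp2ipi /= mulr0 oppr0 expR0 mulr1.
  - move=> z; apply: eq_sums (sphi (z + a)) => nu.
    by rewrite mulrDr realcD exp2ipiD mulrA mulrAC.
  by move=> z hz; apply: h0; rewrite addrK.
have base : forall y : R, `|y - 0| < delta -> phi y = 0.
  apply: (step 0 (r / X)); first exact: divr_gt0.
  move=> y; rewrite subr0 ltr_pdivlMr // => hy; apply: hr; rewrite val_st /= addrC addKr.
    rewrite cabs_real normrM (le_lt_trans _ hy) // ler_wpM2l //.
    by rewrite /X; have := normr_ge0 (i2 x); lra.
  rewrite cabs_real normrM (le_lt_trans _ hy) // ler_wpM2l //.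
  by rewrite /X; have := normr_ge0 (i1 x); lra.
have [N N0 Nd] : exists2 N : nat, (0 < N)%N & N%:R^-1 < delta.
  have h0 : 0 <= delta^-1 by rewrite invr_ge0 ltW.
  exists (Num.bound delta^-1).+1 => //; rewrite invf_plt ?posrE ?ltr0n //.
  by rewrite (lt_le_trans (archi_boundP h0)) // ler_nat.
have NR : N%:R != 0 :> R by rewrite pnatr_eq0 -lt0n.
have all n : forall y : R, `|y - n%:R / N%:R| < delta -> phi y = 0.
  elim: n => [|n IH]; first by rewrite mul0r; apply: base.
  apply: (step _ (delta - N%:R^-1)); first by rewrite subr_gt0.
  move=> y hy; apply: IH.
  have -> : y - n%:R / N%:R = (y - n.+1%:R / N%:R) + N%:R^-1.
    by rewrite -natr1; field.
  rewrite (le_lt_trans (ler_normD _ _)) // -ltrBrDr (lt_le_trans hy) //.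
  by rewrite ger0_norm // invr_ge0 ler0n.
have : phi 1 = 0 by apply: (all N); rewrite divff // subrr normr0.
by rewrite /phi st1 => <-; apply: hs.
Qed.
End ExpansionIdentity.

(** * Holomorphic functions and generic equality *)

Lemma near_differentiable (K : numFieldType) (V W : normedModType K) (f g : V -> W) (x : V) :
  (\forall y \near x, f y = g y) -> differentiable f x -> differentiable g x.
Proof.
move=> fg hf; have fgx : f x = g x by exact: nbhs_singleton fg.
have [cd ef] := (diff_locallyP x f).1 hf.
have eg : g \o shift x = cst (g x) + 'd f x +o_ (0 : V) id.
  apply/eqaddoP => e e0; move/eqaddoP: ef => /(_ e e0); apply: filter_app.
  have : \forall y \near (0 : V), f (y + x) = g (y + x).
    by move: fg; rewrite (near_shift 0 x) subr0.
  by apply: filter_app; near=> y => E; rewrite !fctE /= -[g (y + x)]E -fgx.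
apply/diff_locallyP; rewrite (diff_unique cd eg); split=> //.
Unshelve. all: by end_near.
Qed.

Section Holomorphic.
Variable R : realType.
Local Notation C := (R[i]).
Local Notation Cn := (C^o)%type.
Implicit Types (f g : H2 R -> C) (t : H2 R).

Lemma gt0_realc (e : C) : 0 < e -> exists2 r : R, 0 < r & e = r%:C.
Proof.
move=> e0; have : e \is Num.real by rewrite gtr0_real.
by move/RRe_real => ee; exists (complex.Re e) => //; rewrite -lt_realc ee.
Qed.

Lemma nbhs2P (z : Cn * Cn) (U : set (Cn * Cn)) : nbhs z U <->
  exists2 r : R, 0 < r & forall w : Cn * Cn,
    cabs ((w.1 : C) - z.1) < r -> cabs ((w.2 : C) - z.2) < r -> U w.
Proof.
split=> [/nbhs_ballP[e e0 h]|[r r0 h]].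
  have [r r0 er] := gt0_realc e0; exists r => // w w1 w2; apply: h.
  by split; rewrite -ball_normE /ball_ /= er normE lt_realc cabs_distC.
apply/nbhs_ballP; exists r%:C; first by rewrite /= (lt_realc 0).
move=> w [w1 w2]; apply: h.
  by move: w1; rewrite -ball_normE /ball_ /= normE lt_realc cabs_distC.
by move: w2; rewrite -ball_normE /ball_ /= normE lt_realc cabs_distC.
Qed.

Lemma nbhs_upper2 t : nbhs (val t : Cn * Cn) [set z | upper2 z].
Proof.
have [t1 t2] := H2P t; apply/nbhs2P.
exists (Num.min (complex.Im (val t).1) (complex.Im (val t).2)); first by rewrite lt_min t1.
move=> w; rewrite !lt_min => /andP[w1 _] /andP[_ w2].
have half (z z0 : C) : cabs (z - z0) < complex.Im z0 -> 0 < complex.Im z.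
  move=> /(le_lt_trans (Im_le_cabs _)); case: z => a b; case: z0 => c d /=.
  by rewrite ltr_norml => /andP[+ _]; lra.
by rewrite /upper2 /= (half _ _ w1) (half _ _ w2).
Qed.

Lemma extend0_val f t : extend0 f (val t) = f t.
Proof. by rewrite /extend0 valK. Qed.

Lemma extend0_upper2 f (z : Cn * Cn) (hz : upper2 z) : extend0 f z = f (Sub z hz).
Proof. by rewrite /extend0 insubT. Qed.

(** [extend0] jumps to 0 outside [H2], but [H2] is open and differentiability at a point depends on
    the germ only. *)
Lemma holomorphic_local f : (forall t, exists2 phi : Cn * Cn -> Cn,
    differentiable phi (val t : Cn * Cn) & forall t', f t' = phi (val t')) ->
  holomorphic f.
Proof.
move=> hf t; have [phi dphi e] := hf t; apply: near_differentiable dphi.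
apply: filterS (nbhs_upper2 t) => z /= hz; rewrite extend0_upper2 e.
by congr phi; rewrite SubK.
Qed.

Lemma holomorphic_cst (c : C) : holomorphic (fun _ : H2 R => c).
Proof.
apply: holomorphic_local => t; exists (fun=> c : Cn) => //; exact: differentiable_cst.
Qed.

Lemma holomorphicD f g : holomorphic f -> holomorphic g -> holomorphic (fun t => f t + g t).
Proof.
move=> hf hg; apply: holomorphic_local => t.
exists ((extend0 f : Cn * Cn -> Cn) + (extend0 g : Cn * Cn -> Cn)).
  by apply: differentiableD; [apply: hf|apply: hg].
by move=> t'; rewrite fctE !extend0_val.
Qed.

Lemma holomorphicM f g : holomorphic f -> holomorphic g -> holomorphic (fun t => f t * g t).
Proof.
move=> hf hg; apply: holomorphic_local => t.
exists ((extend0 f : Cn * Cn -> Cn) * (extend0 g : Cn * Cn -> Cn)).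
  by apply: differentiableM; [apply: hf|apply: hg].
by move=> t'; rewrite fctE !extend0_val.
Qed.

Lemma eq_holomorphic f g : f =1 g -> holomorphic f -> holomorphic g.
Proof. by move=> /funext ->. Qed.

Lemma holomorphicX f n : holomorphic f -> holomorphic (fun t => f t ^+ n).
Proof.
move=> hf; elim: n => [|n IH]; first exact: holomorphic_cst.
by apply: eq_holomorphic (holomorphicM hf IH) => t; rewrite exprS.
Qed.

Lemma holomorphic_prod (J : eqType) (r : seq J) (f : J -> H2 R -> C) :
  (forall j, j \in r -> holomorphic (f j)) -> holomorphic (fun t => \prod_(j <- r) f j t).
Proof.
elim: r => [|j r IH] hr.
  by apply: eq_holomorphic (holomorphic_cst 1) => t; rewrite big_nil.
apply: (@eq_holomorphic (fun t => f j t * \prod_(j <- r) f j t)).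
  by move=> t; rewrite big_cons.
apply: holomorphicM; first by apply: hr; rewrite mem_head.
by apply: IH => k kr; apply: hr; rewrite inE kr orbT.
Qed.

Lemma differentiable_fst (z : Cn * Cn) : differentiable (fst : Cn * Cn -> Cn) z.
Proof.
apply: (@linear_differentiable C (Cn * Cn)%type Cn (fst : {linear (Cn * Cn)%type -> Cn})).
by move=> w; apply: cvg_fst.
Qed.

Lemma differentiable_snd (z : Cn * Cn) : differentiable (snd : Cn * Cn -> Cn) z.
Proof.
apply: (@linear_differentiable C (Cn * Cn)%type Cn (snd : {linear (Cn * Cn)%type -> Cn})).
by move=> w; apply: cvg_snd.
Qed.

Lemma holomorphic_swap f : holomorphic f -> holomorphic (fun t => f (swap t)).
Proof.
move=> hf; apply: holomorphic_local => t.
exists ((extend0 f : Cn * Cn -> Cn) \o (fun z : Cn * Cn => (z.2, z.1))).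
  apply: differentiable_comp.
    by apply: differentiable_pair; [exact: differentiable_snd|exact: differentiable_fst].
  by have := hf (swap t); rewrite val_swap.
by move=> t' /=; rewrite -extend0_val val_swap.
Qed.

Lemma differentiable_affine (a b : C) (p : Cn * Cn -> Cn) (z : Cn * Cn) :
  differentiable p z -> differentiable (fun w => a * p w + b : Cn) z.
Proof.
move=> dp; apply: (@differentiableD _ _ _ (fun w => a * p w : Cn) (fun=> b : Cn)).
  exact: (@differentiableZ _ _ _ p a).
exact: differentiable_cst.
Qed.
End Holomorphic.

Section HolomorphicAction.
Context (R : realType) (F : fieldExtType rat) (i1 i2 : {rmorphism F -> R}).
Local Notation C := (R[i]).
Local Notation Cn := (C^o)%type.
Implicit Types (f g : H2 R -> C) (t : H2 R) (A : 'M[F]_2).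
Local Notation mob := (mobius2 i1 i2).

Lemma differentiable_mobius (i : {rmorphism F -> R}) A (p : Cn * Cn -> Cn) (z : Cn * Cn) :
  differentiable p z -> cocycle i A (p z) != 0 ->
  differentiable (fun w => mobius i A (p w) : Cn) z.
Proof.
move=> dp nz; apply: (@differentiableM _ _ (fun w => (i (A 0 0))%:C * p w + (i (A 0 1))%:C : Cn)
   (fun w => (cocycle i A (p w))^-1 : Cn)); first exact: differentiable_affine.
have da : differentiable (fun w => cocycle i A (p w) : Cn) z by exact: differentiable_affine.
exact: differentiableV da nz.
Qed.

Lemma holomorphic_mob f A : tot_positive i1 i2 (\det A) -> holomorphic f ->
  holomorphic (fun t => f (mob A t)).
Proof.
move=> hA hf; apply: holomorphic_local => t.
exists ((extend0 f : Cn * Cn -> Cn) \o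
        (fun z : Cn * Cn => (mobius i1 A z.1 : Cn, mobius i2 A z.2 : Cn))).
  have [t1 t2] := H2P t; apply: differentiable_comp.
    by apply: differentiable_pair; apply: differentiable_mobius;
      [exact: differentiable_fst|case: hA => ? ?; exact: cocycle_neq0
      |exact: differentiable_snd|case: hA => ? ?; exact: cocycle_neq0].
  by have := hf (mob A t); rewrite val_mob.
by move=> t' /=; rewrite -extend0_val val_mob.
Qed.

Lemma holomorphic_autf A : holomorphic (autf i1 i2 A).
Proof.
apply: holomorphicM; apply: holomorphic_local => t.
  exists (fun z : Cn * Cn => cocycle i1 A z.1 : Cn); last by [].
  by apply: differentiable_affine; apply: differentiable_fst.
exists (fun z : Cn * Cn => cocycle i2 A z.2 : Cn); last by [].
by apply: differentiable_affine; apply: differentiable_snd.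
Qed.
End HolomorphicAction.

Section Generic.
Variable R : realType.
Local Notation C := (R[i]).
Local Notation Cn := (C^o)%type.
Implicit Types (f g : H2 R -> C) (t : H2 R) (P Q : H2 R -> Prop).

Lemma generically_sub P Q : (forall t, P t -> Q t) -> generically P -> generically Q.
Proof. by move=> PQ [U [oU dU hU]]; exists U; split=> // t /hU /PQ. Qed.

Lemma generically_all P : (forall t, P t) -> generically P.
Proof.
by move=> hP; exists setT; split=> //; [exact: openT|rewrite closureT].
Qed.

Lemma generically_and P Q : generically P -> generically Q -> generically (fun t => P t /\ Q t).
Proof.
move=> [U [oU dU hU]] [V [oV dV hV]]; exists (U `&` V); split.
- exact: openI.
- move=> z hz B nB.
  (* Density is known only at points of [H2], so the point found in [U] has to stay in [H2] before
     the density of [V] applies. *)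
  have hz' : nbhs (z : Cn * Cn) [set z | upper2 z].
    by have := nbhs_upper2 (Sub z hz); rewrite SubK.
  have nI : nbhs (z : Cn * Cn) ((B `&` [set z | upper2 z])°).
    by apply: nbhs_interior; apply: filterI.
  have [y [Uy Iy]] := dU z hz _ nI.
  have nUB : nbhs (y : Cn * Cn) (U `&` B).
    apply: filterI; first by apply: open_nbhs_nbhs; split.
    by apply: filterS Iy => w [].
  have [_ y2] := nbhs_singleton Iy.
  have [w [Vw [Uw Bw]]] := dV y y2 _ nUB.
  by exists w.
by move=> t [Ut Vt]; split; [apply: hU|apply: hV].
Qed.

Lemma holomorphic_generic_eq f g : holomorphic f -> holomorphic g ->
  generically (fun t => f t = g t) -> forall t, f t = g t.
Proof.
move=> hf hg [U [oU dU hU]] t.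
pose h t := f t + -1 * g t.
have hh : holomorphic h by apply: holomorphicD => //; apply: holomorphicM => //; apply: holomorphic_cst.
suff : h t = 0 by rewrite /h mulN1r => /eqP; rewrite subr_eq0 => /eqP.
have ch := differentiable_continuous (hh t).
apply/eqP; apply: contraT => ht.
have n0 : nbhs (val t : Cn * Cn) [set z | extend0 h z != 0].
  by apply: (cvgr_neq0 _ ch); rewrite extend0_val.
have [z [Uz [hz z2]]] := dU (val t) (valP t) _ (filterI n0 (nbhs_upper2 t)).
move: hz; rewrite /= extend0_upper2 /h hU ?SubK // mulN1r subrr eqxx //.
Qed.

Lemma holomorphic_generic_neq0 (F : fieldExtType rat) (i1 i2 : {rmorphism F -> R}) m (c : F -> C) h :
  holomorphic h -> expansion i1 i2 m id c h -> (exists t, h t != 0) ->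
  generically (fun t => h t != 0).
Proof.
move=> hh hc [t1 nt1]; exists [set z : Cn * Cn | upper2 z /\ extend0 h z != 0]; split.
- rewrite openE => z [z2 hz]; rewrite /interior.
  have e : z = val (Sub z z2 : H2 R) by rewrite SubK.
  have nU : nbhs (z : Cn * Cn) [set z | upper2 z] by rewrite {1}e; apply: nbhs_upper2.
  apply: filterI => //.
  have ch := differentiable_continuous (hh (Sub z z2)).
  by rewrite SubK in ch; apply: (cvgr_neq0 _ ch).
- move=> z hz B nB; apply: contrapT => no.
  have e : z = val (Sub z hz : H2 R) by rewrite SubK.
  have [r r0 hr] := (nbhs2P z B).1 nB.
  have : h t1 = 0.
    apply: (expansion_identity (t0 := Sub z hz) hc r0) => t; rewrite SubK => h1 h2.
    apply/eqP; apply: contraT => ht; case: no; exists (val t); split; last exact: hr.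
    by rewrite /= extend0_val (valP t).
  by move/eqP; rewrite (negPf nt1).
by move=> t [_]; rewrite extend0_val.
Qed.
End Generic.

(** * Hilbert modular forms *)

Section Forms.
Context (R : realType) (F : fieldExtType rat) (s : F).
Context (i1 i2 : {rmorphism F -> R}) {G : golden s i1 i2}.
Local Notation C := (R[i]).
Implicit Types (f g h : H2 R -> C) (t : H2 R) (w : nat) (M : 'M[F]_2) (x nu mu : F).
Local Notation mob := (mobius2 i1 i2).
Local Notation chi := (chi i1 i2).
Local Notation qexp := (qexp i1 i2).
Local Notation Gam := (Gamma i1 i2).

Definition rational_expansion h :=
  has_expansion i1 i2 (fun _ : unit => ratr : {rmorphism rat -> C}) (fun _ => h).

Definition complex_expansion h :=
  has_expansion i1 i2 (fun _ : unit => idfun : {rmorphism C -> C}) (fun _ => h).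

Lemma rational_complex_expansion h : rational_expansion h -> complex_expansion h.
Proof.
move=> [m [a [m0 ha]]]; exists m, (fun nu => ratr (a nu)); split=> // -[].
have [h1 h2] := ha tt; split=> // nu hn; apply: h1; apply: contraNneq hn => ->.
by rewrite rmorph0.
Qed.

Definition modular w h := forall M t, Gam M -> h (mob M t) = autf i1 i2 M t ^+ w * h t.

Lemma hilbert_formP w h : hilbert_form i1 i2 w h <-> holomorphic h /\ modular w h.
Proof.
split=> -[h1 h2]; split=> // M t hM.
  by rewrite h2 // /autf exprMn.
by rewrite h2 // /autf exprMn.
Qed.

Definition rational_form w h :=
  [/\ holomorphic h, modular w h, Defs.symmetric_form h & rational_expansion h].

Lemma Gamma_translation x : ZF (x / s) -> Gam (mx2 1 x 0 1).
Proof.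
move=> hx; apply/Gamma_hecke; split; rewrite ?mx2E ?det_mx2 ?mulr0 ?mulr1 ?subr0 //.
- exact: ZF1.
- exact: ZF0.
exact: ZF1.
Qed.

Lemma autf_upper a x d t : autf i1 i2 (mx2 a x 0 d) t = (i1 d * i2 d)%:C.
Proof. by rewrite /autf /cocycle !mx2E !rmorph0 !mul0r !add0r realcM. Qed.

Lemma modular_translation w h x t : modular w h -> ZF (x / s) ->
  h (mob (mx2 1 x 0 1) t) = h t.
Proof.
move=> hm hx; rewrite hm; last exact: Gamma_translation.
by rewrite autf_upper !rmorph1 mulr1 expr1n mul1r.
Qed.

Lemma sym_form_Q_expansion w h : sym_form_Q i1 i2 w h ->
  exists a, expansion i1 i2 5 (ratr : rat -> C) a h.
Proof.
move=> [/hilbert_formP[hh hm] hs [a [ha1 ha2]]]; exists a; apply: (koecher (s := s)).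
- by move=> nu /ha1 /dual_ideal_invP.
- by move=> t; apply/sumsP; apply: ha2.
move=> u t Zu Zv n1; have u0 : u != 0.
  by apply/eqP => u0; move/eqP: n1; rewrite u0 !rmorph0 mul0r eq_sym oner_eq0.
rewrite hm; first by rewrite autf_upper !fmorphV -invfM n1 invr1 expr1n mul1r.
apply/Gamma_hecke; split; rewrite ?mx2E ?det_mx2 ?mulr0 ?mul0r ?subr0 //.
- by rewrite divff.
- exact: ZF0.
exact: ZF0.
Qed.

(** One direction is Koecher's principle. In the other, invariance under translation by [x] and
    uniqueness of coefficients give [chi (nu * x) = 1] on the support, which puts the exponents in
    the required dual lattice. *)
Lemma sym_form_QP w h : sym_form_Q i1 i2 w h <-> rational_form w h.
Proof.
split.
  move=> hw; have [a ha] := sym_form_Q_expansion hw.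
  case: hw => /hilbert_formP[hh hm] hs _; split=> //.
  by exists 5%N, a.
move=> [hh hm hs [m [a [m0 ha]]]]; split=> //; first exact/hilbert_formP.
have [h1 h2] := ha tt; exists a; split; last by move=> t; apply/sumsP; apply: h2.
move=> nu a0 x /ideal_invP hx; apply: exp2ipi_eq1; rewrite -/(chi (nu * x)).
have hc t : sums (fun nu => ratr (a nu) * chi (nu * x) * qexp nu t) (h t).
  rewrite -(modular_translation t hm hx).
  by apply: eq_sums (h2 (mob (mx2 1 x 0 1) t)) => mu; rewrite qexp_translate mulrA mulrAC.
have := @sums_qexp_uniq _ _ i1 i2 (fun nu => ratr (a nu) * chi (nu * x))
  (fun nu => ratr (a nu)) h hc h2 nu.
by rewrite -[RHS]mulr1; apply: mulfI; rewrite fmorph_eq0.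
Qed.

Lemma rational_formM w v f g : rational_form w f -> rational_form v g ->
  rational_form (w + v) (fun t => f t * g t).
Proof.
move=> [f1 f2 f3 f4] [g1 g2 g3 g4]; split.
- exact: holomorphicM.
- by move=> M t hM; rewrite f2 // g2 // exprD mulrACA.
- by move=> t; rewrite f3 g3.
exact: has_expansionM f4 g4.
Qed.

Lemma rational_formX w f n : rational_form w f -> rational_form (n * w) (fun t => f t ^+ n).
Proof.
move=> hf; elim: n => [|n IH].
  split; first exact: holomorphic_cst.
  - by move=> M t _; rewrite !expr0 mulr1.
  - by [].
  by apply: (@has_expansion_cst _ _ _ _ _ _ _ _ 1) => _ t; rewrite rmorph1.
have [h1 h2 h3 h4] := rational_formM hf IH.
have -> : (fun t => f t ^+ n.+1) = (fun t => f t * f t ^+ n).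
  by apply/funext => t; rewrite exprS.
by split=> //; rewrite mulSn.
Qed.

Lemma rational_form0 w : rational_form w (fun=> 0).
Proof.
split; first exact: holomorphic_cst; rewrite //.
- by move=> M t _; rewrite mulr0.
by apply: (@has_expansion_cst _ _ _ _ _ _ _ _ 0) => _ t; rewrite rmorph0.
Qed.

Lemma rational_formD w f g : rational_form w f -> rational_form w g ->
  rational_form w (fun t => f t + g t).
Proof.
move=> [f1 f2 f3 f4] [g1 g2 g3 g4]; split.
- exact: holomorphicD.
- by move=> M t hM; rewrite f2 // g2 // mulrDr.
- by move=> t; rewrite f3 g3.
exact: has_expansionD f4 g4.
Qed.

Lemma rational_formZ w (c : rat) f : rational_form w f ->
  rational_form w (fun t => ratr c * f t).
Proof.
move=> hf; have := @rational_formM 0 w (fun=> ratr c) f; rewrite add0n; apply=> //.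
split=> //; first exact: holomorphic_cst.
  by move=> M t _; rewrite expr0 mul1r.
by apply: (@has_expansion_cst _ _ _ _ _ _ _ _ c).
Qed.

Lemma rational_form_isobaric w (p : {mpoly rat[3]}) F2 F6 F10 :
  rational_form 2 F2 -> rational_form 6 F6 -> rational_form 10 F10 -> isobaric w p ->
  rational_form w (fun t => eval_Q p (fun i => nth 0 [:: F2 t; F6 t; F10 t] i)).
Proof.
move=> h2 h6 h10 iso.
have -> : (fun t => eval_Q p (fun i => nth 0 [:: F2 t; F6 t; F10 t] i)) =
  (fun t => \sum_(m <- msupp p) ratr p@_m * (F2 t ^+ m 0 * F6 t ^+ m 1 * F10 t ^+ m (inord 2))).
  by apply/funext => t; rewrite eval_QE; apply: eq_bigr => m _; rewrite prod3 /= inordK.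
move: iso; rewrite /isobaric; elim: (msupp p) => [|m r IH] iso.
  by under eq_fun do rewrite big_nil; apply: rational_form0.
under eq_fun do rewrite big_cons.
apply: rational_formD; last by apply: IH => m' hm'; apply: iso; rewrite inE hm' orbT.
apply: rational_formZ; have := iso m (mem_head _ _); rewrite sumn3 /= inordK // => <-.
by apply: rational_formM (rational_formX _ h10); apply: rational_formM; apply: rational_formX.
Qed.

(** The form 2 i1 + i2 separates elements of F, unlike the trace: if it kills z, applying it to the
    conjugate gives z = 0. Discreteness leaves finitely many candidates below any value. *)
Lemma ex_minimal_index (P : F -> Prop) m : (0 < m)%N ->
  (forall nu, P nu -> [/\ ZF (m%:R * nu), 0 <= i1 nu & 0 <= i2 nu]) -> (exists nu, P nu) ->
  exists2 nu, P nu & forall mu, P mu -> mu <> nu -> 2 * i1 nu + i2 nu < 2 * i1 mu + i2 mu.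
Proof.
move=> m0 hP [nu0 P0]; pose th nu : R := 2 * i1 nu + i2 nu.
have th_inj : injective th.
  move=> x y e; have d : th (x - y) = 0 by rewrite /th !rmorphB; move: e; rewrite /th; lra.
  apply/eqP; rewrite -subr_eq0; move: (x - y) d => z; rewrite /th => d.
  have : 2 * z + conjF i1 i2 z = 0.
    by apply: (fmorph_inj i1); rewrite rmorph0 rmorphD rmorphM rmorph_nat i1_conj.
  move=> /(congr1 i2); rewrite rmorphD rmorphM rmorph_nat i2_conj rmorph0 => d'.
  by rewrite -(fmorph_eq0 i1); apply/eqP; lra.
have [A hA] := bounded_lattice_finite (th nu0) m0.
pose l := [seq nu <- A | `[< P nu /\ th nu <= th nu0 >]].
have inl nu : P nu -> th nu <= th nu0 -> nu \in l.
  move=> Pn le; rewrite mem_filter; apply/andP; split; first exact/asboolP.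
  have [h1 h2 h3] := hP nu Pn; apply: hA => //; rewrite ger0_norm //;
    by move: le; rewrite /th; lra.
have [nu nul hmin] : exists2 nu, nu \in l & forall mu, mu \in l -> th nu <= th mu.
  have : l != [::] by apply: contraTneq (inl _ P0 (lexx _)) => ->.
  elim: l {inl} => // x l IH _; have [->|/IH[y yl hy]] := eqVneq l [::].
    by exists x; rewrite ?mem_head // => mu; rewrite inE => /eqP ->.
  have [xy|yx] := leP (th x) (th y).
    exists x; rewrite ?mem_head // => mu; rewrite inE => /predU1P[->//|/hy].
    exact: le_trans.
  exists y; first by rewrite inE yl orbT.
  by move=> mu; rewrite inE => /predU1P[->|/hy //]; rewrite ltW.
have [/asboolP[Pn le0] _] := andP (etrans (esym (mem_filter _ _ _)) nul).
exists nu => // mu Pm ne; rewrite -/(th nu) -/(th mu) lt_neqAle.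
have -> /= : th nu != th mu by apply/eqP => /th_inj e; apply: ne.
have [le|/ltW le] := leP (th mu) (th nu0); last exact: le_trans le.
by apply: hmin; apply: inl.
Qed.

(* Comparing the coefficients of [n * q = r] in increasing order of [2 i1 + i2]. *)
Lemma rational_expansion_quotient n q r : complex_expansion n -> rational_expansion q ->
  rational_expansion r -> (exists t, q t != 0) -> (forall t, n t * q t = r t) ->
  rational_expansion n.
Proof.
move=> [m [c [m0 hc]]] [m' [a [m'0 ha]]] [m'' [b [m''0 hb]]] [t0 q0] e.
have {}hc := hc tt; have {}ha := ha tt; have {}hb := hb tt.
suff hrat nu : exists x : rat, c nu = ratr x.
  have [x hx] : {x : F -> rat | forall nu, c nu = ratr (x nu)}.
    exists (fun nu => xget 0 [set x : rat | c nu = ratr x]) => nu.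
    by have [x hx] := hrat nu; case: xgetP => // /(_ x).
  exists m, x; split=> // _; have [h1 h2] := hc; split=> [nu xn|t].
    by apply: h1; rewrite hx fmorph_eq0.
  by apply: eq_sums (h2 t) => nu /=; rewrite hx.
have [nu0 a0 min0] : exists2 nu, a nu != 0 &
    forall mu, a mu != 0 -> mu <> nu -> 2 * i1 nu + i2 nu < 2 * i1 mu + i2 mu.
  apply: (ex_minimal_index m'0); first by case: ha.
  apply: contrapT => no; move/negP: q0; apply; apply/eqP.
  apply: (sums_uniq ((ha.2) t0)) => eps eps0; exists fset0 => A _.
  rewrite big1 ?subrr ?cabs0 ?ltW // => k _.
  have -> : a k = 0 by apply/eqP; apply: contraT => ak; case: no; exists k.
  by rewrite rmorph0 mul0r.
apply: contrapT => irr; have [nu1 irr1 min1] : exists2 nu1, ~ (exists x : rat, c nu1 = ratr x) &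
    forall mu, ~ (exists x : rat, c mu = ratr x) -> mu <> nu1 ->
      2 * i1 nu1 + i2 nu1 < 2 * i1 mu + i2 mu.
  apply: (ex_minimal_index m0); last by exists nu.
  move=> mu hmu; case: hc => h1 _; apply: h1; apply/eqP => c0; apply: hmu.
  by exists 0; rewrite rmorph0.
have [h1 h2] := expansion_scale m' hc; have [h3 h4] := expansion_scale m ha.
have mm0 : (0 < m' * m)%N by rewrite muln_gt0 m0 m'0.
have [S hS] := @ex_box R F s i1 i2 G (m' * m) mm0.
pose d mu := \sum_(nu <- S mu) c nu * ratr (a (mu - nu)).
have hd t : sums (fun mu => d mu * qexp mu t) (r t).
  rewrite -e; apply: (eq_sums _ (sums_convolution (S := S) _ (h2 t) (h4 t))) => [mu|mu nu' nuS].
    rewrite mulr_suml; apply: eq_bigr => nu' _.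
    rewrite [qexp mu t](_ : _ = qexp nu' t * qexp (mu - nu') t); last first.
      by rewrite -qexpD addrC subrK.
    by rewrite [RHS]mulrACA.
  have [->|/h1[x1 x2 x3]] := eqVneq (c nu') 0; first by rewrite /= !mul0r.
  have [->|/h3[y1 y2 y3]] := eqVneq (a (mu - nu')) 0; first by rewrite rmorph0 mul0r mulr0.
  case/negP: nuS; apply: hS => //.
    by rewrite x2 /= -subr_ge0 -rmorphB.
  by rewrite x3 /= -subr_ge0 -rmorphB.
have db := @sums_qexp_uniq _ _ i1 i2 d (fun mu => ratr (b mu)) r hd hb.2 (nu0 + nu1).
have c1 : c nu1 != 0 by apply/eqP => c0; apply: irr1; exists 0; rewrite c0 rmorph0.
apply: irr1.
(* In the coefficient of [nu0 + nu1], a second irrational [c nu] would have [nu] above [nu1], hence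
   a partner below the least exponent [nu0] of [q], where [a] vanishes. *)
have ratsum (l : seq F) : uniq l -> nu1 \in l -> exists y : rat,
    \sum_(nu <- l) c nu * ratr (a (nu0 + nu1 - nu)) = c nu1 * ratr (a nu0) + ratr y.
  move=> ul nl; rewrite (bigD1_seq nu1) //= addrK.
  suff [y ->] : exists y : rat, \sum_(nu <- l | nu != nu1) c nu * ratr (a (nu0 + nu1 - nu)) = ratr y.
    by exists y.
  apply: (big_ind (fun z => exists y : rat, z = ratr y)).
  - by exists 0; rewrite rmorph0.
  - by move=> _ _ [y ->] [z ->]; exists (y + z); rewrite rmorphD.
  move=> nu' /eqP ne; have [->|an] := eqVneq (a (nu0 + nu1 - nu')) 0.
    by exists 0; rewrite rmorph0 mulr0.
  have [[x ->]|irr'] := pselect (exists x : rat, c nu' = ratr x).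
    by exists (x * a (nu0 + nu1 - nu')); rewrite rmorphM.
  have lt1 := min1 nu' irr' ne.
  have [ne'|eq0] := pselect (nu0 + nu1 - nu' <> nu0).
    have := min0 _ an ne'; rewrite !rmorphB !rmorphD; lra.
  case: ne; apply/eqP; rewrite eq_sym -subr_eq0; move/contrapT/eqP: eq0.
  by rewrite -addrA -subr_eq0 addrAC subrr add0r.
have nuS : nu1 \in S (nu0 + nu1).
  have [x1 x2 x3] := h1 _ c1; have [y1 y2 y3] := h3 _ a0.
  apply: hS => //; first by rewrite x2 /= rmorphD lerDr.
  by rewrite x3 /= rmorphD lerDr.
have [y ey] := ratsum _ (fset_uniq _) nuS.
exists ((b (nu0 + nu1) - y) / a nu0).
have ra : ratr (a nu0) != 0 :> C by rewrite fmorph_eq0.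
by rewrite fmorph_div rmorphB /= -db /d ey addrK mulfK.
Qed.

(** [q] is generically nonzero, so the automorphy and symmetry of [n] can be checked after
    multiplication by [q] and then extended by continuity. *)
Lemma rational_form_quotient w v n q d p :
  holomorphic n -> complex_expansion n -> rational_form v q -> rational_form w d ->
  rational_form v p -> (exists t, q t != 0) -> (forall t, n t * q t = d t * p t) ->
  rational_form w n.
Proof.
move=> hn en [q1 q2 q3 q4] [d1 d2 d3 d4] [p1 p2 p3 p4] q0 e.
have gq : generically (fun t => q t != 0).
  have [m [c [_ hc]]] := rational_complex_expansion q4.
  exact: (holomorphic_generic_neq0 q1 (hc tt)).
split=> //.
- move=> M t hM; move: t; have pM := Gamma_posdet hM.
  apply: holomorphic_generic_eq; first exact: holomorphic_mob.
    by apply: holomorphicM => //; apply: holomorphicX; apply: holomorphic_autf.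
  apply: generically_sub gq => t qt; apply: (mulIf qt).
  have jv : autf i1 i2 M t ^+ v != 0 by rewrite expf_neq0 // autf_neq0.
  apply: (mulfI jv); rewrite mulrCA -q2 // e d2 // p2 // -[_ * n t * q t]mulrA e.
  by move: (autf i1 i2 M t ^+ w) => j; ring.
- apply: holomorphic_generic_eq => //; first exact: holomorphic_swap.
  apply: generically_sub gq => t qt; apply: (mulIf qt).
  by rewrite -{1}(q3 t) e d3 p3 -e.
apply: (rational_expansion_quotient en q4 (r := fun t => d t * p t)) => //.
exact: has_expansionM d4 p4.
Qed.
End Forms.

(** * Rationality of products over Hecke representatives *)

Section RootsOfUnity.
Variable R : realType.
Local Notation C := (R[i]).

(** For p prime and 0 < k < p, these evaluations produce the Galois conjugates of the value at k =
    1. *)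
Definition cyclotomic_eval (p k : nat) : {poly rat} -> C :=
  horner_eval (exp2ipi (p%:R^-1)%:C ^+ k) \o map_poly ratr.

HB.instance Definition _ p k := GRing.RMorphism.on (cyclotomic_eval p k).

Lemma cyclotomic_evalE p k P :
  cyclotomic_eval p k P = (map_poly ratr P).[exp2ipi (p%:R^-1)%:C ^+ k].
Proof. by []. Qed.

(** For each monomial, the sum over all k modulo p is p or 0, and the term k = 0 is 1. *)
Lemma cyclotomic_trace_rational p P : (0 < p)%N ->
  exists q : rat, \sum_(1 <= k < p) cyclotomic_eval p k P = ratr q.
Proof.
move=> p0; pose z : C := exp2ipi (p%:R^-1)%:C.
have zp : z ^+ p = 1.
  by rewrite /z -exp2ipi_natmul mulfV ?pnatr_eq0 -?lt0n //; exact: (@exp2ipi_nat R 1).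
have pow i : exists q : rat, \sum_(1 <= k < p) z ^+ k ^+ i = ratr q :> C.
  have e k : z ^+ k ^+ i = z ^+ i ^+ k by rewrite -!exprM mulnC.
  under eq_bigr do rewrite e.
  suff [q eq] : exists q : rat, \sum_(0 <= k < p) z ^+ i ^+ k = ratr q :> C.
    by exists (q - 1); rewrite rmorphB rmorph1 /= -eq [X in _ = X - 1]big_ltn // expr0 addrAC subrr add0r.
  have [zi|zi] := eqVneq (z ^+ i) 1.
    exists p%:R; rewrite zi; under eq_bigr do rewrite expr1n.
    by rewrite big_const_nat iter_addr_0 subn0 rmorph_nat.
  exists 0; rewrite rmorph0 big_mkord; apply: (mulfI (_ : z ^+ i - 1 != 0)).
    by rewrite subr_eq0.
  by rewrite -subrX1 mulr0 -exprM mulnC exprM zp expr1n subrr.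
have -> : \sum_(1 <= k < p) cyclotomic_eval p k P =
    \sum_(i < size P) ratr P`_i * \sum_(1 <= k < p) z ^+ k ^+ i.
  under [RHS]eq_bigr do rewrite mulr_sumr.
  rewrite exchange_big /=; apply: eq_bigr => k _.
  rewrite cyclotomic_evalE horner_coef size_map_poly; apply: eq_bigr => i _.
  by rewrite coef_map.
apply: (big_ind (fun x => exists q : rat, x = ratr q)).
- by exists 0; rewrite rmorph0.
- by move=> _ _ [x ->] [y ->]; exists (x + y); rewrite rmorphD.
move=> i _; have [q ->] := pow i; exists (P`_i * q); by rewrite rmorphM.
Qed.
End RootsOfUnity.

Section HeckeProduct.
Context (R : realType) (F : fieldExtType rat) (s : F).
Context (i1 i2 : {rmorphism F -> R}) {G : golden s i1 i2}.
Variables (b : F) (B : seq F).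
Hypotheses (b_prime : prime_elt b) (b_pos : tot_positive i1 i2 b).
Hypothesis (B_res : residue_system b B).
Local Notation C := (R[i]).
Implicit Types (f g h : H2 R -> C) (t : H2 R) (w : nat) (A M : 'M[F]_2) (x nu mu : F).
Local Notation mob := (mobius2 i1 i2).
Local Notation chi := (chi i1 i2).
Local Notation reps := (hecke_reps s b B).
Local Notation autf := (autf i1 i2).

Lemma hecke_posdet A : hecke s b A -> tot_positive i1 i2 (\det A).
Proof. by case=> ->. Qed.

Definition hecke_prod f t : C := \prod_(A <- reps) f (mob A t).

Lemma autf_reps A t t' : A \in reps -> autf A t = autf A t'.
Proof. by case/hecke_repsP => [->|[y _ ->]]; rewrite !autf_upper. Qed.

(** The factors of automorphy of the representatives are constants; [M] permutes the
    representatives, so these constants cancel in the product and only powers of [autf M] remain. *)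
Lemma modular_hecke_prod w f : modular i1 i2 w f ->
  modular i1 i2 (size reps * w) (hecke_prod f).
Proof.
move=> hf M t hM; have [g [pg hg]] := hecke_reps_perm b_prime B_res hM.
have posM := Gamma_posdet hM.
have posA A : A \in reps -> tot_positive i1 i2 (\det A).
  by move=> hA; apply: hecke_posdet; apply: (hecke_reps_hecke b_prime B_res hA).
have gA A : A \in reps -> g A \in reps.
  by move=> hA; rewrite -(perm_mem pg) map_f.
have ex A : A \in reps -> autf (g A) t != 0 /\
    f (mob A (mob M t)) = (autf A t * autf M t / autf (g A) t) ^+ w * f (mob (g A) t).
  move=> hA; have [M' hM' e] := hg A hA; have n0 := autf_neq0 t (posA _ (gA _ hA)).
  have pA := posA _ hA; have pgA := posA _ (gA _ hA); have pM' := Gamma_posdet hM'.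
  split=> //; rewrite -mobM // e mobM // hf //; congr (_ ^+ w * _).
  apply: (mulIf n0); rewrite divfK // -autfM // -e autfM //.
  by congr (_ * _); apply: autf_reps.
rewrite /hecke_prod.
have -> : \prod_(A <- reps) f (mob A (mob M t)) = \prod_(A <- reps)
    ((autf A t * autf M t / autf (g A) t) ^+ w * f (mob (g A) t)).
  by rewrite big_seq [RHS]big_seq; apply: eq_bigr => A /ex[_ ->].
have perm (h : 'M[F]_2 -> C) : \prod_(A <- reps) h (g A) = \prod_(A <- reps) h A.
  by rewrite -(big_map g xpredT h); apply: perm_big.
rewrite big_split /= (perm (fun A => f (mob A t))); congr (_ * _).
rewrite prodrXl big_split /= big_split /= prodfV (perm (fun A => autf A t)) mulrAC divff.
  by rewrite mul1r big_const_seq count_predT iter_mulr_1 exprM.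
rewrite prodf_seq_neq0; apply/allP => A hA /=; apply: autf_neq0; exact: posA.
Qed.

Lemma holomorphic_hecke_prod f : holomorphic f -> holomorphic (hecke_prod f).
Proof.
move=> hf; apply: holomorphic_prod => A hA; apply: holomorphic_mob => //.
by apply: hecke_posdet; apply: (hecke_reps_hecke b_prime B_res hA).
Qed.
(** Since 5 = s^2, p nu s y / b is (5 nu) y (p / b) / s, whose trace is an integer; so each value of
    [chi] is a power of the root of unity of order p. *)
Lemma chi_residue (p : nat) y nu : (0 < p)%N -> ZF (p%:R / b) -> ZF y -> ZF (5 * nu) ->
  exists r : nat, forall k : nat,
    chi (nu * (k%:R * (s * y)) / b) = exp2ipi (p%:R^-1)%:C ^+ k ^+ r.
Proof.
move=> p0 hp hy hnu; have s0 : s != 0 by exact: s_neq0.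
have b0 : b != 0 by case: b_prime.
pose x := nu * (s * y) / b; have pR : p%:R != 0 :> R by rewrite pnatr_eq0 -lt0n.
have [n en] : exists n : int, p%:R * trace i1 i2 x = n%:~R.
  apply/intrP; have -> : p%:R * trace i1 i2 x = trace i1 i2 (5 * nu * y * (p%:R / b) / s).
    rewrite -[p%:R]/(p%:Z%:~R) -traceZ; congr trace.
    by rewrite /x -(golden_sqr (s := s)); field; rewrite s0 b0.
  by apply: traceZs; apply: ZFM => //; apply: ZFM.
exists `|(n %% p%:Z)%Z|%N => k.
have chix : chi x = exp2ipi (p%:R^-1)%:C ^+ `|(n %% p%:Z)%Z|%N.
  have -> : chi x = exp2ipi (n%:~R / p%:R)%:C.
    by rewrite /chi -en mulrC mulKf.
  rewrite -exp2ipi_natmul {1}(divz_eq n p%:Z) intrD intrM mulrDl mulfK // realcD exp2ipiD.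
  rewrite exp2ipi_int mul1r; congr (exp2ipi (_ / _)%:C).
  by rewrite natr_absz ger0_norm // modz_ge0 // eqz_nat -lt0n.
have -> : nu * (k%:R * (s * y)) / b = k%:Z%:~R * x by rewrite /x; field; rewrite b0.
rewrite -!exprM mulnC exprM -chix /chi traceZ.
exact: exp2ipi_natmul.
Qed.

Lemma translation_reps (f : H2 R -> C) w k y y' t : modular i1 i2 w f ->
  ZF ((k * y - y') / b) ->
  f (mob (mx2 1 (k * (s * y)) 0 b) t) = f (mob (mx2 1 (s * y') 0 b) t).
Proof.
move=> hf hk; have s0 : s != 0 by exact: s_neq0.
have b0 : b != 0 by case: b_prime.
have pb x : tot_positive i1 i2 (\det (mx2 1 x 0 b)) by rewrite det_mx2 mul1r mulr0 subr0.
have p1 x : tot_positive i1 i2 (\det (mx2 1 x 0 1)).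
  by rewrite det_mx2 mul1r mulr0 subr0 /tot_positive !rmorph1 ltr01.
have -> : mx2 1 (k * (s * y)) 0 b = mx2 1 (s * ((k * y - y') / b)) 0 1 *m mx2 1 (s * y') 0 b.
  by rewrite mx2_mul !mulr0 !mul1r !mul0r !addr0 add0r; congr mx2; field.
have hx : ZF (s * ((k * y - y') / b) / s) by rewrite mulrC mulKf.
rewrite mobM; [exact: (@modular_translation _ _ _ _ _ G _ _ _ _ hf hx)|exact: p1|exact: pb].
Qed.

(** Only the matrices with corner 1 bring in roots of unity. Their product has coefficients [P nu]
    evaluated at a root of unity, and comparing the evaluations at its powers proves these values
    rational. *)
Lemma rational_hecke_prod w f : rational_form i1 i2 w f ->
  rational_expansion i1 i2 (hecke_prod f).
Proof.
move=> hf; have [a ha] := sym_form_Q_expansion ((sym_form_QP w f).2 hf).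
have [_ hm _ _] := hf; have [ZB uB cov inj] := B_res.
have b0 : b != 0 by case: b_prime.
have part1 : rational_expansion i1 i2 (fun t => f (mob (mx2 b 0 0 1) t)).
  apply: (has_expansion_mob (I := unit) (x := fun=> 0) (c := a) (m := 5)
    (h := fun=> f) (psi := fun=> 1)) => //.
  - by rewrite mulr1.
  - by move=> _ nu _; rewrite mulr0 mul0r chi0 rmorph1.
have [p pp hp] := ex_rational_prime b_prime.
have p0 := prime_gt0 pp.
pose E (k : nat) t := \prod_(y <- B) f (mob (mx2 1 (k%:R * (s * y)) 0 b) t).
have [m [P [m0 hP]]] : has_expansion i1 i2 (cyclotomic_eval R p : nat -> {rmorphism {poly rat} -> C}) E.
  apply: has_expansion_prod => y yB.
  have [r hr] : {r : F -> nat | forall nu, ZF (5 * nu) -> forall k : nat,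
      chi (nu * (k%:R * (s * y)) / b) = exp2ipi (p%:R^-1)%:C ^+ k ^+ r nu}.
    exists (fun nu => xget 0%N [set r : nat | forall k : nat,
      chi (nu * (k%:R * (s * y)) / b) = exp2ipi (p%:R^-1)%:C ^+ k ^+ r]) => nu hnu.
    by have [r hr] := chi_residue p0 hp (ZB _ yB) hnu; case: xgetP => // /(_ r).
  apply: (has_expansion_mob (x := fun k : nat => k%:R * (s * y)) (c := fun nu => (a nu)%:P)
    (m := 5) (h := fun=> f) (psi := fun nu => 'X^(r nu))) => //.
  - move=> k; case: ha => h1 h2; split=> [nu|t].
      by rewrite polyC_eq0; apply: h1.
    by apply: eq_sums (h2 t) => nu; rewrite /= cyclotomic_evalE map_polyC hornerC.
  - by rewrite mul1r.
  - move=> k nu hnu; rewrite /= cyclotomic_evalE rmorphXn /= map_polyX hornerXn.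
    by rewrite -hr.
(* [k] is prime to [p], so y -> k y permutes the residues modulo [b], and [f] at a representative
   depends on the residue only. *)
have EE k : (0 < k < p)%N -> E k =1 E 1%N.
  move=> /andP[k0 kp] t.
  have [r hr] : {r : F -> F | forall y, ZF y -> r y \in B /\ ZF ((k%:R * y - r y) / b)}.
    exists (fun y => xget 0 [set z | z \in B /\ ZF ((k%:R * y - z) / b)]) => y hy.
    have [z zB hz] := cov _ (ZFM (ZF_nat k) hy).
    by case: xgetP => [//|/(_ z)[]].
  have rB : {subset map r B <= B} by move=> _ /mapP[y yB ->]; case: (hr y (ZB _ yB)).
  have rinj : {in B &, injective r}.
    move=> y z yB zB e; apply: inj => //.
    have [_ h1] := hr y (ZB _ yB); have [_ h2] := hr z (ZB _ zB).
    apply: (prime_elt_cancel b_prime pp hp (k := k)).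
    - by rewrite gtnNdvd.
    - exact: ZFB (ZB _ yB) (ZB _ zB).
    have -> : k%:R * (y - z) / b = (k%:R * y - r y) / b - (k%:R * z - r z) / b.
      by rewrite e; field.
    exact: ZFB.
  have [||_ eqB] := uniq_min_size _ rB _.
  - by rewrite map_inj_in_uniq.
  - by rewrite size_map.
  have pB : perm_eq (map r B) B by apply: uniq_perm => //; rewrite map_inj_in_uniq.
  rewrite /E -[RHS](perm_big _ pB) /= big_map big_seq [RHS]big_seq; apply: eq_bigr => y yB.
  have [_ hy] := hr y (ZB _ yB).
  by rewrite mul1r; apply: translation_reps hm hy.
have part2 : rational_expansion i1 i2 (E 1%N).
  have evE k : (0 < k < p)%N -> forall nu, cyclotomic_eval R p k (P nu) = cyclotomic_eval R p 1 (P nu).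
    move=> hk nu; have [_ h1] := hP k; have [_ h2] := hP 1%N.
    apply: (@sums_qexp_uniq _ _ i1 i2 (fun nu => cyclotomic_eval R p k (P nu))
       (fun nu => cyclotomic_eval R p 1 (P nu)) (E 1%N)) => // t.
    by rewrite -(EE k hk).
  (* The p - 1 evaluations are equal and their sum is rational. *)
  have rat1 nu : exists q : rat, cyclotomic_eval R p 1 (P nu) = ratr q.
    have [q hq] := cyclotomic_trace_rational R (P nu) p0.
    have p1 : p.-1%:R != 0 :> C by rewrite pnatr_eq0 -lt0n -subn1 subn_gt0 prime_gt1.
    exists (q / p.-1%:R); rewrite [RHS]fmorph_div /= rmorph_nat -hq.
    have -> : \sum_(1 <= k < p) cyclotomic_eval R p k (P nu) =
        \sum_(1 <= k < p) cyclotomic_eval R p 1 (P nu).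
      rewrite big_nat_cond [RHS]big_nat_cond; apply: eq_bigr => k /andP[hk _].
      exact: evE.
    by rewrite sumr_const_nat subn1 -[X in X / _]mulr_natr mulfK.
  exists m, (fun nu => xget 0 [set q : rat | cyclotomic_eval R p 1 (P nu) = ratr q]).
  have xE nu : cyclotomic_eval R p 1 (P nu) =
      ratr (xget 0 [set q : rat | cyclotomic_eval R p 1 (P nu) = ratr q]).
    by have [q hq] := rat1 nu; case: xgetP => // /(_ q).
  split=> // _; have [h1 h2] := hP 1%N; split=> [nu|t].
    move=> hx; apply: h1; apply: contraNneq hx => P0.
    by rewrite -(fmorph_eq0 (ratr : {rmorphism rat -> C})) /= -xE P0 rmorph0.
  by apply: eq_sums (h2 t) => nu /=; rewrite -xE.
apply: eq_has_expansion (has_expansionM part1 part2) => _ t.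
rewrite /hecke_prod big_cons big_map /E; congr (_ * _).
by apply: eq_bigr => y _; rewrite mul1r.
Qed.

(** Multiplying by the exchanged product restores symmetry at the cost of doubling the weight; for
    [F10] the weight is 20 times the number of representatives. *)
Lemma rational_form_hecke w f : rational_form i1 i2 w f ->
  rational_form i1 i2 (2 * (size reps * w)) (fun t => hecke_prod f t * hecke_prod f (swap t)).
Proof.
move=> hf; have [f1 f2 f3 f4] := hf.
have hr := rational_hecke_prod hf; have hm := modular_hecke_prod f2.
have hh := holomorphic_hecke_prod f1.
split.
- by apply: holomorphicM => //; apply: holomorphic_swap.
- move=> M t hM; rewrite hm // swap_mob; last exact: Gamma_posdet.
  rewrite hm; last exact: Gamma_conj.
  have -> : autf (map_mx (conjF i1 i2) M) (swap t) = autf M t.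
    by rewrite /autf /cocycle !mxE val_swap /= !i1_conj !i2_conj mulrC.
  by rewrite mul2n -addnn exprD mulrACA.
- by move=> t; rewrite swapK mulrC.
exact: has_expansionM hr (has_expansion_swap hr).
Qed.
End HeckeProduct.

(** * The modular equations *)

Section Transversals.
Local Open Scope group_scope.
Variables (gT : groupType).
Implicit Types (A H : set gT) (s : seq gT).

Lemma generated_subgroup A : subgroup (generated A).
Proof.
split=> [S [[S1 _] _] //|x y hx hy S [hS AS]].
by case: (hS) => _; apply; [apply: hx|apply: hy].
Qed.

Lemma subgroupV A x : subgroup A -> A x -> A x^-1.
Proof. by move=> [A1 AM] hx; rewrite -[x^-1]mul1g; apply: AM. Qed.

Lemma subgroupM A x y : subgroup A -> A x -> A y -> A (x * y).
Proof.
by move=> hA hx hy; rewrite -[y]invgK; case: hA (subgroupV hA hy) => _ AM hy'; apply: AM.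
Qed.

Lemma transversal_inj A H s x y : left_transversal A H s -> H 1 ->
  x \in s -> y \in s -> H (y^-1 * x) -> x = y.
Proof.
move=> [_ sA uniq_rep] H1 xs ys h; have [z [_ uz]] := uniq_rep x (sA x xs).
by rewrite -(uz x) ?(uz y) //; split=> //; rewrite mulVg.
Qed.
End Transversals.

Section Stabilizers.
Variable R : realType.
Implicit Types (h : H2 R -> R[i]) (g : bijection (H2 R)) (A : set (bijection (H2 R))).

Lemma stabilizer1 A h : A 1%g -> stabilizer A h 1%g.
Proof. by move=> A1; split=> //; apply: generically_all => t; rewrite /act invg1. Qed.

Lemma act_stabilizer A h g g' : A (g'^-1 * g)%g -> (forall t, act g h t = act g' h t) ->
  stabilizer A h (g'^-1 * g)%g.
Proof.
move=> hA e; split=> //; apply: generically_all => t.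
transitivity (act g h (g' t)); first by rewrite /act invgM invgK.
by rewrite e /act; congr h; apply: bij_funK.
Qed.
End Stabilizers.

Section Good.
Context (R : realType) (F : fieldExtType rat) (s : F).
Context (i1 i2 : {rmorphism F -> R}) {G : golden s i1 i2}.
Local Notation C := (R[i]).
Implicit Types (h : H2 R -> C) (N : H2 R -> {mpoly C[2]}).

(** The properties that survive in each partial product of the equations; symmetry, automorphy and
    rationality are recovered only for the final coefficient. *)
Definition good h := holomorphic h /\ complex_expansion i1 i2 h.

Lemma eq_good h h' : h =1 h' -> good h -> good h'.
Proof. by move=> /funext ->. Qed.

Lemma good_cst c : good (fun=> c).
Proof. by split; [exact: holomorphic_cst|exact: (@has_expansion_cst _ _ _ _ _ _ _ _ c)]. Qed.

Lemma goodD h h' : good h -> good h' -> good (fun t => h t + h' t).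
Proof. by move=> [? ?] [? ?]; split; [exact: holomorphicD|exact: has_expansionD]. Qed.

Lemma goodM h h' : good h -> good h' -> good (fun t => h t * h' t).
Proof. by move=> [? ?] [? ?]; split; [exact: holomorphicM|exact: has_expansionM]. Qed.

Lemma goodX h n : good h -> good (fun t => h t ^+ n).
Proof.
move=> hh; elim: n => [|n IH]; first exact: good_cst.
by apply: eq_good (goodM hh IH) => t; rewrite exprS.
Qed.

Lemma good_sum I r (P : pred I) (h : I -> H2 R -> C) : (forall i, good (h i)) ->
  good (fun t => \sum_(i <- r | P i) h i t).
Proof.
move=> hh; elim: r => [|i r IH].
  by apply: eq_good (good_cst 0) => t; rewrite big_nil.
apply: (@eq_good (fun t => (if P i then h i t else 0) + \sum_(j <- r | P j) h j t)).
  by move=> t; rewrite big_cons; case: (P i) => //; rewrite add0r.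
by apply: goodD => //; case: (P i) => //; apply: good_cst.
Qed.

Lemma good_generic_neq0 h : good h -> (exists t, h t != 0) -> generically (fun t => h t != 0).
Proof. by move=> [hh [m [c [_ hc]]]]; apply: holomorphic_generic_neq0 hh (hc tt). Qed.

Definition good_poly N := forall m, good (fun t => (N t)@_m).

Lemma eq_good_poly N N' : N =1 N' -> good_poly N -> good_poly N'.
Proof. by move=> /funext ->. Qed.

Lemma good_poly_cst p : good_poly (fun=> p).
Proof. by move=> m; apply: good_cst. Qed.

Lemma good_polyC h : good h -> good_poly (fun t => (h t)%:MP).
Proof.
move=> hh m; apply: (@eq_good (fun t => h t * (m == 0%MM)%:R)).
  by move=> t; rewrite mcoeffC.
by apply: goodM => //; apply: good_cst.
Qed.

Lemma good_polyD N N' : good_poly N -> good_poly N' -> good_poly (fun t => N t + N' t).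
Proof.
move=> hN hN' m; apply: eq_good (goodD (hN m) (hN' m)) => t; by rewrite mcoeffD.
Qed.

Lemma good_polyM N N' : good_poly N -> good_poly N' -> good_poly (fun t => N t * N' t).
Proof.
move=> hN hN' m; apply: (@eq_good (fun t => \sum_(k : 'X_{1..2 < (mdeg m).+1, (mdeg m).+1} |
    m == (k.1 + k.2)%MM) (N t)@_k.1 * (N' t)@_k.2)).
  by move=> t; rewrite mcoeffM.
by apply: good_sum => k; apply: goodM.
Qed.

Lemma good_polyB N N' : good_poly N -> good_poly N' -> good_poly (fun t => N t - N' t).
Proof.
move=> hN hN'; apply: (@eq_good_poly (fun t => N t + (-1) * N' t)).
  by move=> t; rewrite mulN1r.
apply: good_polyD => //; apply: good_polyM => //; exact: good_poly_cst.
Qed.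

Lemma good_poly_prod I r (N : I -> H2 R -> {mpoly C[2]}) : (forall i, good_poly (N i)) ->
  good_poly (fun t => \prod_(i <- r) N i t).
Proof.
move=> hN; elim: r => [|i r IH].
  by apply: eq_good_poly (good_poly_cst 1) => t; rewrite big_nil.
by apply: (eq_good_poly _ (good_polyM (hN i) IH)) => t; rewrite big_cons.
Qed.
End Good.

(** * Clearing denominators *)

Section ClearDenominators.
Context (R : realType) (F : fieldExtType rat) (s : F).
Context (i1 i2 : {rmorphism F -> R}) {G : golden s i1 i2}.
Local Notation C := (R[i]).
Variables (K : eqType) (ks : seq K) (d : K -> H2 R -> C).
Hypotheses (ks_uniq : uniq ks) (d_good : forall k, k \in ks -> good i1 i2 (d k)).
Hypothesis d_neq0 : generically (fun t => forall k, k \in ks -> d k t != 0).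
Implicit Types (Psi : H2 R -> {mpoly C[2]}).

Definition cleared Psi := exists2 N, good_poly i1 i2 N &
  generically (fun t => (\prod_(k <- ks) d k t) *: Psi t = N t).

Lemma cleared_sum (I : eqType) (r : seq I) (Psi : I -> H2 R -> {mpoly C[2]}) :
  (forall i, i \in r -> cleared (Psi i)) -> cleared (fun t => \sum_(i <- r) Psi i t).
Proof.
elim: r => [|i r IH] hr.
  exists (fun=> 0); first exact: good_poly_cst.
  by apply: generically_all => t; rewrite big_nil scaler0.
have [N gN hN] := hr i (mem_head _ _).
have [j jr|N' gN' hN'] := IH; first by apply: hr; rewrite inE jr orbT.
exists (fun t => N t + N' t); first exact: good_polyD.
apply: generically_sub (generically_and hN hN') => t [e e'].
by rewrite big_cons scalerDr e e'.
Qed.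

Lemma cleared_prod (J : eqType) (l : seq J) (idx : J -> K) (a : J -> {mpoly C[2]})
    (b h : J -> H2 R -> C) :
  {in l, forall j, idx j \in ks} -> uniq l -> {in l &, injective idx} ->
  {in l, forall j, good i1 i2 (b j)} ->
  {in l, forall j t, h j t = b j t / d (idx j) t} ->
  cleared (fun t => \prod_(j <- l) (a j - (h j t)%:MP)).
Proof.
move=> lk ul inj gb hE.
(* The default 0 off [l] and [ks] is there because [good_poly_prod] asks for good factors at every
   index of the type. *)
exists (fun t => (\prod_(j <- l) (if j \in l then (d (idx j) t)%:MP * a j - (b j t)%:MP else 0)) *
   \prod_(k <- ks) (if k \in ks then if k \in map idx l then 1 else (d k t)%:MP else 0)).
  apply: good_polyM; apply: good_poly_prod => j.
    case jl: (j \in l); last exact: good_poly_cst.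
    apply: good_polyB; last by apply: good_polyC; apply: gb.
    apply: good_polyM; last exact: good_poly_cst.
    by apply: good_polyC; apply: d_good; apply: lk.
  case jk: (j \in ks); last exact: good_poly_cst.
  case: (j \in map idx l); first exact: good_poly_cst.
  by apply: good_polyC; apply: d_good.
apply: generically_sub d_neq0 => t d0.
rewrite [X in _ = _ * X](_ : _ = (\prod_(k <- ks | k \notin map idx l) d k t)%:MP); last first.
  rewrite rmorph_prod [RHS]big_mkcond big_seq [RHS]big_seq; apply: eq_bigr => k -> /=.
  by case: ifP.
have pl : perm_eq [seq k <- ks | k \in map idx l] (map idx l).
  apply: uniq_perm; rewrite ?filter_uniq ?map_inj_in_uniq // => k.
  by rewrite mem_filter andb_idr // => /mapP[j jl ->]; apply: lk.
rewrite (bigID (fun k => k \in map idx l)) /= -big_filter (perm_big _ pl) /= big_map.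
rewrite -scalerA -mul_mpolyC -scalerAr [RHS]mulrC [RHS]mul_mpolyC; congr (_ *: _).
rewrite rmorph_prod -big_split /= big_seq [RHS]big_seq.
apply: eq_bigr => j jl; rewrite jl mulrBr; congr (_ - _).
by rewrite -rmorphM /= hE // mulrC divfK // d0 // lk.
Qed.
End ClearDenominators.

(** * Gundlach generators and the degree bound *)

Lemma isobaricM v w p q : isobaric v p -> isobaric w q -> isobaric (v + w) (p * q).
Proof.
move=> hp hq m /msuppM_le /allpairsP[[m1 m2] /= [/hp <- /hq <- ->]].
by rewrite -big_split /=; apply: eq_bigr => i _; rewrite mnmDE mulnDl.
Qed.

Section Gundlach.
Context (R : realType) (F : fieldExtType rat) (s : F).
Context (i1 i2 : {rmorphism F -> R}) {G : golden s i1 i2}.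
Variables (F2 F6 F10 : H2 R -> R[i]).
Hypothesis FG : gundlach_generators i1 i2 F2 F6 F10.
Local Notation C := (R[i]).
Local Notation rational_form := (rational_form i1 i2).
Local Notation gens t := (fun i : 'I_3 => nth 0 [:: F2 t; F6 t; F10 t] (i : nat)).
Implicit Types (p q : {mpoly rat[3]}) (P Q : {mpoly rat[2]}) (t : H2 R).

Lemma gundlach_rational :
  [/\ rational_form 2 F2, rational_form 6 F6 & rational_form 10 F10].
Proof. by case: FG => h2 h6 h10 _; split; apply/sym_form_QP. Qed.

Lemma rational_form_polynomial w f : ~~ odd w -> rational_form w f ->
  exists2 p, isobaric w p & forall t, f t = eval_Q p (gens t).
Proof.
move=> ow /sym_form_QP hf; case: FG => _ _ _ /(_ w f ow hf) [p [[ip ep] _]].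
by exists p.
Qed.

Lemma isobaric_eval_inj w p q : ~~ odd w -> isobaric w p -> isobaric w q ->
  (forall t, eval_Q p (gens t) = eval_Q q (gens t)) -> p = q.
Proof.
move=> ow ip iq e; have [h2 h6 h10] := gundlach_rational.
have hp : rational_form w (fun t => eval_Q p (gens t)).
  exact: rational_form_isobaric.
have /sym_form_QP hs := hp.
case: FG => _ _ _ /(_ w _ ow hs) [x [_ ux]].
have ex : x = p.
  by apply: ux; split; [exact: ip|move=> t; exact: erefl].
by rewrite -ex; apply: ux; split; [exact: iq|exact: e].
Qed.

(** Otherwise the third variable and 0 would be two isobaric polynomials representing the same form
    of weight 10. *)
Lemma F10_neq0 : exists t, F10 t != 0.
Proof.
apply: contrapT => no; have F0 t : F10 t = 0.
  by apply/eqP; apply: contraT => nt; case: no; exists t.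
have iX : isobaric 10 'X_(inord 2).
  by move=> m; rewrite msuppX inE => /eqP ->; rewrite sumn3 !mnmE -!val_eqE /= inordK.
have i0 : isobaric 10 0 by move=> m; rewrite msupp0.
have : 'X_(inord 2) = 0 :> {mpoly rat[3]}.
  apply: (isobaric_eval_inj (w := 10) _ iX i0); first by [].
  by move=> t; rewrite eval_Q0 /eval_Q /map_mpoly mmapX mmap1U mevalXU inordK //=; apply: F0.
by move/eqP; rewrite -msupp_eq0 msuppX.
Qed.

Variables (b : F) (B : seq F).
Hypotheses (b_prime : prime_elt b) (b_pos : tot_positive i1 i2 b).
Hypothesis (B_res : residue_system b B).
Local Notation reps := (hecke_reps s b B).
Local Notation mob := (mobius2 i1 i2).
Local Notation G1 := (g1 F2 F10).
Local Notation G2 := (g2 F2 F6 F10).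
Local Notation Gam := (Gamma i1 i2).
Implicit Types (A M : 'M[F]_2) (K : 'M[F]_2 * bool).

Definition hecke_keys : seq ('M[F]_2 * bool) := [seq (A, e) | A <- reps, e <- [:: false; true]].

Definition hecke_map K t := mob K.1 (swap_if K.2 t).

Lemma hecke_keys_uniq : uniq hecke_keys.
Proof.
apply: allpairs_uniq => //; first exact: hecke_reps_uniq b_prime B_res.
by move=> [? ?] [? ?].
Qed.

Lemma hecke_keysP A e : (A, e) \in hecke_keys = (A \in reps).
Proof.
apply/allpairsP/idP => [[[A' e'] [/= hA _ [-> _]]] //|hA].
by exists (A, e); split=> //; case: e.
Qed.

Lemma prod_hecke_keys (f : H2 R -> C) t :
  \prod_(K <- hecke_keys) f (hecke_map K t) =
  hecke_prod s i1 i2 b B f t * hecke_prod s i1 i2 b B f (swap t).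
Proof.
rewrite big_allpairs /hecke_prod -big_split /=; apply: eq_bigr => A _.
by rewrite !big_cons big_nil mulr1.
Qed.

Lemma good_hecke_map w f K : K \in hecke_keys -> rational_form w f ->
  good i1 i2 (fun t => f (hecke_map K t)).
Proof.
case: K => A e; rewrite hecke_keysP => hA hf.
have hd : tot_positive i1 i2 (\det A).
  by apply: (hecke_posdet (s := s) b_pos); apply: hecke_reps_hecke hA.
have [a ha] := sym_form_Q_expansion ((sym_form_QP w f).2 hf).
have [h1 _ _ _] := hf.
have hm : good i1 i2 (fun t => f (mob A t)).
  split; first exact: holomorphic_mob.
  have {}ha : expansion i1 i2 5 (idfun : C -> C) (fun nu => ratr (a nu)) f.
    by case: ha => ha1 ha2; split=> // nu hn; apply: ha1; apply: contraNneq hn => ->; rewrite rmorph0.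
  have up x y z : A = mx2 x y 0 z -> complex_expansion i1 i2 (fun t => f (mob A t)).
    move=> eA; rewrite eA; move: hd; rewrite eA det_mx2 mulr0 subr0 => hd.
    by apply: (has_expansion_mob (I := unit) (x := fun=> y) (m := 5) (h := fun=> f)
      (psi := fun nu => chi i1 i2 (nu * y / z)) _ (fun=> ha)).
  by case/hecke_repsP: hA => [/up|[y _ /up]].
case: hm => h3 h4; case: e => //; split; first exact: (holomorphic_swap h3).
exact: (has_expansion_swap h4).
Qed.

(** The adjugate inverts [A] up to the scalar [\det A], and scalar matrices act trivially.
    Surjectivity carries a point where [F10] is nonzero over to each [F10 (hecke_map K t)]. *)
Lemma hecke_map_surj K t : K \in hecke_keys -> exists t', hecke_map K t' = t.
Proof.
case: K => A e; rewrite hecke_keysP => hA.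
have hd : tot_positive i1 i2 (\det A).
  by apply: (hecke_posdet (s := s) b_pos); apply: hecke_reps_hecke hA.
exists (swap_if e (mob (adj2 A) t)); rewrite /hecke_map /= swap_ifK -mobM //; last first.
  by rewrite /adj2 det_mx2 mulrNN [A 1 1 * _]mulrC -det2.
have [-> _] := mul_adj2 A; apply: val_inj; rewrite val_mob; last first.
  by rewrite det_scalar; case: hd => h1 h2; split; rewrite rmorphXn exprn_gt0.
have nz (i : {rmorphism F -> R}) : (i (\det A))%:C != 0.
  have b0 : \det A != 0 by apply: contraTneq hd.1 => ->; rewrite rmorph0 ltxx.
  by rewrite fmorph_eq0 fmorph_eq0.
have e1 (i : {rmorphism F -> R}) z : mobius i (\det A)%:M z = z.
  by rewrite /mobius !mxE /= !mulr1n !mulr0n !rmorph0 mul0r addr0 add0r mulrC mulKf.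
by rewrite !e1; case: (val t).
Qed.

Lemma F10_hecke_neq0 :
  generically (fun t => forall K, K \in hecke_keys -> F10 (hecke_map K t) != 0).
Proof.
have [_ _ h10] := gundlach_rational; have [t0 nt0] := F10_neq0.
have hK K : K \in hecke_keys -> generically (fun t => F10 (hecke_map K t) != 0).
  move=> KK; apply: (@good_generic_neq0 _ _ i1 i2); first exact: good_hecke_map h10.
  by have [t et] := hecke_map_surj t0 KK; exists t; rewrite et.
elim: hecke_keys hK => [|K l IH] hK; first exact: generically_all.
have [h1 h2] : generically (fun t => F10 (hecke_map K t) != 0) /\
    generically (fun t => forall K, K \in l -> F10 (hecke_map K t) != 0).
  split; first by apply: hK; rewrite mem_head.
  by apply: IH => K' K'l; apply: hK; rewrite inE K'l orbT.
apply: generically_sub (generically_and h1 h2) => t [e1 e2] K'.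
by rewrite inE => /predU1P[->|/e2].
Qed.

Lemma gundlach_invariant M t : Gam M -> G1 (mob M t) = G1 t /\ G2 (mob M t) = G2 t.
Proof.
move=> hM; have [[_ h2 _ _] [_ h6 _ _] [_ h10 _ _]] := gundlach_rational.
have j0 := autf_neq0 t (Gamma_posdet hM).
rewrite /g1 /g2 h2 // h6 // h10 //; move: (autf i1 i2 M t) j0 => j j0.
split.
  by rewrite exprMn -exprM -mulf_div divff ?mul1r // expf_neq0.
by rewrite exprMn -exprM mulrACA -exprD -mulf_div divff ?mul1r // expf_neq0.
Qed.

(** The Gamma-part of the normal form is absorbed by invariance. The same key serves both
    invariants, so equal keys imply equal actions on each of them. *)
Lemma ex_hecke_key : exists idx : bijection (H2 R) -> 'M[F]_2 * bool,
  forall g, Gamma0 i1 i2 g -> idx g \in hecke_keys /\ forall t,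
    act g (G1 \o scaleV i1 i2 b) t = G1 (hecke_map (idx g) t) /\
    act g (G2 \o scaleV i1 i2 b) t = G2 (hecke_map (idx g) t).
Proof.
have ex (g : bijection (H2 R)) : exists K, Gamma0 i1 i2 g -> K \in hecke_keys /\ forall t,
    act g (G1 \o scaleV i1 i2 b) t = G1 (hecke_map K t) /\
    act g (G2 \o scaleV i1 i2 b) t = G2 (hecke_map K t).
  have [hg|ng] := pselect (Gamma0 i1 i2 g); last by exists (0, false).
  have hV := subgroupV (generated_subgroup _) hg.
  have [A hA [M hM [e eA]]] := hecke_orbit b_prime b_pos B_res hV.
  exists (A, e) => _; split; first by rewrite hecke_keysP.
  by move=> t; rewrite /act /= eA; apply: gundlach_invariant.
by have [idx hidx] := choice ex; exists idx.
Qed.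

Local Notation G1b := (G1 \o scaleV i1 i2 b).
Local Notation G2b := (G2 \o scaleV i1 i2 b).
Local Notation Gam0 := (Gamma0 i1 i2).
Local Notation Gam1 := (stabilizer Gam0 G1b).
Local Notation Gam2 := (stabilizer Gam1 G2b).
Local Notation cleared := (cleared i1 i2 hecke_keys (fun K t => F10 (hecke_map K t))).

Lemma good_F2_hecke K : K \in hecke_keys -> good i1 i2 (fun t => F2 (hecke_map K t) ^+ 5).
Proof.
have [h2 _ _] := gundlach_rational => hK; apply: goodX; exact: good_hecke_map hK h2.
Qed.

Lemma good_F2_F6_hecke K : K \in hecke_keys ->
  good i1 i2 (fun t => F2 (hecke_map K t) ^+ 2 * F6 (hecke_map K t)).
Proof.
have [h2 h6 _] := gundlach_rational => hK; apply: goodM; last exact: good_hecke_map hK h6.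
by apply: goodX; apply: good_hecke_map hK h2.
Qed.

Lemma good_F10_hecke K : K \in hecke_keys -> good i1 i2 (fun t => F10 (hecke_map K t)).
Proof. have [_ _ h10] := gundlach_rational => hK; exact: good_hecke_map hK h10. Qed.

Lemma Gamma0_subgroup : subgroup Gam0.
Proof. exact: generated_subgroup. Qed.

(** Two elements of [s1] with the same key act identically on [G1b], hence represent the same coset
    of its stabilizer. *)
Lemma Psi1_cleared (s1 : seq (bijection (H2 R))) :
  left_transversal Gam0 Gam1 s1 -> cleared (Psi1 G1b s1).
Proof.
move=> T1; have [us sG _] := T1; have [idx hidx] := ex_hecke_key.
have Gam11 : Gam1 1%g by apply: stabilizer1; case: Gamma0_subgroup.
apply: (@cleared_prod _ _ _ _ _ G _ _ _ hecke_keys_uniq good_F10_hecke F10_hecke_neq0 _ s1 idx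
  (fun=> 'X_0) (fun g t => F2 (hecke_map (idx g) t) ^+ 5) (fun g => act g G1b)) => //.
- by move=> g /sG /hidx[].
- move=> g g' hg hg' e; apply: (transversal_inj T1) => //; apply: act_stabilizer.
  + by apply: (subgroupM Gamma0_subgroup); [apply: (subgroupV Gamma0_subgroup); apply: sG|apply: sG].
  + have [_ h] := hidx _ (sG _ hg); have [_ h'] := hidx _ (sG _ hg') => t.
    by rewrite (h t).1 (h' t).1 e.
- by move=> g /sG /hidx[hg _]; apply: good_F2_hecke.
- by move=> g /sG /hidx[_ h] t; case: (h t).
Qed.

(** Each summand is cleared by the same product: the sum type below lists its factors in both
    variables, and their keys are pairwise distinct. *)
Lemma Psi2_cleared (s1 s2 : seq (bijection (H2 R))) :
  left_transversal Gam0 Gam1 s1 -> left_transversal Gam1 Gam2 s2 ->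
  cleared (Psi2 G1b G2b s1 s2).
Proof.
move=> T1 T2; have [us1 sG1 _] := T1; have [us2 sG2 _] := T2; have [idx hidx] := ex_hecke_key.
have S0 := Gamma0_subgroup.
have Gam11 : Gam1 1%g by apply: stabilizer1; case: S0.
have Gam21 : Gam2 1%g by exact: stabilizer1.
apply: cleared_sum => g gs.
have hg : Gam0 g by exact: sG1.
have hg2 g' : g' \in s2 -> Gam0 (g * g')%g by move=> /sG2[h _]; exact: (subgroupM S0 hg h).
pose l : seq (bijection (H2 R) + bijection (H2 R)) :=
  map inl [seq g' <- s1 | g' != g] ++ map inr s2.
pose key (j : bijection (H2 R) + bijection (H2 R)) :=
  match j with inl g' => idx g' | inr g' => idx (g * g')%g end.
have lE j : j \in l -> match j with inl g' => g' \in s1 /\ g' <> g | inr g' => g' \in s2 end.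
  rewrite mem_cat => /orP[/mapP[g']|/mapP[g' hg' ->] //].
  by rewrite mem_filter => /andP[/eqP ne hg'] ->.
suff : cleared (fun t => \prod_(j <- l)
    (match j with inl _ => 'X_0 | inr _ => 'X_1 end -
     (match j with inl g' => act g' G1b | inr g' => act (g * g')%g G2b end t)%:MP)).
  move=> [N gN hN]; exists N => //; apply: generically_sub hN => t <-.
  by congr (_ *: _); rewrite big_cat /= !big_map big_filter.
(* [g2] fixes [G1b], so equal keys would make [g'] and [g] act alike on [G1b], that is g' = g, which
   the summand of [g] excludes. *)
have mixed g' g2 : g' \in s1 -> g' <> g -> g2 \in s2 -> idx g' = idx (g * g2)%g -> False.
  move=> h1 ne h2 e; apply: ne; apply: (transversal_inj T1) => //.
  have [_ st] := sG2 _ h2; split.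
    by apply: (subgroupM S0); [apply: (subgroupV S0)|apply: sG1].
  apply: generically_sub st => t <-.
  have [_ h] := hidx _ (sG1 _ h1); have [_ h'] := hidx _ (hg2 _ h2).
  transitivity (act g' G1b (g t)); first by rewrite /act invgM invgK.
  rewrite (h _).1 e -(h' _).1 /act invgM /=; congr (G1 (scaleV _ _ _ (_ _))).
  exact: bij_funK.
apply: (@cleared_prod _ _ _ _ _ G _ _ _ hecke_keys_uniq good_F10_hecke F10_hecke_neq0 _ l key _
  (fun j t => match j with
     | inl _ => F2 (hecke_map (key j) t) ^+ 5
     | inr _ => F2 (hecke_map (key j) t) ^+ 2 * F6 (hecke_map (key j) t) end)
  (fun j => match j with inl g' => act g' G1b | inr g' => act (g * g')%g G2b end)).
- by move=> [g'|g'] /lE; [case=> /sG1 /hidx[]|move=> /hg2 /hidx[]].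
- rewrite cat_uniq !map_inj_uniq ?filter_uniq ?us2 //; try by move=> ? ? [].
  by rewrite andbT; apply/hasPn => _ /mapP[g' _ ->]; apply/mapP => -[].
- move=> [g'|g'] [g''|g''] /lE h1 /lE h2 /= e.
  + case: h1 h2 => h1 _ [h2 _]; congr inl; apply: (transversal_inj T1) => //.
    apply: act_stabilizer.
      by apply: (subgroupM S0); [apply: (subgroupV S0)|]; apply: sG1.
    have [_ h] := hidx _ (sG1 _ h1); have [_ h'] := hidx _ (sG1 _ h2) => t.
    by rewrite (h t).1 (h' t).1 e.
  + by case: h1 => h1 ne; case: (mixed g' g'').
  + by case: h2 => h2 ne; case: (mixed g'' g').
  + congr inr; apply: (transversal_inj T2) => //.
    have [_ h] := hidx _ (hg2 _ h1); have [_ h'] := hidx _ (hg2 _ h2).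
    have shift f f' : (forall t, act (g * g')%g f t = act (g * g'')%g f' t) ->
        forall t, act g' f t = act g'' f' t.
      by move=> e' t; have := e' (g t); rewrite /act !invgM /= bij_funK.
    have [gg' _] := sG2 _ h1; have [gg'' _] := sG2 _ h2.
    apply: act_stabilizer; first apply: act_stabilizer.
    * by apply: (subgroupM S0) => //; apply: (subgroupV S0).
    * by apply: shift => t; rewrite (h t).1 (h' t).1 e.
    * by apply: shift => t; rewrite (h t).2 (h' t).2 e.
- move=> [g'|g'] /lE h; [apply: good_F2_hecke|apply: good_F2_F6_hecke].
    by case: h => /sG1 /hidx[].
  by have [] := hidx _ (hg2 _ h).
- move=> [g'|g'] /lE h t.
    by case: h => /sG1 /hidx[_ h] _; case: (h t).
  by have [_ /(_ t)[_ ->]] := hidx _ (hg2 _ h).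
Qed.

(** [P] and [Q] are homogenized to forms of the same weight 10 k, with k large enough for both. This
    makes the cleared coefficient a quotient of rational forms, hence a rational form of weight [W]
    to which Gundlach's theorem applies. *)
Lemma total_degree_cleared Psi f : cleared Psi -> is_coefficient G1 G2 Psi f ->
  (total_degree f <= (20 * (size B).+1) %/ 6)%N.
Proof.
move=> [N gN hN] [m [P [Q [Q0 -> hPQ]]]].
have [h2 h6 h10] := gundlach_rational.
pose W := (2 * (size reps * 10))%N.
have eW : (20 * (size B).+1 = W)%N by rewrite /W /= size_map; lia.
pose den t := \prod_(K <- hecke_keys) F10 (hecke_map K t).
have hden : rational_form W den.
  have -> : den = fun t => hecke_prod s i1 i2 b B F10 t * hecke_prod s i1 i2 b B F10 (swap t).
    by apply/funext => t; rewrite /den prod_hecke_keys.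
  exact: rational_form_hecke.
have oW : ~~ odd W by rewrite /W oddM.
pose k := maxn (msize P) (msize Q).
have sP : (msize P <= k.+1)%N by rewrite leqW // leq_maxl.
have sQ : (msize Q <= k.+1)%N by rewrite leqW // leq_maxr.
have iP := isobaric_homogenization sP; have iQ := isobaric_homogenization sQ.
have hP : rational_form (10 * k) (fun t => eval_Q (homogenization k P) (gens t)).
  exact: rational_form_isobaric.
have hQ : rational_form (10 * k) (fun t => eval_Q (homogenization k Q) (gens t)).
  exact: rational_form_isobaric.
have g10 : generically (fun t => F10 t != 0).
  have [a ha] := sym_form_Q_expansion ((sym_form_QP 10 F10).2 h10).
  apply: (@good_generic_neq0 _ _ i1 i2); last exact: F10_neq0.
  by case: h10 => h _ _ hr; split=> //; apply: rational_complex_expansion.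
have gall := generically_and g10 (generically_and hPQ (generically_and hN F10_hecke_neq0)).
(* If no point satisfied [X], the constants 0 and 1 would be generically equal. *)
have nonempty (X : H2 R -> Prop) : generically X -> exists t, X t.
  move=> gX; apply: contrapT => no.
  have := @holomorphic_generic_eq R (fun=> 0) (fun=> 1) (holomorphic_cst 0) (holomorphic_cst 1).
  have gX' : generically (fun t : H2 R => 0 = 1 :> C).
    by apply: generically_sub gX => t Xt; case: no; exists t.
  by move=> /(_ gX' (toH2 (0, 0)))/eqP; rewrite eq_sym oner_eq0.
have evE X t : (msize X <= k.+1)%N -> F10 t != 0 -> eval_Q (homogenization k X) (gens t) =
    F10 t ^+ k * eval_Q X (fun i : 'I_2 => nth 0 [:: G1 t; G2 t] i).
  by move=> sX t10; exact: eval_homogenization.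
have q0 : exists t, eval_Q (homogenization k Q) (gens t) != 0.
  have [t [t10 [[Qt _] _]]] := nonempty _ gall; exists t.
  by rewrite (evE _ _ sQ t10) mulf_neq0 // expf_neq0.
(* Generically this is N / den = P / Q multiplied out; both sides are holomorphic, so it holds at
   every point. *)
have NE t : (N t)@_m * eval_Q (homogenization k Q) (gens t) =
    den t * eval_Q (homogenization k P) (gens t).
  move: t; apply: holomorphic_generic_eq.
  - by apply: holomorphicM; [case: (gN m)|case: hQ].
  - by apply: holomorphicM; [case: hden|case: hP].
  apply: generically_sub gall => t [t10 [[Qt ePQ] [eN _]]].
  rewrite -eN mcoeffZ ePQ (evE _ _ sP t10) (evE _ _ sQ t10).
  set u := eval_Q P _; set v := eval_Q Q _; have v0 : v != 0 by exact: Qt.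
  by rewrite -/(den t) -[LHS]mulrA; congr (_ * _); rewrite mulrCA divfK.
have hNm : rational_form W (fun t => (N t)@_m).
  have [n1 n2] := gN m.
  exact: (rational_form_quotient n1 n2 hQ hden hP q0 NE).
have [pN iN eN] := rational_form_polynomial oW hNm.
have [pD iD eD] := rational_form_polynomial oW hden.
have pD0 : pD != 0.
  apply/eqP => pD0; have [t [_ [_ [_ ht]]]] := nonempty _ gall.
  have /eqP := eD t; rewrite pD0 eval_Q0 /den prodf_seq_eq0 => /hasP[K KK /=].
  by rewrite (negPf (ht K KK)).
rewrite eW; apply: (total_degree_isobaric_quotient iN iD pD0 sP sQ Q0).
apply: (isobaric_eval_inj (w := W + 10 * k)).
- by rewrite oddD negb_add (negPf oW) oddM.
- exact: isobaricM.
- exact: isobaricM.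
by move=> t; rewrite !eval_QM -eN -eD NE.
Qed.
End Gundlach.

Theorem proposition4p13 (R : realType) (F : fieldExtType rat) (sqrt5 : F)
    (sqrt5P : sqrt5 ^+ 2 = 5) (FE : <<1; sqrt5>>%VS = fullv)
    (i1 i2 : {rmorphism F -> R}) (i12 : ~ i1 =1 i2)
    (beta : F) (beta_prime : prime_elt beta) (beta_pos : tot_positive i1 i2 beta)
    (F2 F6 F10 : H2 R -> R[i]) (FG : gundlach_generators i1 i2 F2 F6 F10) :
  let G1 := g1 F2 F10 in
  let G2 := g2 F2 F6 F10 in
  let G1b := G1 \o scaleV i1 i2 beta in
  let G2b := G2 \o scaleV i1 i2 beta in
  let Gam0 := Gamma0 i1 i2 in
  let Gam1 := stabilizer Gam0 G1b in
  let Gam2 := stabilizer Gam1 G2b in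
  forall s1 s2 : seq (bijection (H2 R)),
    left_transversal Gam0 Gam1 s1 -> left_transversal Gam1 Gam2 s2 ->
  forall f : {fraction {mpoly rat[2]}},
    is_coefficient G1 G2 (Psi1 G1b s1) f \/
    is_coefficient G1 G2 (Psi2 G1b G2b s1 s2) f ->
  (total_degree f)%:R <= 10 * (norm i1 i2 beta + 1) / 3 :> R.
Proof.
move=> G1 G2 G1b G2b Gam0 Gam1 Gam2 s1 s2 T1 T2 f hf.
have G : golden sqrt5 i1 i2 by split.
have [Zb _ _ _] := beta_prime.
have nb : 0 < norm i1 i2 beta by case: beta_pos => b1 b2; apply: mulr_gt0.
have [B [sB B1 B2 B3 B4]] := ex_residues Zb nb.
have B_res : residue_system beta B by [].
(* 20/6 = 10/3, and [size B] is at most the norm of [beta]. *)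
suff : (total_degree f <= (20 * (size B).+1) %/ 6)%N.
  move=> le; have : (total_degree f * 3 <= 10 * (size B).+1)%N by lia.
  by rewrite -(ler_nat R) !natrM -[(size B).+1]addn1 natrD; lra.
case: hf => hf; apply: (total_degree_cleared FG beta_prime beta_pos B_res _ hf).
  exact: (Psi1_cleared FG beta_prime beta_pos B_res T1).
exact: (Psi2_cleared FG beta_prime beta_pos B_res T1 T2).
Qed.
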